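(* Let $f=(f_1,f_2)\in\Phi_{\geq 2}(\mathbb{C}^2,0)$ be a dicritical holomorphic map. Then there exist infinitely many robust parabolic curves for $f$ at the origin.
   Context: **Exponentials.** For a germ $X$ of holomorphic vector field at $0\in\mathbb{C}^2$ with $X(0)=0$, $\exp(X)$ denotes its time-one flow, i.e. $\exp(X)=\left(x+\sum_{n\ge1}\frac1{n!}X^n.x,\; y+\sum_{n\ge1}\frac1{n!}X^n.y\right)$, where $X.g$ is $X$ applied as a derivation to the function $g$ and $X^n.g=X.(X^{n-1}.g)$. $\Phi_{\ge2}(\mathbb{C}^2,0)$ is the set of germs $f=\exp(X)$ with $X$ a germ of holomorphic vector field whose order of vanishing at $0$ is at least $2$; such $f$ are tangent to the identity ($f(0)=0$, $df_0=\mathrm{Id}$). **Dicritical maps.** Let $g\neq\mathrm{Id}$ be a holomorphic self-map germ of a complex surface which is the identity on an irreducible curve $S$, and let $p\in S$. The order of $g$ on $S$ at $p$ is the largest $T$ such that $h\circ g-h\in\mathcal{I}(S)_p^T$ for all $h\in\mathcal{O}_p$, where $\mathcal{I}(S)_p\subset\mathcal{O}_p$ is the ideal of germs vanishing on $S$. The map $g$ is tangential on $S$ at $p$ if, for a local defining function $l$ of $S$ at $p$, $\frac{l\circ g-l}{l^T}\equiv0 \bmod \mathcal{I}(S)_p$. Let $f\ne\mathrm{Id}$ be tangent to the identity at $0\in\mathbb{C}^2$, let $\pi$ be the blow-up of the origin with exceptional divisor $D$, and let $\tilde f$ be the blow-up of $f$, i.e. the lift with $\pi\circ\tilde f=f\circ\pi$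 (which is the identity on $D$). Then $0$ is dicritical for $f$ (one says $f$ is dicritical) if $\tilde f$ is non-tangential on $D$; this does not depend on the point of $D$ considered. **Parabolic curves.** A parabolic curve for $f$ at the origin is an injective holomorphic map $\varphi:\Delta\to\mathbb{C}^2$ such that: (1) $\Delta\subset\mathbb{C}$ is a simply connected domain with $0\in\partial\Delta$; (2) $\varphi$ is continuous at the origin (extended by $\varphi(0)=0$); (3) $\varphi(\Delta)$ is invariant under $f$ and $(f|_{\varphi(\Delta)})^n\to0$ as $n\to\infty$. The same definition is used at a fixed point of a self-map of a complex surface. **Robust parabolic curves.** One can blow up $\varphi$ at level $1$ if $\pi^{-1}\circ\varphi$ extends continuously to $0$ with value a point of the exceptional divisor and is a parabolic curve for the lifted map $\tilde f$ at that point; one can blow up $\varphi$ at level $h$ if this can be repeated $h$ times, each time blowing up the limit point of the current lifted curve. A robust parabolic curve (RP curve) is a parabolic curve $\varphi$ such that: (1) $\varphi$ can be blown up at level $h$ for every $h\ge1$; (2) there is a formal power series $Q\in(\mathbb{C}[[\zeta]])^2$ such that for every $h\ge1$ there is $r_h>0$ with $\varphi-Q_h=O(\zeta^{h+1})$ on $\Delta_{r_h}$, where $Q_h$ is the truncation of $Q$ at degree $h$ and $\Delta_r=\Delta\cap\{|\zeta|<r\}$. **Counting convention.** RP curves are counted as attracting petals: they are counted up to the equivalence relation generated by inclusion of images, so that reparametrizations and restrictions to smaller invariant domains of the same petal are not counted separately. *)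

(* Defs.v *)
From Stdlib Require Export Reals Factorial Relations ClassicalEpsilon.
From Coquelicot Require Export Coquelicot.

Open Scope R_scope.
Open Scope C_scope.

Definition O2 : C * C := (RtoC 0, RtoC 0).

(** * Holomorphic functions of two variables *)

(* Germs of holomorphic functions at [p] are the convergent power series: the
   bound on the coefficients gives absolute convergence on the polydisc of
   radius [r], so that the order of summation (here by total degree) is
   immaterial. *)
Definition holomorphic2_at (g : C * C -> C) (p : C * C) : Prop :=
  exists (a : nat -> nat -> C) (r K : R),
    0 < r /\
    (forall i j, Cmod (a i j) * r ^ (i + j) <= K)%R /\
    (forall x y : C, Cmod x < r -> Cmod y < r ->
       is_series
         (fun n => sum_n (fun i => a i (n - i)%nat * x ^ i * y ^ (n - i)) n)
         (g (fst p + x, snd p + y))).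

Definition Dx (g : C * C -> C) : C * C -> C :=
  fun p => C_derive (fun t => g (t, snd p)) (fst p).

Definition Dy (g : C * C -> C) : C * C -> C :=
  fun p => C_derive (fun t => g (fst p, t)) (snd p).

Definition vanishes_to_order (k : nat) (g : C * C -> C) : Prop :=
  forall i j : nat, (i + j < k)%nat ->
    Nat.iter i Dx (Nat.iter j Dy g) O2 = RtoC 0.

(** * Exponentials of vector fields *)

Definition lie (X : C * C -> C * C) (g : C * C -> C) : C * C -> C :=
  fun p => fst (X p) * Dx g p + snd (X p) * Dy g p.

(* The term of index 0 of the two series is the coordinate function itself. *)
Definition is_exp (X f : C * C -> C * C) : Prop :=
  locally O2 (fun p : C * C =>
    is_series (fun n => / RtoC (INR (fact n)) * Nat.iter n (lie X) fst p)
      (fst (f p)) /\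
    is_series (fun n => / RtoC (INR (fact n)) * Nat.iter n (lie X) snd p)
      (snd (f p))).

Definition Phi_ge2 (f : C * C -> C * C) : Prop :=
  exists X : C * C -> C * C,
    holomorphic2_at (fun p => fst (X p)) O2 /\
    holomorphic2_at (fun p => snd (X p)) O2 /\
    vanishes_to_order 2 (fun p => fst (X p)) /\
    vanishes_to_order 2 (fun p => snd (X p)) /\
    is_exp X f.

(** * Complex surfaces and point blow-ups *)

(* A complex surface, presented by a local holomorphic parametrization
   [par m] centred at each point [m]: [par m O2 = m], and [par m] restricts to
   the inverse of a chart on some neighbourhood of the origin; its values far
   from the origin are irrelevant.  The compatibility of these charts is not
   part of the record, which is only used for [C2] and its iterated blow-ups. *)
Record surface := Surface {
  carrier :> Type;
  par : carrier -> C * C -> carrier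
}.
Arguments par {s} _ _.

Definition nbhs {M : surface} (m : M) : (M -> Prop) -> Prop :=
  filtermap (par m) (locally O2).

Definition C2 : surface :=
  Surface (C * C) (fun p z => (fst p + fst z, snd p + snd z)).

(* The projective line of directions: [Some v] is [1 : v], [None] is [0 : 1]. *)
Definition P1 : Type := option C.

Definition blowup_carrier (M : surface) (q : M) : Type :=
  ({m : M | m <> q} + P1)%type.

(* The point of the blow-up over [m], in the direction [l] when [m = q]. *)
Definition over {M : surface} (q m : M) (l : P1) : blowup_carrier M q :=
  match excluded_middle_informative (m = q) with
  | left _ => inr l
  | right ne => inl (exist _ m ne)
  end.

(* Near the direction [1 : v] the coordinates of [M] at [q] are
   [(z, z (w + v))]; near [0 : 1] they are [(z w, w)], and the direction
   is [z : 1]. *)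
Definition blowup_par {M : surface} (q : M) (m : blowup_carrier M q)
    (z : C * C) : blowup_carrier M q :=
  match m with
  | inl m0 => over q (par (proj1_sig m0) z) None
  | inr (Some v) =>
      over q (par q (fst z, fst z * (snd z + v))) (Some (snd z + v))
  | inr None =>
      over q (par q (fst z * snd z, snd z))
        (if Ceq_dec (fst z) (RtoC 0) then None else Some (/ fst z))
  end.

Definition blowup (M : surface) (q : M) : surface :=
  Surface (blowup_carrier M q) (blowup_par q).

Definition proj {M : surface} {q : M} (m : blowup M q) : M :=
  match m with inl m0 => proj1_sig m0 | inr _ => q end.

Definition exc_pt {M : surface} (q : M) (l : P1) : blowup M q := inr l.

Definition exc_div {M : surface} (q : M) (m : blowup M q) : Prop := proj m = q.

Definition holomorphic_fun {M : surface} (m : M) (h : M -> C) : Prop :=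
  holomorphic2_at (fun z => h (par m z)) O2.

Definition holomorphic_map {M N : surface} (m : M) (g : M -> N) : Prop :=
  exists G : C * C -> C * C,
    holomorphic2_at (fun z => fst (G z)) O2 /\
    holomorphic2_at (fun z => snd (G z)) O2 /\
    G O2 = O2 /\
    locally O2 (fun z : C * C => g (par m z) = par (g m) (G z)).

Definition holomorphic_curve {M : surface} (t : C) (phi : C -> M) : Prop :=
  exists G : C -> C * C,
    G t = O2 /\
    locally t (fun s : C =>
      phi s = par (phi t) (G s) /\
      ex_derive (K := C_AbsRing) (V := C_NormedModule) (fun u => fst (G u)) s /\
      ex_derive (K := C_AbsRing) (V := C_NormedModule) (fun u => snd (G u)) s).

(* A self-map [g] of a surface comes with a set [U] on which it is defined.
   The lift of [g] to the blow-up at [q] is defined over [U], except at the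
   points outside the exceptional divisor that [g] sends to [q]. *)
Definition lift_dom {M : surface} (q : M) (U : M -> Prop) (g : M -> M)
    (m : blowup M q) : Prop :=
  U (proj m) /\ (proj m = q \/ g (proj m) <> q).

Definition is_lift {M : surface} (q : M) (U : M -> Prop) (g : M -> M)
    (g' : blowup M q -> blowup M q) : Prop :=
  forall m, lift_dom q U g m ->
    holomorphic_map m g' /\ proj (g' m) = g (proj m).

(** * Tangential and dicritical maps *)

Definition vanishing_ideal {M : surface} (S : M -> Prop) (p : M)
    (h : M -> C) : Prop :=
  holomorphic_fun p h /\ nbhs p (fun m => S m -> h m = RtoC 0).

(* Powers of an ideal [I] of the local ring at [p]: finite sums of products of
   [T] elements of [I], with [ideal_pow p I 0] the whole local ring. *)
Inductive ideal_pow {M : surface} (p : M) (I : (M -> C) -> Prop) :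
    nat -> (M -> C) -> Prop :=
| ideal_pow_O h : holomorphic_fun p h -> ideal_pow p I 0 h
| ideal_pow_mul T a b :
    I a -> ideal_pow p I T b -> ideal_pow p I (S T) (fun m => a m * b m)
| ideal_pow_add T a b :
    ideal_pow p I T a -> ideal_pow p I T b ->
    ideal_pow p I T (fun m => a m + b m)
| ideal_pow_germ T a b :
    nbhs p (fun m => a m = b m) -> ideal_pow p I T a -> ideal_pow p I T b.

Definition contact_ge {M : surface} (g : M -> M) (S : M -> Prop) (p : M)
    (T : nat) : Prop :=
  forall h, holomorphic_fun p h ->
    ideal_pow p (vanishing_ideal S p) T (fun m => h (g m) - h m).

Definition is_order_on {M : surface} (g : M -> M) (S : M -> Prop) (p : M)
    (T : nat) : Prop :=
  contact_ge g S p T /\ forall T', contact_ge g S p T' -> (T' <= T)%nat.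

Definition defining_function {M : surface} (S : M -> Prop) (p : M)
    (l : M -> C) : Prop :=
  vanishing_ideal S p l /\
  forall a, vanishing_ideal S p a ->
    exists b, holomorphic_fun p b /\ nbhs p (fun m => a m = b m * l m).

(* [k] is the quotient of [l \o g - l] by [l ^ T], in the local ring at [p]. *)
Definition tangential_at {M : surface} (g : M -> M) (S : M -> Prop) (p : M)
    : Prop :=
  exists T l k,
    is_order_on g S p T /\ defining_function S p l /\
    nbhs p (fun m => l (g m) - l m = k m * l m ^ T) /\
    vanishing_ideal S p k.

Definition dicritical (U : C2 -> Prop) (f : C2 -> C2) : Prop :=
  ~ nbhs (O2 : C2) (fun p => f p = p) /\
  exists f' : blowup C2 O2 -> blowup C2 O2,
    is_lift (O2 : C2) U f f' /\
    forall l : P1, ~ tangential_at f' (exc_div (O2 : C2)) (exc_pt (O2 : C2) l).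

(** * Parabolic curves *)

Definition unit_interval (t : R) : Prop := (0 <= t <= 1)%R.

Definition unit_square (st : R * R) : Prop :=
  unit_interval (fst st) /\ unit_interval (snd st).

Definition path_in (D : C -> Prop) (gamma : R -> C) : Prop :=
  continuous_on unit_interval gamma /\ forall t, unit_interval t -> D (gamma t).

Definition path_connected (D : C -> Prop) : Prop :=
  forall a b, D a -> D b ->
    exists gamma, path_in D gamma /\ gamma 0%R = a /\ gamma 1%R = b.

Definition null_homotopic (D : C -> Prop) (gamma : R -> C) : Prop :=
  exists H : R * R -> C,
    continuous_on unit_square H /\
    (forall st, unit_square st -> D (H st)) /\
    (forall t, unit_interval t -> H (0%R, t) = gamma t) /\
    (forall t, unit_interval t -> H (1%R, t) = gamma 0%R) /\
    (forall s, unit_interval s ->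
       H (s, 0%R) = gamma 0%R /\ H (s, 1%R) = gamma 0%R).

Definition simply_connected (D : C -> Prop) : Prop :=
  path_connected D /\
  forall gamma, path_in D gamma -> gamma 0%R = gamma 1%R ->
    null_homotopic D gamma.

Definition boundary_point (D : C -> Prop) (z : C) : Prop :=
  forall N : C -> Prop, locally z N ->
    (exists t, N t /\ D t) /\ (exists t, N t /\ ~ D t).

Definition parabolic_curve {M : surface} (U : M -> Prop) (g : M -> M) (q : M)
    (Delta : C -> Prop) (phi : C -> M) : Prop :=
  g q = q /\
  open Delta /\ simply_connected Delta /\ boundary_point Delta (RtoC 0) /\
  (forall t, Delta t -> holomorphic_curve t phi) /\
  (forall s t, Delta s -> Delta t -> phi s = phi t -> s = t) /\
  filterlim phi (within Delta (locally (RtoC 0))) (nbhs q) /\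
  (forall t, Delta t ->
     U (phi t) /\ exists s, Delta s /\ g (phi t) = phi s) /\
  (forall t, Delta t ->
     filterlim (fun n => Nat.iter n g (phi t)) eventually (nbhs q)).

(** * Robust parabolic curves *)

Fixpoint can_blow_up (h : nat) {M : surface} (U : M -> Prop) (g : M -> M)
    (q : M) (Delta : C -> Prop) (phi : C -> M) {struct h} : Prop :=
  match h with
  | O => True
  | S h' =>
      exists (g' : blowup M q -> blowup M q) (psi : C -> blowup M q) (l : P1),
        is_lift q U g g' /\
        (forall t, Delta t -> phi t <> q /\ proj (psi t) = phi t) /\
        parabolic_curve (lift_dom q U g) g' (exc_pt q l) Delta psi /\
        can_blow_up h' (lift_dom q U g) g' (exc_pt q l) Delta psi
  end.

Record curve := Curve { cdom : C -> Prop; cmap : C -> C2 }.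

(* [Q k] is the coefficient of degree [k] of the formal power series. *)
Definition has_asymptotic_expansion (c : curve) (Q : nat -> C * C) : Prop :=
  forall h : nat, (1 <= h)%nat ->
    exists r K : R, 0 < r /\
      forall t, cdom c t -> Cmod t < r ->
        (Cmod (fst (cmap c t) - sum_n (fun k => fst (Q k) * t ^ k)%C h)
           <= K * Cmod t ^ (h + 1))%R /\
        (Cmod (snd (cmap c t) - sum_n (fun k => snd (Q k) * t ^ k)%C h)
           <= K * Cmod t ^ (h + 1))%R.

Definition RP_curve (U : C2 -> Prop) (f : C2 -> C2) (c : curve) : Prop :=
  parabolic_curve U f (O2 : C2) (cdom c) (cmap c) /\
  (forall h : nat, (1 <= h)%nat ->
     can_blow_up h U f (O2 : C2) (cdom c) (cmap c)) /\
  exists Q, has_asymptotic_expansion c Q.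

Definition RP_included (U : C2 -> Prop) (f : C2 -> C2) (c d : curve) : Prop :=
  RP_curve U f c /\ RP_curve U f d /\
  forall t, cdom c t -> exists s, cdom d s /\ cmap c t = cmap d s.

Definition same_petal (U : C2 -> Prop) (f : C2 -> C2) : curve -> curve -> Prop :=
  clos_refl_sym_trans curve (RP_included U f).

(* Main.v *)
(* Let X be the generator of f and X_k its leading homogeneous part.  If X_k is
   not a multiple of the Euler field, the blow-up of f is tangential at every
   direction where the discriminant of X_k does not vanish; so f dicritical means
   X_k = P (x d/dx + y d/dy).  Then the blow-up of X is x^k times a field
   transverse to the exceptional divisor at the directions v with P(1, v) <> 0,
   and its leaf through v is the graph y = x (v + u(x)) of a convergent series.
   The flow of X, hence f, preserves the leaf, on which f is
   t -> t + P(1, v) t^k + ..., with an attracting petal.  The petal, inside an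
   analytic graph, survives all blow-ups: each blow-up divides y by x, and the
   lift stays tangent to the identity because it fixes the tangent of the curve.
   Orbits in petals over different v tend to different points of the exceptional
   divisor, which separates the petals. *)

Require Import Defs.
From Stdlib Require Import Arith Lra Lia Psatz Rcomplete.
Open Scope R_scope.

(** * Series of complex numbers *)

(** All the analysis rests on the algebra of power series with a weighted l^1 norm. It is complete,
    so products, substitution, inversion and Picard iteration stay inside it with explicit bounds.
    Since [Phi_ge2] gives f only as the sum of a Lie series, the estimates on f come from flows
    defined for complex times of modulus up to 2: their Taylor series at time 0, evaluated at time
    1, is that Lie series. Two obstacles shape the geometry. The lift in [dicritical] is an unknown
    map, so it has to be identified near each direction [1 : v] with an explicit formula before
    tangentiality can be computed. And a [surface] carries no chart axioms, so the few local
    properties used at a blown-up point are stated separately and carried through the tower of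
    blow-ups. A petal is a narrow triangle around an attracting direction: being convex, it is
    simply connected, and no Fatou coordinate is built. The infinitely many directions v are taken
    in a punctured disc around 0 where P(1, v) has no zero. *)

Ltac rmin_bounds :=
  repeat match goal with
  | H : context [Rmin ?a ?b] |- _ =>
    lazymatch goal with
    | _ : Rmin a b <= a |- _ => fail
    | _ => generalize (Rmin_l a b) (Rmin_r a b); intros ? ?
    end
  end.

(** The index n is excluded, unlike in [sum_n]: starting from the empty sum makes inductions and
    shifts uniform. [sum_n_csum] translates. *)
Fixpoint csum (a : nat -> C) (n : nat) : C :=
  match n with O => 0%C | S m => (csum a m + a m)%C end.

Fixpoint rsum (a : nat -> R) (n : nat) : R :=
  match n with O => 0 | S m => rsum a m + a m end.

(** Convergence for [Cmod], kept free of filters; [is_series_ser] identifies it with [is_series]. *)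
Definition ser (a : nat -> C) (l : C) : Prop :=
  forall eps, 0 < eps ->
    exists N, forall n, (N <= n)%nat -> Cmod (csum a n - l) < eps.

Lemma Cmod_minus_sym (x y : C) : Cmod (x - y) = Cmod (y - x).
Proof. rewrite <- Cmod_opp. f_equal. ring. Qed.

Lemma Cmod_triangle_minus (x y : C) : Cmod (x - y) <= Cmod x + Cmod y.
Proof.
  unfold Cminus. rewrite <- (Cmod_opp y). apply Cmod_triangle.
Qed.

Lemma Cmod_lower (x y : C) : Cmod x - Cmod y <= Cmod (x - y).
Proof.
  generalize (Cmod_triangle (x - y) y).
  replace (x - y + y)%C with x by ring. lra.
Qed.

Lemma Cmod_real s : 0 <= s -> Cmod (RtoC s) = s.
Proof. intros. rewrite Cmod_R. apply Rabs_right. lra. Qed.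

Lemma Cmod_minus_0 (x : C) : Cmod (x - 0) = Cmod x.
Proof. f_equal. ring. Qed.

Lemma Cmod_diag (x : C) : Cmod (x - x) = 0.
Proof. replace (x - x)%C with (RtoC 0) by ring. apply Cmod_0. Qed.

Lemma Cminus_eq0 (x y : C) : (x - y)%C = 0%C -> x = y.
Proof. intros e. replace x with (x - y + y)%C by ring. rewrite e. ring. Qed.

Lemma Cmod_small_eq0 (x : C) : (forall eps, 0 < eps -> Cmod x <= eps) -> x = 0%C.
Proof.
  intros H. apply Cmod_eq_0. destruct (Cmod_ge_0 x) as [h|h]; [|easy].
  specialize (H (Cmod x / 2)). lra.
Qed.

Lemma pow_le_low x j k : 0 <= x <= 1 -> (j <= k)%nat -> x ^ k <= x ^ j.
Proof.
  intros hx hjk. replace k with (j + (k - j))%nat by lia. rewrite pow_add.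
  assert (x ^ (k - j) <= 1 ^ (k - j)) by (apply pow_incr; lra). rewrite pow1 in *.
  assert (0 <= x ^ j) by now apply pow_le. nra.
Qed.

Lemma mul_le_of_le_div c x d : 0 < c -> x <= d / c -> c * x <= d.
Proof.
  intros hc h. apply Rle_trans with (c * (d / c)); [apply Rmult_le_compat_l; lra|].
  apply Req_le. field. lra.
Qed.

(** Supplies the small real test points at which a quantity is shown to be null or small. *)
Lemma small_real K d e : 0 < d -> 0 < e -> exists s, 0 < s /\ s < d /\ s <= 1 /\ K * s <= e.
Proof.
  intros hd he. assert (k0 := Rabs_pos K). assert (k1 := Rle_abs K).
  set (c := Rabs K + 1). assert (he' : 0 < e / c) by (apply Rdiv_lt_0_compat; unfold c; lra).
  exists (Rmin (Rmin (d / 2) 1) (e / c)).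
  assert (p : 0 < Rmin (Rmin (d / 2) 1) (e / c)) by (repeat apply Rmin_glb_lt; lra).
  rmin_bounds. repeat split; try lra.
  set (s := Rmin _ _) in *. apply Rle_trans with (c * s); [unfold c; nra|].
  apply mul_le_of_le_div; unfold c in *; lra.
Qed.

Lemma csum_ext (a b : nat -> C) n :
  (forall k, (k < n)%nat -> a k = b k) -> csum a n = csum b n.
Proof.
  induction n as [|n IH]; cbn [csum rsum]; intros H; [easy|].
  rewrite IH, (H n); auto with arith.
Qed.

Lemma rsum_ext (a b : nat -> R) n :
  (forall k, (k < n)%nat -> a k = b k) -> rsum a n = rsum b n.
Proof.
  induction n as [|n IH]; cbn [csum rsum]; intros H; [easy|].
  rewrite IH, (H n); auto with arith.
Qed.

Lemma csum_plus (a b : nat -> C) n :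
  csum (fun k => a k + b k)%C n = (csum a n + csum b n)%C.
Proof. induction n as [|n IH]; cbn [csum rsum]; [|rewrite IH]; ring. Qed.

Lemma csum_scal (c : C) (a : nat -> C) n :
  csum (fun k => c * a k)%C n = (c * csum a n)%C.
Proof. induction n as [|n IH]; cbn [csum rsum]; [|rewrite IH]; ring. Qed.

Lemma csum_0 (a : nat -> C) n :
  (forall k, (k < n)%nat -> a k = 0%C) -> csum a n = 0%C.
Proof.
  induction n as [|n IH]; cbn [csum rsum]; intros H; [easy|].
  rewrite IH, (H n); auto with arith. ring.
Qed.

Lemma csum_shift (a : nat -> C) n :
  csum a (S n) = (a O + csum (fun k => a (S k)) n)%C.
Proof. induction n as [|n IH]; cbn [csum rsum] in *; [ring|]. rewrite IH. ring. Qed.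

Lemma rsum_shift (a : nat -> R) n :
  rsum a (S n) = a O + rsum (fun k => a (S k)) n.
Proof. induction n as [|n IH]; cbn [csum rsum] in *; [ring|]. rewrite IH. ring. Qed.

Lemma rsum_scal (c : R) (a : nat -> R) n :
  rsum (fun k => c * a k) n = c * rsum a n.
Proof. induction n as [|n IH]; cbn [csum rsum]; [|rewrite IH]; ring. Qed.

Lemma rsum_plus (a b : nat -> R) n :
  rsum (fun k => a k + b k) n = rsum a n + rsum b n.
Proof. induction n as [|n IH]; cbn [csum rsum]; [|rewrite IH]; ring. Qed.

Lemma rsum_le (a b : nat -> R) n :
  (forall k, (k < n)%nat -> a k <= b k) -> rsum a n <= rsum b n.
Proof.
  induction n as [|n IH]; cbn [csum rsum]; intros H; [lra|].
  apply Rplus_le_compat; auto with arith.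
Qed.

Lemma rsum_ge0 (a : nat -> R) n : (forall k, 0 <= a k) -> 0 <= rsum a n.
Proof.
  intros H; induction n as [|n IH]; cbn [csum rsum]; [lra|]. specialize (H n). lra.
Qed.

Lemma rsum_mono (a : nat -> R) n m :
  (forall k, 0 <= a k) -> (n <= m)%nat -> rsum a n <= rsum a m.
Proof.
  intros H; induction 1 as [|m h IH]; cbn [csum rsum]; [lra|]. specialize (H m). lra.
Qed.

Lemma rsum_term (a : nat -> R) n k :
  (forall k, 0 <= a k) -> (k < n)%nat -> a k <= rsum a n.
Proof.
  intros H h. apply Rle_trans with (rsum a (S k)).
  - cbn [rsum]. generalize (rsum_ge0 a k H). lra.
  - apply rsum_mono; auto.
Qed.

Lemma rsum_switch (b : nat -> nat -> R) m n :
  rsum (fun i => rsum (b i) n) m = rsum (fun j => rsum (fun i => b i j) m) n.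
Proof.
  induction m as [|m IH]; cbn [csum rsum].
  - symmetry. induction n as [|n IHn]; cbn [csum rsum]; [easy|]. rewrite IHn. ring.
  - rewrite IH, rsum_plus. easy.
Qed.

Lemma csum_Cmod (a : nat -> C) n :
  Cmod (csum a n) <= rsum (fun k => Cmod (a k)) n.
Proof.
  induction n as [|n IH]; cbn [csum rsum]; [rewrite Cmod_0; lra|].
  eapply Rle_trans; [apply Cmod_triangle|]. lra.
Qed.

Lemma csum_dist (a b : nat -> C) n :
  (csum a n - csum b n)%C = csum (fun k => a k - b k)%C n.
Proof. induction n as [|n IH]; cbn [csum rsum]; [|rewrite <- IH]; ring. Qed.

Lemma csum_cut (a : nat -> C) m n :
  (m <= n)%nat ->
  Cmod (csum a n - csum a m) <= rsum (fun k => Cmod (a k)) n - rsum (fun k => Cmod (a k)) m.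
Proof.
  induction 1 as [|n h IH]; cbn [csum rsum].
  - replace (csum a m - csum a m)%C with (RtoC 0) by ring. rewrite Cmod_0. lra.
  - replace (csum a n + a n - csum a m)%C with ((csum a n - csum a m) + a n)%C by ring.
    eapply Rle_trans; [apply Cmod_triangle|]. lra.
Qed.

(** Some partial sum comes within [eps] of the supremum, and all later ones lie between the two. *)
Lemma bounded_cauchy (B : nat -> R) (tot : R) :
  (forall k, 0 <= B k) -> (forall n, rsum B n <= tot) ->
  forall eps, 0 < eps ->
    exists M, forall n, (M <= n)%nat -> rsum B n - rsum B M < eps.
Proof.
  intros hB ht eps he.
  destruct (completeness (fun x => exists n, x = rsum B n)) as [l [l1 l2]].
  - exists tot. intros x [n ->]. apply ht.
  - exists 0. now exists O.
  - assert (exists M, l - eps < rsum B M) as [M hM].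
    { apply NNPP. intros hn. assert (l <= l - eps); [|lra]. apply l2.
      intros x [n ->]. apply Rnot_lt_le. intros hh. apply hn. now exists n. }
    exists M. intros n hn. assert (rsum B n <= l) by (apply l1; now exists n). lra.
Qed.

Lemma ser_ext (a b : nat -> C) l : (forall n, a n = b n) -> ser a l -> ser b l.
Proof.
  intros h ha eps he. destruct (ha eps he) as [N hN]. exists N. intros n hn.
  rewrite <- (csum_ext a b); auto.
Qed.

Lemma ser_unique (a : nat -> C) l l' : ser a l -> ser a l' -> l = l'.
Proof.
  intros h h'. apply Cminus_eq0, Cmod_small_eq0. intros eps he.
  destruct (h (eps/2)) as [N hN]; [lra|]. destruct (h' (eps/2)) as [N' hN']; [lra|].
  specialize (hN (N + N')%nat). specialize (hN' (N + N')%nat).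
  assert (h1 : (N <= N + N')%nat) by lia. assert (h2 : (N' <= N + N')%nat) by lia.
  specialize (hN h1). specialize (hN' h2).
  replace (l - l')%C with ((csum a (N+N') - l') - (csum a (N+N') - l))%C by ring.
  eapply Rle_trans; [apply Cmod_triangle_minus|]. lra.
Qed.

Lemma ser_plus (a b : nat -> C) l m :
  ser a l -> ser b m -> ser (fun n => a n + b n)%C (l + m)%C.
Proof.
  intros ha hb eps he.
  destruct (ha (eps/2)) as [N hN]; [lra|]. destruct (hb (eps/2)) as [N' hN']; [lra|].
  exists (N + N')%nat. intros n hn. rewrite csum_plus.
  replace (csum a n + csum b n - (l + m))%C with ((csum a n - l) + (csum b n - m))%C by ring.
  eapply Rle_lt_trans; [apply Cmod_triangle|].
  assert (h1 : (N <= n)%nat) by lia. assert (h2 : (N' <= n)%nat) by lia.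
  specialize (hN n h1). specialize (hN' n h2). lra.
Qed.

Lemma ser_scal (c : C) (a : nat -> C) l : ser a l -> ser (fun n => c * a n)%C (c * l)%C.
Proof.
  intros ha eps he.
  assert (hc := Cmod_ge_0 c).
  destruct (ha (eps/(Cmod c + 1))) as [N hN]; [apply Rdiv_lt_0_compat; lra|].
  exists N. intros n hn. rewrite csum_scal.
  replace (c * csum a n - c * l)%C with (c * (csum a n - l))%C by ring.
  rewrite Cmod_mult. specialize (hN n hn).
  assert (h1 := Cmod_ge_0 (csum a n - l)).
  apply Rle_lt_trans with ((Cmod c) * (eps / (Cmod c + 1))).
  - apply Rmult_le_compat_l; lra.
  - replace eps with ((Cmod c + 1) * (eps / (Cmod c + 1))) at 2 by (field; lra).
    apply Rmult_lt_compat_r; [apply Rdiv_lt_0_compat|]; lra.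
Qed.

Lemma ser_0 : ser (fun _ => 0%C) 0%C.
Proof.
  intros eps he. exists O. intros n _. rewrite csum_0; auto.
  replace (0 - 0)%C with (RtoC 0) by ring. now rewrite Cmod_0.
Qed.

Lemma ser_minus (a b : nat -> C) l m :
  ser a l -> ser b m -> ser (fun n => a n - b n)%C (l - m)%C.
Proof.
  intros ha hb. apply ser_ext with (fun n => a n + (-(1)) * b n)%C; [intros; ring|].
  replace (l - m)%C with (l + (-(1)) * m)%C by ring.
  now apply ser_plus, ser_scal.
Qed.

Lemma ser_csum (b : nat -> nat -> C) (c : nat -> C) n :
  (forall k, (k < n)%nat -> ser (fun m => b m k) (c k)) ->
  ser (fun m => csum (b m) n) (csum c n).
Proof.
  induction n as [|n IH]; cbn [csum rsum]; intros h; [apply ser_0|].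
  apply ser_plus; auto.
Qed.

Lemma ser_shift (a : nat -> C) l :
  ser a (a O + l)%C <-> ser (fun n => a (S n)) l.
Proof.
  split; intros h eps he; destruct (h eps he) as [N hN].
  - exists N. intros n hn. specialize (hN (S n)). rewrite csum_shift in hN.
    replace (csum (fun k => a (S k)) n - l)%C with
      (a O + csum (fun k => a (S k)) n - (a O + l))%C by ring. auto.
  - exists (S N). intros [|n] hn; [lia|]. rewrite csum_shift.
    replace (a O + csum (fun k => a (S k)) n - (a O + l))%C
      with (csum (fun k => a (S k)) n - l)%C by ring. apply hN. lia.
Qed.

Lemma ser_finite (a : nat -> C) n :
  (forall k, (n <= k)%nat -> a k = 0%C) -> ser a (csum a n).
Proof.
  intros h eps he. exists n. intros m hm.
  replace (csum a m) with (csum a n).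
  { replace (csum a n - csum a n)%C with (RtoC 0) by ring. now rewrite Cmod_0. }
  induction hm as [|m hm IH]; cbn [csum rsum]; [easy|]. rewrite <- IH, h; auto. ring.
Qed.

Lemma ser_le (a : nat -> C) l B :
  (forall n, Cmod (csum a n) <= B) -> ser a l -> Cmod l <= B.
Proof.
  intros hB h. apply Rnot_lt_le. intros hl.
  destruct (h (Cmod l - B)) as [N hN]; [lra|].
  specialize (hN N (le_n _)). specialize (hB N).
  rewrite Cmod_minus_sym in hN. generalize (Cmod_lower l (csum a N)). lra.
Qed.

Lemma ser_bound (a : nat -> C) l B :
  (forall n, rsum (fun k => Cmod (a k)) n <= B) -> ser a l -> Cmod l <= B.
Proof.
  intros hB. apply ser_le. intros n. eapply Rle_trans; [apply csum_Cmod|]. apply hB.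
Qed.

Lemma Re_le (x y : C) : Rabs (fst x - fst y) <= Cmod (x - y).
Proof. apply (re_le_Cmod (x - y)). Qed.

Lemma Im_le (x y : C) : Rabs (snd x - snd y) <= Cmod (x - y).
Proof.
  eapply Rle_trans; [|apply Rmax_Cmod]. apply (Rmax_r _ (Rabs (snd (x - y)%C))).
Qed.

Lemma Cmod_le_parts (x : C) : Cmod x <= Rabs (fst x) + Rabs (snd x).
Proof.
  unfold Cmod. rewrite <- (sqrt_Rsqr (Rabs (fst x) + Rabs (snd x))).
  - apply sqrt_le_1_alt. unfold Rsqr.
    rewrite <- (pow2_abs (fst x)), <- (pow2_abs (snd x)).
    generalize (Rabs_pos (fst x)) (Rabs_pos (snd x)). nra.
  - generalize (Rabs_pos (fst x)) (Rabs_pos (snd x)). lra.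
Qed.

(** Blocks of the series are dominated by blocks of the moduli; completeness is that of R, applied
    to real and imaginary parts. *)
Lemma ser_abs_conv (a : nat -> C) B :
  (forall n, rsum (fun k => Cmod (a k)) n <= B) -> exists l, ser a l.
Proof.
  intros hB.
  assert (hc := bounded_cauchy _ B (fun k => Cmod_ge_0 (a k)) hB).
  assert (cau : forall eps, 0 < eps -> exists N, forall n m, (n >= N)%nat -> (m >= N)%nat ->
     Cmod (csum a n - csum a m) < eps).
  { intros eps he. destruct (hc (eps/2)) as [M hM]; [lra|]. exists M. intros n m hn hm.
    replace (csum a n - csum a m)%C with
      ((csum a n - csum a M) - (csum a m - csum a M))%C by ring.
    eapply Rle_lt_trans; [apply Cmod_triangle_minus|].
    generalize (csum_cut a M n hn) (csum_cut a M m hm) (hM n hn) (hM m hm). lra. }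
  destruct (Rcomplete.R_complete (fun n => fst (csum a n))) as [x hx].
  { intros eps he. destruct (cau eps he) as [N hN]. exists N. intros n m hn hm.
    eapply Rle_lt_trans; [apply Re_le|]. auto. }
  destruct (Rcomplete.R_complete (fun n => snd (csum a n))) as [y hy].
  { intros eps he. destruct (cau eps he) as [N hN]. exists N. intros n m hn hm.
    eapply Rle_lt_trans; [apply Im_le|]. auto. }
  exists (x, y). intros eps he.
  destruct (hx (eps/2)) as [N hN]; [lra|]. destruct (hy (eps/2)) as [N' hN']; [lra|].
  exists (N + N')%nat. intros n hn.
  assert (h1 : (n >= N)%nat) by lia. assert (h2 : (n >= N')%nat) by lia.
  specialize (hN n h1). specialize (hN' n h2). unfold Rdist in *.
  eapply Rle_lt_trans; [apply Cmod_le_parts|]. simpl. unfold Rminus in *. lra.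
Qed.

(* Tannery's theorem, applied to the partial sums in the second index. *)
Lemma ser_fubini (b : nat -> nat -> C) (B : nat -> R) (tot : R) (s c : nat -> C) (l : C) :
  (forall m n, rsum (fun k => Cmod (b m k)) n <= B m) ->
  (forall n, rsum B n <= tot) ->
  (forall m, ser (b m) (s m)) -> ser s l ->
  (forall n, ser (fun m => b m n) (c n)) -> ser c l.
Proof.
  intros hb hB hs hl hc.
  assert (B0 : forall k, 0 <= B k) by (intros k; apply (hb k O)).
  intros eps he.
  (* Rows from M on are controlled by the tail of [B], uniformly in n; the finitely many earlier
     rows are close to their sums for n large. A tail row counts twice, for its partial sum and for
     its limit, hence eps/4 + 2 (eps/4). *)
  destruct (bounded_cauchy B tot B0 hB (eps/4)) as [M hM]; [lra|].
  assert (K : forall M, exists N, forall n, (N <= n)%nat ->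
     rsum (fun m => Cmod (csum (b m) n - s m)) M <= eps/4).
  { clear M hM. intros M.
    cut (forall d, 0 < d -> exists N, forall n, (N <= n)%nat ->
     rsum (fun m => Cmod (csum (b m) n - s m)) M <= d).
    { intros h. apply h. lra. }
    induction M as [|M IH]; cbn [csum rsum]; intros d hd.
    - exists O. intros. lra.
    - destruct (IH (d/2)) as [N hN]; [lra|].
      destruct (hs M (d/2)) as [N' hN']; [lra|].
      exists (N + N')%nat. intros n hn.
      assert (h1 : (N <= n)%nat) by lia. assert (h2 : (N' <= n)%nat) by lia.
      specialize (hN n h1). specialize (hN' n h2). lra. }
  destruct (K M) as [N hN]. exists N. intros n hn. specialize (hN n hn).
  assert (hser : ser (fun m => csum (b m) n - s m)%C (csum c n - l)%C).
  { apply ser_minus; [|easy]. apply ser_csum. auto. }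
  apply Rle_lt_trans with (eps/4 + 2 * (eps/4)); [|lra].
  eapply ser_bound; [|exact hser]. intros q.
  assert (dom : forall m, Cmod (csum (b m) n - s m) <= 2 * B m).
  { intros m. eapply Rle_trans; [apply Cmod_triangle_minus|].
    assert (Cmod (csum (b m) n) <= B m).
    { eapply Rle_trans; [apply csum_Cmod|]. apply hb. }
    assert (Cmod (s m) <= B m) by (eapply ser_bound; eauto). lra. }
  set (u := fun m => Cmod (csum (b m) n - s m)) in *.
  assert (u0 : forall k, 0 <= u k) by (intros; apply Cmod_ge_0).
  destruct (le_lt_dec q M) as [hq|hq].
  { generalize (rsum_mono u q M u0 hq). lra. }
  assert (rsum u q - rsum u M <= 2 * (rsum B q - rsum B M)).
  { assert (hq' : (M <= q)%nat) by lia. clear - dom hq'.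
    induction hq' as [|q h IH]; cbn [csum rsum]; [lra|]. specialize (dom q). fold (u q) in dom. lra. }
  assert (hq' : (M <= q)%nat) by lia. specialize (hM q hq'). lra.
Qed.

(** * Power series in two variables *)

(* The homogeneous part of degree [n], and the sum of the moduli of its
   coefficients. *)
Definition hom (a : nat -> nat -> C) (n : nat) (x y : C) : C :=
  csum (fun i => a i (n - i)%nat * x ^ i * y ^ (n - i))%C (S n).

Definition hn (a : nat -> nat -> C) (n : nat) : R :=
  rsum (fun i => Cmod (a i (n - i)%nat)) (S n).

(* On the closed polydisc of radius [r], [h] is the sum of a series of weighted
   l^1 norm at most [N]; these norms are submultiplicative and complete. *)
Definition expan (r N : R) (a : nat -> nat -> C) (h : C -> C -> C) : Prop :=
  0 < r /\ (forall n, rsum (fun k => hn a k * r ^ k) n <= N) /\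
  forall x y, Cmod x <= r -> Cmod y <= r -> ser (fun n => hom a n x y) (h x y).

Definition an (r N : R) (h : C -> C -> C) : Prop := exists a, expan r N a h.

Lemma hn_ge0 a n : 0 <= hn a n.
Proof. apply rsum_ge0. intros. apply Cmod_ge_0. Qed.

Lemma hn_pow_ge0 a n r : 0 <= r -> 0 <= hn a n * r ^ n.
Proof. intros h. apply Rmult_le_pos; [apply hn_ge0|now apply pow_le]. Qed.

Lemma hom_bound a n x y r :
  Cmod x <= r -> Cmod y <= r -> Cmod (hom a n x y) <= hn a n * r ^ n.
Proof.
  intros hx hy. unfold hom, hn. eapply Rle_trans; [apply csum_Cmod|].
  rewrite Rmult_comm, <- rsum_scal. apply rsum_le. intros k hk.
  rewrite !Cmod_mult, !Cmod_pow. replace (r ^ n) with (r ^ k * r ^ (n - k)).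
  - rewrite (Rmult_comm (r ^ k * r ^ (n - k))), Rmult_assoc.
    apply Rmult_le_compat_l; [apply Cmod_ge_0|].
    assert (0 <= Cmod x) by apply Cmod_ge_0. assert (0 <= Cmod y) by apply Cmod_ge_0.
    apply Rmult_le_compat; try (apply pow_le; easy); apply pow_incr; lra.
  - rewrite <- pow_add. f_equal. lia.
Qed.

Lemma expan_N_ge0 r N a h : expan r N a h -> 0 <= N.
Proof. intros (hr & hN & _). apply (hN O). Qed.

Lemma an_N_ge0 r N h : an r N h -> 0 <= N.
Proof. intros [a ha]. eapply expan_N_ge0; eauto. Qed.

Lemma an_r_gt0 r N h : an r N h -> 0 < r.
Proof. now intros [a [ha _]]. Qed.

Lemma an_bound r N h x y : an r N h -> Cmod x <= r -> Cmod y <= r -> Cmod (h x y) <= N.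
Proof.
  intros [a (hr & hN & hs)] hx hy. eapply ser_bound; [|apply hs; auto].
  intros n. eapply Rle_trans; [|apply (hN n)]. apply rsum_le. intros. now apply hom_bound.
Qed.

Lemma an_weaken r N N' h : an r N h -> N <= N' -> an r N' h.
Proof.
  intros [a (hr & hN & hs)] hh. exists a. split; [easy|]. split; [|easy].
  intros n. eapply Rle_trans; [apply hN|easy].
Qed.

Lemma expan_shrink r r' N a h : expan r N a h -> 0 < r' <= r -> expan r' N a h.
Proof.
  intros (hr & hN & hs) [h1 h2]. split; [easy|]. split.
  - intros n. eapply Rle_trans; [|apply hN]. apply rsum_le. intros k _.
    apply Rmult_le_compat_l; [apply hn_ge0|]. apply pow_incr. lra.
  - intros x y hx hy. apply hs; lra.
Qed.

Lemma an_shrink r r' N h : an r N h -> 0 < r' <= r -> an r' N h.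
Proof. intros [a ha] hr. exists a. eapply expan_shrink; eauto. Qed.

Lemma an_ext r N h h' :
  (forall x y, Cmod x <= r -> Cmod y <= r -> h x y = h' x y) -> an r N h -> an r N h'.
Proof.
  intros e [a (hr & hN & hs)]. exists a. split; [easy|]. split; [easy|].
  intros x y hx hy. rewrite <- e; auto.
Qed.

Lemma expan_00 r N a h : expan r N a h -> h (RtoC 0) (RtoC 0) = a O O.
Proof.
  intros (hr & _ & hs). replace (a O O) with (csum (fun n => hom a n 0 0) 1) by (unfold hom; simpl; ring).
  apply (ser_unique (fun n => hom a n 0 0)); [apply hs; rewrite Cmod_0; lra|].
  apply ser_finite. intros k hk. apply csum_0. intros i hi.
  destruct i as [|i]; simpl; [|ring]. replace (k - 0)%nat with (S (k - 1)) by lia. simpl; ring.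
Qed.

Lemma expan_term r N a h i j : expan r N a h -> Cmod (a i j) * r ^ (i + j) <= N.
Proof.
  intros (hr & hN & _). apply Rle_trans with (2 := hN (S (i + j))).
  apply Rle_trans with (hn a (i + j) * r ^ (i + j)).
  - apply Rmult_le_compat_r; [apply pow_le; lra|].
    replace j with (i + j - i)%nat at 1 by lia.
    apply (rsum_term (fun k => Cmod (a k (i + j - k)%nat))); [|lia].
    intros. apply Cmod_ge_0.
  - apply (rsum_term (fun k => hn a k * r ^ k)); [|lia].
    intros. apply hn_pow_ge0. lra.
Qed.

Definition cst_coef (c : C) (i j : nat) : C :=
  match i, j with O, O => c | _, _ => RtoC 0 end.

Lemma expan_cst r c : 0 < r -> expan r (Cmod c) (cst_coef c) (fun _ _ => c).
Proof.
  intros hr.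
  assert (z : forall k j, (0 < k + j)%nat -> cst_coef c k j = 0%C)
    by (intros [|k] [|j]; simpl; [lia|easy..]).
  split; [easy|]. split.
  - intros [|n]; [apply Cmod_ge_0|].
    rewrite rsum_shift, (rsum_ext _ (fun _ => 0 * 0)), rsum_scal.
    + unfold hn. simpl. lra.
    + intros k _. unfold hn. rewrite (rsum_ext _ (fun _ => 0 * 0)), rsum_scal; [ring|].
      intros i hi. rewrite z, Cmod_0 by lia. ring.
  - intros x y _ _.
    assert (e : csum (fun n => hom (cst_coef c) n x y) 1 = c)
      by (unfold hom; cbn [csum]; simpl; ring).
    refine (eq_ind _ (ser _) (ser_finite _ 1 _) _ e).
    intros k hk. unfold hom. apply csum_0. intros i hi.
    rewrite z by lia. ring.
Qed.

Lemma an_const r c : 0 < r -> an r (Cmod c) (fun _ _ => c).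
Proof. intros hr. exists (cst_coef c). now apply expan_cst. Qed.

Definition sx_coef (a : nat -> nat -> C) (i j : nat) : C :=
  match i with O => RtoC 0 | S i' => a i' j end.

Lemma hom_sx a n x y : hom (sx_coef a) (S n) x y = (x * hom a n x y)%C.
Proof.
  unfold hom. rewrite csum_shift, <- csum_scal. simpl sx_coef.
  rewrite (csum_ext _ (fun k => x * (a k (n - k)%nat * x ^ k * y ^ (n - k)))%C).
  - ring.
  - intros k _. change (S n - S k)%nat with (n - k)%nat. simpl. ring.
Qed.

Lemma hom_sx0 a x y : hom (sx_coef a) 0 x y = 0%C.
Proof. unfold hom. simpl. ring. Qed.

Lemma hn_sx a n : hn (sx_coef a) (S n) = hn a n.
Proof.
  unfold hn. rewrite rsum_shift. simpl sx_coef. rewrite Cmod_0, Rplus_0_l.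
  apply rsum_ext. easy.
Qed.

Lemma expan_mul_x r N a h :
  expan r N a h -> expan r (r * N) (sx_coef a) (fun x y => x * h x y)%C.
Proof.
  intros he. assert (hN0 := expan_N_ge0 _ _ _ _ he). destruct he as (hr & hN & hs).
  split; [easy|]. split.
  - intros [|n].
    + simpl. apply Rmult_le_pos; lra.
    + rewrite rsum_shift. unfold hn at 1. simpl rsum at 1. rewrite Cmod_0.
      rewrite (rsum_ext _ (fun k => r * (hn a k * r ^ k))), rsum_scal.
      * specialize (hN n). nra.
      * intros k _. rewrite hn_sx. simpl. ring.
  - intros x y hx hy.
    replace (x * h x y)%C with (hom (sx_coef a) 0 x y + x * h x y)%C
      by (rewrite hom_sx0; ring).
    apply (ser_shift (fun n => hom (sx_coef a) n x y)).
    apply ser_ext with (fun n => x * hom a n x y)%C.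
    + intros n. now rewrite hom_sx.
    + apply ser_scal. auto.
Qed.

Lemma an_mul_x r N h : an r N h -> an r (r * N) (fun x y => x * h x y)%C.
Proof. intros [a ha]. exists (sx_coef a). now apply expan_mul_x. Qed.

Lemma csum_rev (a : nat -> C) n : csum a (S n) = csum (fun k => a (n - k)%nat) (S n).
Proof.
  induction n as [|n IH]; [easy|]. rewrite (csum_shift (fun k => a (S n - k)%nat)).
  change (csum a (S (S n))) with (csum a (S n) + a (S n))%C.
  rewrite IH. change (S n - 0)%nat with (S n). rewrite Cplus_comm. f_equal.
Qed.

Lemma rsum_rev (a : nat -> R) n : rsum a (S n) = rsum (fun k => a (n - k)%nat) (S n).
Proof.
  induction n as [|n IH]; [easy|]. rewrite (rsum_shift (fun k => a (S n - k)%nat)).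
  change (rsum a (S (S n))) with (rsum a (S n) + a (S n)).
  rewrite IH. change (S n - 0)%nat with (S n). rewrite Rplus_comm. f_equal.
Qed.

(** Exchanging the variables lets each statement about y be read off from the one about x. *)
Lemma expan_swap r N a h :
  expan r N a h -> expan r N (fun i j => a j i) (fun x y => h y x).
Proof.
  intros (hr & hN & hs). split; [easy|]. split.
  - intros n. rewrite <- (rsum_ext (fun k => hn a k * r ^ k)); [easy|].
    intros k _. f_equal. unfold hn. rewrite rsum_rev. apply rsum_ext. intros i hi.
    do 3 f_equal. lia.
  - intros x y hx hy. apply ser_ext with (fun n => hom a n y x); [|auto].
    intros n. unfold hom. rewrite csum_rev. apply csum_ext. intros k hk.
    replace (n - (n - k))%nat with k by lia. ring.
Qed.

Lemma an_swap r N h : an r N h -> an r N (fun x y => h y x).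
Proof. intros [a ha]. exists (fun i j => a j i). now apply expan_swap. Qed.

Lemma an_mul_y r N h : an r N h -> an r (r * N) (fun x y => y * h x y)%C.
Proof.
  intros h1. apply (an_swap _ _ (fun x y => x * h y x)%C), an_mul_x. now apply an_swap.
Qed.

Lemma expan_plus r N N' a b h g :
  expan r N a h -> expan r N' b g ->
  expan r (N + N') (fun i j => a i j + b i j)%C (fun x y => h x y + g x y)%C.
Proof.
  intros (hr & hN & hs) (hr' & hN' & hs'). split; [easy|]. split.
  - intros n. apply Rle_trans with (rsum (fun k => hn a k * r ^ k + hn b k * r ^ k) n).
    + apply rsum_le. intros k _. rewrite <- Rmult_plus_distr_r.
      apply Rmult_le_compat_r; [apply pow_le; lra|]. unfold hn. rewrite <- rsum_plus.
      apply rsum_le. intros. apply Cmod_triangle.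
    + rewrite rsum_plus. generalize (hN n) (hN' n). lra.
  - intros x y hx hy. apply ser_ext with (fun n => hom a n x y + hom b n x y)%C.
    + intros n. unfold hom. rewrite <- csum_plus. apply csum_ext. intros. ring.
    + apply ser_plus; auto.
Qed.

Lemma expan_scal r N a h c :
  expan r N a h -> expan r (Cmod c * N) (fun i j => c * a i j)%C (fun x y => c * h x y)%C.
Proof.
  intros (hr & hN & hs). split; [easy|]. split.
  - intros n. rewrite (rsum_ext _ (fun k => Cmod c * (hn a k * r ^ k))), rsum_scal.
    + apply Rmult_le_compat_l; [apply Cmod_ge_0|easy].
    + intros k _. unfold hn. rewrite (rsum_ext _ (fun i => Cmod c * Cmod (a i (k-i)%nat))).
      * rewrite rsum_scal. ring.
      * intros. apply Cmod_mult.
  - intros x y hx hy. apply ser_ext with (fun n => c * hom a n x y)%C.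
    + intros n. unfold hom. rewrite <- csum_scal. apply csum_ext. intros. ring.
    + apply ser_scal; auto.
Qed.

Lemma an_plus r N N' h g :
  an r N h -> an r N' g -> an r (N + N') (fun x y => h x y + g x y)%C.
Proof. intros [a ha] [b hb]. eexists. apply expan_plus; eauto. Qed.

Lemma an_scal r N h c : an r N h -> an r (Cmod c * N) (fun x y => c * h x y)%C.
Proof. intros [a ha]. eexists. apply expan_scal; eauto. Qed.

Lemma an_opp r N h : an r N h -> an r N (fun x y => - h x y)%C.
Proof.
  intros h1. apply an_ext with (fun x y => (-(1)) * h x y)%C; [intros; ring|].
  replace N with (Cmod (-(1))%C * N); [now apply an_scal|]. rewrite Cmod_m1. ring.
Qed.

Lemma an_0 r : 0 < r -> an r 0 (fun _ _ => RtoC 0).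
Proof. intros. apply an_weaken with (Cmod 0); [now apply an_const|rewrite Cmod_0; lra]. Qed.

Lemma an_1 r : 0 < r -> an r 1 (fun _ _ => RtoC 1).
Proof. intros. apply an_weaken with (Cmod 1); [now apply an_const|rewrite Cmod_1; lra]. Qed.

Lemma an_x r : 0 < r -> an r r (fun x _ => x).
Proof.
  intros hr. apply an_ext with (fun x _ => x * 1)%C; [intros; ring|].
  replace r with (r * 1) at 2 by ring. now apply an_mul_x, an_1.
Qed.

Lemma an_y r : 0 < r -> an r r (fun _ y => y).
Proof. intros hr. apply (an_swap _ _ (fun x _ => x)). now apply an_x. Qed.

Lemma an_csum r (N : nat -> R) h n :
  0 < r -> (forall k, (k < n)%nat -> an r (N k) (h k)) ->
  an r (rsum N n) (fun x y => csum (fun k => h k x y) n).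
Proof.
  intros hr. induction n as [|n IH]; intros H; cbn [csum rsum]; [now apply an_0|].
  apply (an_plus _ _ _ (fun x y => csum (fun k => h k x y) n)); auto.
Qed.

Lemma ser_lim_Cmod (a : nat -> C) l :
  ser a l -> is_lim_seq (fun n => Cmod (csum a n)) (Cmod l).
Proof.
  intros h. apply is_lim_seq_spec. intros eps. destruct (h eps (cond_pos eps)) as [N hN].
  exists N. intros n hn. specialize (hN n hn). apply Rle_lt_trans with (2 := hN).
  apply Rabs_le. split; [|apply Cmod_lower]. rewrite Cmod_minus_sym.
  generalize (Cmod_lower l (csum a n)). lra.
Qed.

Lemma lim_rsum (u : nat -> nat -> R) (v : nat -> R) n :
  (forall k, (k < n)%nat -> is_lim_seq (fun m => u m k) (v k)) ->
  is_lim_seq (fun m => rsum (u m) n) (rsum v n).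
Proof.
  induction n as [|n IH]; intros h; cbn [rsum]; [apply is_lim_seq_const|].
  apply is_lim_seq_plus'; auto.
Qed.

Lemma choice_nat {T : Type} (P : nat -> T -> Prop) :
  (forall n, exists t, P n t) -> exists u, forall n, P n (u n).
Proof.
  intros h. exists (fun n => proj1_sig (constructive_indefinite_description _ (h n))).
  intros n. apply (proj2_sig (constructive_indefinite_description _ (h n))).
Qed.

(** Completeness of the weighted l^1 space. The coefficients of degree i + j of [h m] are at most
    [N m / r ^ (i + j)], hence summable in m, and Tannery's theorem exchanges the sum over m with
    the sum over the degrees. *)
Lemma an_series r (N : nat -> R) B (h : nat -> C -> C -> C) H :
  0 < r -> (forall m, an r (N m) (h m)) -> (forall n, rsum N n <= B) ->
  (forall x y, Cmod x <= r -> Cmod y <= r -> ser (fun m => h m x y) (H x y)) ->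
  an r B H.
Proof.
  intros hr ha hB hs. destruct (choice_nat _ ha) as [a ea].
  assert (N0 : forall m, 0 <= N m) by (intros m; eapply an_N_ge0; eauto).
  assert (cv : forall i j, exists l, ser (fun m => a m i j) l).
  { intros i j. apply ser_abs_conv with (B / r ^ (i + j)). intros n.
    apply Rmult_le_reg_r with (r ^ (i + j)); [now apply pow_lt|].
    unfold Rdiv. rewrite Rmult_assoc, Rinv_l, Rmult_1_r by (apply pow_nonzero; lra).
    apply Rle_trans with (2 := hB n). rewrite Rmult_comm, <- rsum_scal.
    apply rsum_le. intros m _. rewrite Rmult_comm. exact (expan_term _ _ _ _ i j (ea m)). }
  assert (cv' : forall i, exists u : nat -> C, forall j, ser (fun m => a m i j) (u j))
    by (intros i; exact (choice_nat (fun j l => ser (fun m => a m i j) l) (cv i))).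
  destruct (choice_nat _ cv') as [A hA]. exists A. split; [easy|]. split.
  - intros n.
    (* For a finite sum over m the norm bound is the triangle inequality; on a finite block of
       degrees it passes to the limit. *)
    assert (L : is_lim_seq
       (fun M => rsum (fun k => rsum (fun i => Cmod (csum (fun m => a m i (k-i)%nat) M)) (S k) * r ^ k) n)
       (rsum (fun k => hn A k * r ^ k) n)).
    { apply lim_rsum. intros k _. apply (is_lim_seq_scal_r _ (r ^ k) (hn A k)).
      apply lim_rsum. intros i _. now apply ser_lim_Cmod. }
    refine (is_lim_seq_le _ (fun _ => B) _ _ _ L (is_lim_seq_const B)). intros M.
    apply Rle_trans with (2 := hB M).
    apply Rle_trans with (rsum (fun k => rsum (fun m => hn (a m) k * r ^ k) M) n).
    + apply rsum_le. intros k _.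
      rewrite (rsum_ext (fun m => hn (a m) k * r ^ k) (fun m => r ^ k * hn (a m) k)),
        rsum_scal by (intros; ring).
      rewrite Rmult_comm. apply Rmult_le_compat_l; [apply pow_le; lra|].
      unfold hn. rewrite rsum_switch. apply rsum_le. intros i _. apply csum_Cmod.
    + rewrite rsum_switch. apply rsum_le. intros m _. apply (ea m).
  - intros x y hx hy. eapply ser_fubini with (B := N) (tot := B)
      (b := fun m n => hom (a m) n x y) (s := fun m => h m x y).
    + intros m n. destruct (ea m) as (_ & hN & _). apply Rle_trans with (2 := hN n).
      apply rsum_le. intros k _. now apply hom_bound.
    + easy.
    + intros m. now apply (ea m).
    + auto.
    + intros n. unfold hom. apply ser_csum. intros k _.
      replace (A k (n - k)%nat * x ^ k * y ^ (n - k))%C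
         with (x ^ k * y ^ (n - k) * A k (n - k)%nat)%C by ring.
      apply ser_ext with (fun m => x ^ k * y ^ (n - k) * a m k (n - k)%nat)%C.
      * intros. ring.
      * now apply ser_scal.
Qed.

Lemma an_mono_mul r N h i j :
  an r N h -> an r (r ^ i * r ^ j * N) (fun x y => x ^ i * y ^ j * h x y)%C.
Proof.
  intros hh. induction i as [|i IH].
  - induction j as [|j IHj].
    + apply an_ext with h; [intros; simpl; ring|]. apply an_weaken with N; [easy|]. simpl; lra.
    + apply an_ext with (fun x y => y * (x ^ 0 * y ^ j * h x y))%C; [intros; simpl; ring|].
      replace (r ^ 0 * r ^ S j * N) with (r * (r ^ 0 * r ^ j * N)) by (simpl; ring).
      now apply an_mul_y.
  - apply an_ext with (fun x y => x * (x ^ i * y ^ j * h x y))%C; [intros; simpl; ring|].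
    replace (r ^ S i * r ^ j * N) with (r * (r ^ i * r ^ j * N)) by (simpl; ring).
    now apply an_mul_x.
Qed.

(** Multiplying g by x^i y^j multiplies its norm by at most r^(i+j); summing over the monomials of h
    gives the product of the norms. *)
Lemma an_mult r N N' h g :
  an r N h -> an r N' g -> an r (N * N') (fun x y => h x y * g x y)%C.
Proof.
  intros [a (hr & hN & hs)] hg. assert (N'0 := an_N_ge0 _ _ _ hg).
  apply an_series with (N := fun n => hn a n * r ^ n * N')
    (h := fun n x y => (hom a n x y * g x y)%C); [easy| | |].
  - intros n. unfold hom, hn.
    apply an_ext with (fun x y => csum (fun i => a i (n - i)%nat *
       (x ^ i * y ^ (n - i) * g x y))%C (S n)).
    { intros x y _ _. rewrite (Cmult_comm _ (g x y)), <- csum_scal. apply csum_ext.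
      intros. ring. }
    rewrite (Rmult_comm (rsum _ _)), (Rmult_comm _ N'), <- Rmult_assoc, <- rsum_scal.
    apply an_csum; [easy|]. intros k hk.
    replace (N' * r ^ n * Cmod (a k (n - k)%nat)) with
      (Cmod (a k (n - k)%nat) * (r ^ k * r ^ (n - k) * N')).
    + apply (an_scal _ _ (fun x y => x ^ k * y ^ (n - k) * g x y)%C). now apply an_mono_mul.
    + rewrite <- pow_add. replace (k + (n - k))%nat with n by lia. ring.
  - intros n. rewrite (rsum_ext _ (fun k => N' * (hn a k * r ^ k))), rsum_scal.
    + rewrite (Rmult_comm N). apply Rmult_le_compat_l; auto.
    + intros. ring.
  - intros x y hx hy. rewrite (Cmult_comm (h x y)).
    apply ser_ext with (fun n => g x y * hom a n x y)%C; [intros; ring|].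
    apply ser_scal. auto.
Qed.

Lemma an_pow r N h n : an r N h -> an r (N ^ n) (fun x y => h x y ^ n)%C.
Proof.
  intros hh. assert (hr := an_r_gt0 _ _ _ hh). induction n as [|n IH]; simpl.
  - now apply an_1.
  - now apply an_mult.
Qed.

(** The norms of u and w are at most the radius [rho] of g, so a monomial of degree n turns into a
    function of norm at most [rho ^ n] and the norm of g is not increased. Constant terms in u and w
    are allowed, which recentering and Picard iteration rely on. *)
Lemma an_comp rho Ng g r u w :
  an rho Ng g -> an r rho u -> an r rho w -> an r Ng (fun x y => g (u x y) (w x y)).
Proof.
  intros [b (hrho & hN & hs)] hu hw. assert (hr := an_r_gt0 _ _ _ hu).
  apply an_series with (N := fun n => hn b n * rho ^ n)
    (h := fun n x y => hom b n (u x y) (w x y)); [easy| |easy|].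
  - intros n. unfold hom, hn. rewrite Rmult_comm, <- rsum_scal.
    apply an_csum; [easy|]. intros k hk.
    apply an_ext with (fun x y => b k (n - k)%nat * (u x y ^ k * w x y ^ (n - k)))%C.
    { intros. ring. }
    replace (rho ^ n * Cmod (b k (n - k)%nat)) with
      (Cmod (b k (n - k)%nat) * (rho ^ k * rho ^ (n - k))).
    + apply (an_scal _ _ (fun x y => u x y ^ k * w x y ^ (n - k))%C).
      apply an_mult; now apply an_pow.
    + rewrite <- pow_add. replace (k + (n - k))%nat with n by lia. ring.
  - intros x y hx hy. apply hs; eapply an_bound; eauto.
Qed.

Lemma rsum_geom q n : 0 <= q < 1 -> rsum (fun k => q ^ k) n <= / (1 - q).
Proof.
  intros hq. assert (rsum (fun k => q ^ k) n = (1 - q ^ n) * / (1 - q)) as ->.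
  { induction n as [|n IH]; cbn [rsum]; [simpl; ring|]. rewrite IH. simpl. field. lra. }
  assert (0 < / (1 - q)) by (apply Rinv_0_lt_compat; lra).
  assert (0 <= q ^ n) by (apply pow_le; lra). nra.
Qed.

Lemma ser_geom (u : C) : Cmod u < 1 -> ser (fun n => u ^ n)%C (/ (1 - u))%C.
Proof.
  intros hu.
  assert (nz : (1 - u)%C <> 0%C).
  { intros e. assert (u = 1%C) as -> by (replace u with (1 - (1 - u))%C by ring; rewrite e; ring).
    rewrite Cmod_1 in hu. lra. }
  destruct (ser_abs_conv (fun n => u ^ n)%C (/ (1 - Cmod u))) as [l hl].
  { intros n. rewrite (rsum_ext _ (fun k => Cmod u ^ k)) by (intros; apply Cmod_pow).
    apply rsum_geom. split; [apply Cmod_ge_0|easy]. }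
  replace (/ (1 - u))%C with l; [easy|].
  assert (h2 := ser_scal u _ _ hl).
  assert (h1 : ser (fun n => u ^ (S n))%C (l - 1)%C).
  { apply (ser_shift (fun n => u ^ n)%C). simpl. now replace (1 + (l - 1))%C with l by ring. }
  assert (e := ser_unique _ _ _ h1 h2).
  assert (e1 : (l * (1 - u))%C = 1%C).
  { replace (l * (1 - u))%C with (l - u * l)%C by ring. rewrite <- e. ring. }
  replace l with (l * (1 - u) * / (1 - u))%C by (field; easy). rewrite e1. ring.
Qed.

(** Geometric series of ratio q in the normed algebra. *)
Lemma an_inv_1m r q u :
  an r q u -> q < 1 -> an r (/ (1 - q)) (fun x y => / (1 - u x y))%C.
Proof.
  intros hu hq. assert (q0 := an_N_ge0 _ _ _ hu). assert (hr := an_r_gt0 _ _ _ hu).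
  apply an_series with (N := fun n => q ^ n) (h := fun n x y => (u x y ^ n)%C); [easy| | |].
  - intros. now apply an_pow.
  - intros. apply rsum_geom. lra.
  - intros x y hx hy. apply ser_geom. eapply Rle_lt_trans; [eapply an_bound; eauto|easy].
Qed.

(** Without a constant term every monomial gains at least one factor r' / r. Through [hol_small],
    this is how norms of germs vanishing at the origin are made small. *)
Lemma an_shrink0 r r' N h :
  an r N h -> h (RtoC 0) (RtoC 0) = 0%C -> 0 < r' <= r -> an r' (N * (r' / r)) h.
Proof.
  intros [a ha] h0 hr'. assert (a00 := eq_trans (eq_sym (expan_00 _ _ _ _ ha)) h0).
  destruct ha as (hr & hN & hs).
  exists a. split; [easy|]. split.
  - assert (q0 : 0 < r' / r) by (apply Rdiv_lt_0_compat; lra).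
    assert (q1 : r' / r <= 1).
    { apply Rmult_le_reg_r with r; [easy|]. unfold Rdiv. rewrite Rmult_assoc, Rinv_l; lra. }
    intros n. rewrite Rmult_comm. apply Rle_trans with (rsum (fun k => r' / r * (hn a k * r ^ k)) n).
    + apply rsum_le. intros [|k] _.
      * unfold hn. simpl. rewrite a00, Cmod_0. lra.
      * replace r' with (r' / r * r) at 1 by (field; lra).
        rewrite Rpow_mult_distr, (Rmult_comm (r' / r) (_ * _)), Rmult_assoc.
        apply Rmult_le_compat_l; [apply hn_ge0|]. rewrite Rmult_comm.
        apply Rmult_le_compat_l; [apply pow_le; lra|].
        assert (hp := pow_le_low (r' / r) 1 (S k) ltac:(lra) ltac:(lia)). lra.
    + rewrite rsum_scal. apply Rmult_le_compat_l; [lra|easy].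
  - intros x y hx hy. apply hs; lra.
Qed.

(** * Germs of holomorphic functions at the origin *)

Definition near (P : C -> C -> Prop) : Prop :=
  exists d, 0 < d /\ forall x y, Cmod x < d -> Cmod y < d -> P x y.

Lemma near_and P Q : near P -> near Q -> near (fun x y => P x y /\ Q x y).
Proof.
  intros (d & hd & h) (d' & hd' & h'). exists (Rmin d d').
  split; [now apply Rmin_glb_lt|]. intros x y hx hy.
  rmin_bounds. split; [apply h|apply h']; lra.
Qed.

Lemma near_imp (P Q : C -> C -> Prop) : (forall x y, P x y -> Q x y) -> near P -> near Q.
Proof. intros i (d & hd & h). exists d. auto. Qed.

Definition hol (h : C -> C -> C) : Prop := exists r N, an r N h.

Lemma near_lt d : 0 < d -> near (fun x y => Cmod x < d /\ Cmod y < d).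
Proof. intros. exists d. auto. Qed.

Lemma hol_ext h h' : near (fun x y => h x y = h' x y) -> hol h -> hol h'.
Proof.
  intros (d & hd & e) (r & N & ha). assert (hr := an_r_gt0 _ _ _ ha).
  exists (Rmin (d/2) r), N. assert (0 < Rmin (d/2) r) by (apply Rmin_glb_lt; lra).
  rmin_bounds.
  apply an_ext with h.
  - intros x y hx hy. apply e; lra.
  - eapply an_shrink; eauto.
Qed.

Lemma hol_const c : hol (fun _ _ => c).
Proof. exists 1, (Cmod c). apply an_const. lra. Qed.

Lemma hol_x : hol (fun x _ => x).
Proof. exists 1, 1. apply an_x. lra. Qed.

Lemma hol_y : hol (fun _ y => y).
Proof. exists 1, 1. apply an_y. lra. Qed.

Lemma hol_common h g : hol h -> hol g -> exists r N N', an r N h /\ an r N' g.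
Proof.
  intros (r & N & h1) (r' & N' & h2). exists (Rmin r r'), N, N'.
  assert (h3 := an_r_gt0 _ _ _ h1). assert (h4 := an_r_gt0 _ _ _ h2).
  assert (0 < Rmin r r') by (apply Rmin_glb_lt; lra).
  rmin_bounds.
  split; eapply an_shrink; eauto.
Qed.

Lemma hol_plus h g : hol h -> hol g -> hol (fun x y => h x y + g x y)%C.
Proof.
  intros h1 h2. destruct (hol_common h g h1 h2) as (r & N & N' & h3 & h4).
  exists r, (N + N'). now apply an_plus.
Qed.

Lemma hol_mult h g : hol h -> hol g -> hol (fun x y => h x y * g x y)%C.
Proof.
  intros h1 h2. destruct (hol_common h g h1 h2) as (r & N & N' & h3 & h4).
  exists r, (N * N'). now apply an_mult.
Qed.

Lemma hol_opp h : hol h -> hol (fun x y => - h x y)%C.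
Proof. intros (r & N & h1). exists r, N. now apply an_opp. Qed.

Lemma hol_minus h g : hol h -> hol g -> hol (fun x y => h x y - g x y)%C.
Proof. intros h1 h2. apply (hol_plus h (fun x y => - g x y)%C); [easy|]. now apply hol_opp. Qed.

Lemma hol_swap h : hol h -> hol (fun x y => h y x).
Proof. intros (r & N & h1). exists r, N. now apply an_swap. Qed.

Lemma hol_pow h n : hol h -> hol (fun x y => h x y ^ n)%C.
Proof. intros (r & N & h1). exists r, (N ^ n). now apply an_pow. Qed.

Lemma hol_small h e : hol h -> h (RtoC 0) (RtoC 0) = 0%C -> 0 < e ->
  exists r, 0 < r /\ forall r', 0 < r' <= r -> an r' e h.
Proof.
  intros (r & N & h1) h0 he. assert (hr := an_r_gt0 _ _ _ h1). assert (hN := an_N_ge0 _ _ _ h1).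
  exists (Rmin r (e * r / (N + 1))).
  assert (p : 0 < e * r / (N + 1)).
  { apply Rdiv_lt_0_compat; [|lra]. now apply Rmult_lt_0_compat. }
  split; [now apply Rmin_glb_lt|]. intros r' hr'.
  rmin_bounds.
  apply an_weaken with (N * (r' / r)); [apply an_shrink0; auto; lra|].
  assert (r' / r <= e / (N + 1)).
  { apply Rmult_le_reg_r with r; [easy|]. replace (r' / r * r) with r' by (field; lra).
    replace (e / (N + 1) * r) with (e * r / (N + 1)) by (field; lra). lra. }
  apply Rle_trans with (N * (e / (N + 1))); [apply Rmult_le_compat_l; lra|].
  apply Rmult_le_reg_r with (N + 1); [lra|].
  replace (N * (e / (N + 1)) * (N + 1)) with (N * e) by (field; lra). nra.
Qed.

Lemma hol_comp g u w :
  hol g -> hol u -> hol w -> u (RtoC 0) (RtoC 0) = 0%C -> w (RtoC 0) (RtoC 0) = 0%C ->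
  hol (fun x y => g (u x y) (w x y)).
Proof.
  intros (rho & N & hg) hu hw u0 w0. assert (hr := an_r_gt0 _ _ _ hg).
  destruct (hol_small u rho hu u0 hr) as (r & r0 & h1).
  destruct (hol_small w rho hw w0 hr) as (r' & r0' & h2).
  exists (Rmin r r'), N. assert (0 < Rmin r r') by (apply Rmin_glb_lt; lra).
  rmin_bounds.
  apply an_comp with rho; [easy|apply h1|apply h2]; lra.
Qed.

(** With c the value at the origin, h = c (1 - u) where u vanishes at the origin, hence has norm at
    most 1/2 on a small polydisc. *)
Lemma hol_inv h : hol h -> h (RtoC 0) (RtoC 0) <> 0%C -> hol (fun x y => / h x y)%C.
Proof.
  intros hh h0. set (c := h (RtoC 0) (RtoC 0)) in *.
  assert (hu : hol (fun x y => 1 - / c * h x y)%C).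
  { apply hol_minus; [apply hol_const|]. apply hol_mult; [apply hol_const|easy]. }
  destruct (hol_small _ (/2) hu) as (r & hr & h1); [|lra|].
  { fold c. field. easy. }
  apply hol_ext with (fun x y => / c * / (1 - (1 - / c * h x y)))%C.
  - assert (hr' : 0 < r <= r) by lra. specialize (h1 r hr').
    exists r. split; [easy|]. intros x y hx hy.
    assert (nz : h x y <> 0%C).
    { intros e. assert (Cmod (1 - / c * h x y) <= / 2) by
      (apply (an_bound r (/2) (fun x y => 1 - / c * h x y)%C); [easy|lra|lra]).
      rewrite e in H. replace (1 - / c * 0)%C with (RtoC 1) in H by ring.
      rewrite Cmod_1 in H. lra. }
    field. easy.
  - apply hol_mult; [apply hol_const|]. exists r, (/ (1 - / 2)).
    apply (an_inv_1m r (/2) (fun x y => 1 - / c * h x y)%C); [apply h1|]; lra.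
Qed.

Lemma hol_div h g : hol h -> hol g -> g (RtoC 0) (RtoC 0) <> 0%C -> hol (fun x y => h x y / g x y)%C.
Proof. intros h1 h2 h3. apply (hol_mult h (fun x y => / g x y)%C); [easy|]. now apply hol_inv. Qed.

Lemma near_comp P u w :
  near P -> hol u -> hol w -> u (RtoC 0) (RtoC 0) = 0%C -> w (RtoC 0) (RtoC 0) = 0%C ->
  near (fun x y => P (u x y) (w x y)).
Proof.
  intros (d & hd & h) hu hw u0 w0.
  assert (sm : forall g, hol g -> g (RtoC 0) (RtoC 0) = 0%C -> near (fun x y => Cmod (g x y) < d)).
  { intros g hg g0. destruct (hol_small g (d / 2) hg g0) as (r & hr & k); [lra|].
    exists r. split; [easy|]. intros x y hx hy.
    apply Rle_lt_trans with (d / 2); [|lra]. apply (an_bound r _ g x y); [apply k|..]; lra. }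
  apply near_imp with (2 := near_and _ _ (sm u hu u0) (sm w hw w0)). intros x y [h1 h2]. now apply h.
Qed.

Lemma hol_nonzero_near h : hol h -> h (RtoC 0) (RtoC 0) <> 0%C -> near (fun x y => h x y <> 0%C).
Proof.
  intros hh h0.
  assert (hg : hol (fun x y => h x y - h (RtoC 0) (RtoC 0))%C) by (apply hol_minus; [easy|apply hol_const]).
  assert (cp : 0 < Cmod (h (RtoC 0) (RtoC 0))) by now apply Cmod_gt_0.
  destruct (hol_small _ (Cmod (h (RtoC 0) (RtoC 0)) / 2) hg) as (r & hr & k); [ring|lra|].
  exists r. split; [easy|]. intros x y hx hy e.
  assert (b := an_bound r _ _ x y (k r ltac:(lra)) ltac:(lra) ltac:(lra)). cbv beta in b.
  rewrite e in b. replace (0 - h 0 0)%C with (- h 0 0)%C in b by ring. rewrite Cmod_opp in b. lra.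
Qed.

Lemma hol_bounded_near h : hol h -> exists K, 0 <= K /\ near (fun x y => Cmod (h x y) <= K).
Proof.
  intros (r & N & h1). exists N. split; [eapply an_N_ge0; eauto|].
  exists r. split; [eapply an_r_gt0; eauto|]. intros x y hx hy. apply (an_bound r N h); [easy|lra..].
Qed.

(** As q is at most 1, every term from index n on carries a factor q^n. *)
Lemma ser_tail (u : nat -> C) (b : nat -> R) q l N n :
  (forall k, Cmod (u k) <= b k * q ^ k) -> (forall k, 0 <= b k) ->
  (forall k, rsum b k <= N) -> 0 <= q <= 1 -> ser u l ->
  Cmod (l - csum u n) <= N * q ^ n.
Proof.
  intros hu hb hN hq hs.
  (* The finite part is recast as a series, so that the remainder is a difference of two series and
     [ser_bound] applies. *)
  set (v := fun k => if le_lt_dec n k then RtoC 0 else u k).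
  assert (hv : ser v (csum u n)).
  { replace (csum u n) with (csum v n).
    - apply ser_finite. intros k hk. unfold v. destruct (le_lt_dec n k); [easy|lia].
    - apply csum_ext. intros k hk. unfold v. destruct (le_lt_dec n k); [lia|easy]. }
  eapply ser_bound; [|apply (ser_minus _ _ _ _ hs hv)]. intros m.
  apply Rle_trans with (rsum (fun k => q ^ n * b k) m).
  - apply rsum_le. intros k _. unfold v. destruct (le_lt_dec n k).
    + replace (u k - 0)%C with (u k) by ring. apply Rle_trans with (1 := hu k).
      rewrite Rmult_comm. apply Rmult_le_compat_r; [easy|]. now apply pow_le_low.
    + replace (u k - u k)%C with (RtoC 0) by ring. rewrite Cmod_0.
      apply Rmult_le_pos; [apply pow_le; lra|easy].
  - rewrite rsum_scal, (Rmult_comm N). apply Rmult_le_compat_l; [apply pow_le; lra|easy].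
Qed.

Lemma expan_tail r N a h m x y n :
  expan r N a h -> Cmod x <= m -> Cmod y <= m -> m <= r ->
  Cmod (h x y - csum (fun k => hom a k x y) n) <= N * (m / r) ^ n.
Proof.
  intros (hr & hN & hs) hx hy hm. assert (0 <= m) by (generalize (Cmod_ge_0 x); lra).
  apply ser_tail with (b := fun k => hn a k * r ^ k).
  - intros k. eapply Rle_trans; [apply hom_bound; eauto|]. rewrite Rmult_assoc, <- Rpow_mult_distr.
    replace (r * (m / r)) with m by (field; lra). lra.
  - intros. apply hn_pow_ge0. lra.
  - easy.
  - split; [apply Rdiv_le_0_compat; lra|]. apply Rmult_le_reg_r with r; [easy|].
    replace (m / r * r) with m by (field; lra). lra.
  - apply hs; lra.
Qed.

Lemma pser_tail (c : nat -> C) r B t l n :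
  0 < r -> (forall k, rsum (fun k => Cmod (c k) * r ^ k) k <= B) -> Cmod t <= r ->
  ser (fun k => c k * t ^ k)%C l ->
  Cmod (l - csum (fun k => c k * t ^ k)%C n) <= B * (Cmod t / r) ^ n.
Proof.
  intros hr hB ht hs. apply ser_tail with (b := fun k => Cmod (c k) * r ^ k); auto.
  - intros k. rewrite Cmod_mult, Cmod_pow, Rmult_assoc, <- Rpow_mult_distr.
    replace (r * (Cmod t / r)) with (Cmod t) by (field; lra). lra.
  - intros k. apply Rmult_le_pos; [apply Cmod_ge_0|apply pow_le; lra].
  - assert (h0 := Cmod_ge_0 t). split; [apply Rdiv_le_0_compat; lra|].
    apply Rmult_le_reg_r with r; [easy|].
    replace (Cmod t / r * r) with (Cmod t) by (field; lra). lra.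
Qed.

(** Once the coefficients below n vanish, the remainder of order n + 1 at a small real s bounds c n
    s^n by a multiple of s^(n+1); then s tends to 0. *)
Lemma pser_unique (c : nat -> C) r B d :
  0 < r -> (forall k, rsum (fun k => Cmod (c k) * r ^ k) k <= B) -> 0 < d ->
  (forall t, Cmod t < d -> ser (fun k => c k * t ^ k)%C 0%C) -> forall n, c n = 0%C.
Proof.
  intros hr hB hd hs n. induction n as [n IH] using lt_wf_ind.
  assert (B0 : 0 <= B) by apply (hB O).
  assert (K : forall s, 0 < s -> s < d -> s <= r -> Cmod (c n) <= s * (B / r ^ (S n))).
  { intros s h0 h1 h2.
    assert (cs : Cmod s = s) by (rewrite Cmod_R; apply Rabs_right; lra).
    assert (h := pser_tail c r B s 0 (S n) hr hB). rewrite cs in h.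
    specialize (h h2). rewrite <- cs in h1. specialize (h (hs s h1)).
    cbn [csum] in h. rewrite csum_0 in h.
    2:{ intros k hk. rewrite IH by easy. ring. }
    replace (0 - (0 + c n * s ^ n))%C with (- (c n * s ^ n))%C in h by ring.
    rewrite Cmod_opp, Cmod_mult, Cmod_pow, cs in h.
    apply Rmult_le_reg_r with (s ^ n); [now apply pow_lt|].
    apply Rle_trans with (1 := h). apply Req_le.
    unfold Rdiv. rewrite Rpow_mult_distr, pow_inv. simpl (s ^ (S n)). ring. }
  apply Cmod_small_eq0. intros eps he.
  destruct (small_real (B / r ^ S n) (Rmin d r) eps) as (s & s1 & s2 & _ & s3);
    [now apply Rmin_glb_lt|easy|].
  rmin_bounds.
  apply Rle_trans with (1 := K s s1 ltac:(lra) ltac:(lra)). lra.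
Qed.

Lemma hom_scale a n t x y : hom a n (t * x) (t * y) = (hom a n x y * t ^ n)%C.
Proof.
  unfold hom. rewrite (Cmult_comm (csum _ _)), <- csum_scal. apply csum_ext. intros k hk.
  rewrite !Cpow_mult_l. replace (t ^ n)%C with (t ^ k * t ^ (n - k))%C.
  - ring.
  - rewrite <- Cpow_add_r. f_equal. lia.
Qed.

Lemma rsum_finite (b : nat -> R) n m :
  (forall k, 0 <= b k) -> (forall k, (n <= k)%nat -> b k = 0) -> rsum b m <= rsum b n.
Proof.
  intros hb hz. destruct (le_lt_dec m n); [now apply rsum_mono|].
  assert (h : (n <= m)%nat) by lia. induction h as [|m h IH]; cbn [rsum]; [lra|].
  rewrite hz by easy. destruct (le_lt_dec m n).
  - replace m with n by lia. lra.
  - specialize (IH l0). lra.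
Qed.

(** On a complex line through the origin the homogeneous parts are the coefficients of a power
    series in one variable, so each of them vanishes on the polydisc. Setting y = r turns such a
    part into a polynomial in x, whose coefficients vanish in turn. *)
Lemma expan_zero r N a h :
  expan r N a h -> near (fun x y => h x y = 0%C) -> forall i j, a i j = 0%C.
Proof.
  intros (hr & hN & hs) (d & hd & h0) i j.
  assert (z : forall n x y, Cmod x <= r -> Cmod y <= r -> hom a n x y = 0%C).
  { intros n x y hx hy.
    apply (pser_unique (fun n => hom a n x y) 1 N (Rmin 1 (d / (r + 1)))); [lra| | |].
    - intros k. apply Rle_trans with (2 := hN k). apply rsum_le. intros m _.
      rewrite pow1, Rmult_1_r. now apply hom_bound.
    - apply Rmin_glb_lt; [lra|]. apply Rdiv_lt_0_compat; lra.
    - intros t ht. rmin_bounds.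
      assert (b : forall x, Cmod x <= r -> Cmod (t * x) <= r /\ Cmod (t * x) < d).
      { intros z hz. rewrite Cmod_mult. assert (z0 := Cmod_ge_0 z). assert (t0 := Cmod_ge_0 t).
        split; [nra|]. apply Rle_lt_trans with (Cmod t * r); [nra|].
        apply Rlt_le_trans with (d / (r + 1) * (r + 1)); [nra|].
        apply Req_le. field. lra. }
      rewrite <- (h0 (t * x)%C (t * y)%C) by now apply b.
      apply ser_ext with (fun n => hom a n (t * x) (t * y)).
      + intros. apply hom_scale.
      + apply hs; now apply b. }
  set (n := (i + j)%nat).
  set (c := fun k => if le_lt_dec k n then (a k (n - k)%nat * r ^ (n - k))%C else RtoC 0).
  assert (cz : c i = 0%C).
  { apply (pser_unique c r (rsum (fun k => Cmod (c k) * r ^ k) (S n)) r); auto.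
    - intros k. apply rsum_finite.
      + intros q. apply Rmult_le_pos; [apply Cmod_ge_0|apply pow_le; lra].
      + intros q hq. unfold c. destruct (le_lt_dec q n); [lia|]. rewrite Cmod_0. ring.
    - intros t ht. rewrite <- (z n t (RtoC r)); [|lra|rewrite Cmod_R, Rabs_right; lra].
      unfold hom. rewrite <- (csum_ext (fun k => c k * t ^ k)%C).
      + apply ser_finite. intros k hk. unfold c. destruct (le_lt_dec k n); [lia|]. ring.
      + intros k hk. unfold c. destruct (le_lt_dec k n); [|lia].
        ring. }
  unfold c in cz. destruct (le_lt_dec i n); [|unfold n in *; lia].
  replace (n - i)%nat with j in cz by (unfold n; lia).
  assert (rz : (RtoC r ^ j)%C <> 0%C).
  { apply Cpow_nz. intros e. apply RtoC_inj in e. lra. }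
  replace (a i j) with (a i j * r ^ j / r ^ j)%C by (field; easy). rewrite cz. field. easy.
Qed.

Lemma expan_unique r N a h r' N' b h' :
  expan r N a h -> expan r' N' b h' -> near (fun x y => h x y = h' x y) ->
  forall i j, a i j = b i j.
Proof.
  intros ha hb e i j.
  assert (0 < r) by apply ha. assert (0 < r') by apply hb.
  assert (p : 0 < Rmin r r') by (apply Rmin_glb_lt; lra).
  rmin_bounds.
  apply (expan_shrink _ (Rmin r r')) in ha; [|lra].
  apply (expan_shrink _ (Rmin r r')) in hb; [|lra].
  assert (hm := expan_plus _ _ _ _ _ _ _ ha (expan_scal _ _ _ _ (-(1))%C hb)).
  assert (z := expan_zero _ _ _ _ hm).
  replace (a i j) with (a i j + - (1) * b i j + b i j)%C by ring.
  rewrite z; [ring|]. apply near_imp with (2 := e). intros x y ->. ring.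
Qed.

(** The sum as a total function, meaningful only where the series converges; [ssum_correct] asks for
    this. *)
Definition ssum (u : nat -> C) : C := epsilon (inhabits (RtoC 0)) (ser u).

Lemma ssum_correct u l : ser u l -> ser u (ssum u).
Proof. intros h. apply (epsilon_spec (inhabits (RtoC 0)) (ser u)). now exists l. Qed.

Lemma expan_of_coef r N a :
  0 < r -> (forall n, rsum (fun k => hn a k * r ^ k) n <= N) ->
  expan r N a (fun x y => ssum (fun n => hom a n x y)).
Proof.
  intros hr hN. split; [easy|]. split; [easy|]. intros x y hx hy.
  destruct (ser_abs_conv (fun n => hom a n x y) N) as [l hl].
  - intros n. apply Rle_trans with (2 := hN n). apply rsum_le. intros. now apply hom_bound.
  - now apply ssum_correct with l.
Qed.

(** * Differentiation of power series *)

Definition dx_coef (a : nat -> nat -> C) (i j : nat) : C := (INR (S i) * a (S i) j)%C.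

(** The right-hand side is padded with a null term at i = 0 to get the index range of [hom a (S n)],
    with which [expan_cder] compares it term by term. *)
Lemma hom_dx a n s x y :
  (s * hom (dx_coef a) n x y)%C =
  csum (fun i => a i (S n - i)%nat * (INR i * s * x ^ (pred i)) * y ^ (S n - i))%C (S (S n)).
Proof.
  rewrite csum_shift. unfold hom, dx_coef. rewrite <- csum_scal. simpl (INR 0).
  replace (a O (S n - 0)%nat * (0 * s * x ^ pred 0) * y ^ (S n - 0))%C with (RtoC 0) by ring.
  rewrite Cplus_0_l. apply csum_ext. intros k _.
  change (S n - S k)%nat with (n - k)%nat. change (pred (S k)) with k. ring.
Qed.

Lemma hn_dx a n : hn (dx_coef a) n <= INR (S n) * hn a (S n).
Proof.
  unfold hn. rewrite (rsum_shift _ (S n)), Rmult_plus_distr_l, <- rsum_scal.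
  apply Rle_trans with (rsum (fun k => INR (S n) * Cmod (a (S k) (S n - S k)%nat)) (S n)).
  - apply rsum_le. intros k hk. unfold dx_coef. rewrite Cmod_mult, Cmod_R, Rabs_right.
    + change (S n - S k)%nat with (n - k)%nat.
      apply Rmult_le_compat_r; [apply Cmod_ge_0|]. apply le_INR. lia.
    + apply Rle_ge, pos_INR.
  - assert (0 <= INR (S n) * Cmod (a O (S n - 0)%nat)); [|lra].
    apply Rmult_le_pos; [apply pos_INR|apply Cmod_ge_0].
Qed.

Lemma INR_pow2 n : INR n <= 2 ^ n.
Proof.
  induction n as [|n IH]; [simpl; lra|]. rewrite S_INR. simpl.
  assert (1 <= 2 ^ n) by (apply pow_R1_Rle; lra). lra.
Qed.

(** The factor k brought down by the derivative is at most 2^k, which halving the radius absorbs. *)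
Lemma expan_dx r N a h :
  expan r N a h ->
  expan (r / 2) (2 / r * N) (dx_coef a) (fun x y => ssum (fun n => hom (dx_coef a) n x y)).
Proof.
  intros (hr & hN & hs). apply expan_of_coef; [lra|]. intros n.
  apply Rle_trans with (2 / r * rsum (fun k => hn a k * r ^ k) (S n)).
  - rewrite rsum_shift, Rmult_plus_distr_l, <- rsum_scal.
    apply Rle_trans with (rsum (fun k => 2 / r * (hn a (S k) * r ^ S k)) n).
    + apply rsum_le. intros k _. apply Rle_trans with (INR (S k) * hn a (S k) * (r / 2) ^ k).
      * apply Rmult_le_compat_r; [apply pow_le; lra|apply hn_dx].
      * assert (h1 := INR_pow2 (S k)). assert (h2 := hn_ge0 a (S k)).
        apply Rle_trans with (2 ^ S k * hn a (S k) * (r / 2) ^ k).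
        -- repeat apply Rmult_le_compat_r; auto. apply pow_le. lra.
        -- apply Req_le. unfold Rdiv. rewrite Rpow_mult_distr, pow_inv. simpl. field.
           repeat split; try apply pow_nonzero; lra.
    + assert (0 <= 2 / r * (hn a 0 * r ^ 0)); [|lra].
      apply Rmult_le_pos; [apply Rdiv_le_0_compat; lra|]. apply hn_pow_ge0. lra.
  - apply Rmult_le_compat_l; [apply Rdiv_le_0_compat; lra|easy].
Qed.

(** Second order Taylor remainder of a monomial. Multiplying by rho^2, instead of lowering the
    exponent on the right, avoids special cases for i < 2 and for rho = 0. *)
Lemma pow_taylor (x s : C) rho i :
  Cmod x <= rho -> Cmod (x + s) <= rho ->
  Cmod ((x + s) ^ i - x ^ i - INR i * s * x ^ (pred i)) * rho ^ 2
    <= INR i ^ 2 * rho ^ i * Cmod s ^ 2.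
Proof.
  intros hx hs. assert (r0 : 0 <= rho) by (generalize (Cmod_ge_0 x); lra).
  induction i as [|i IH].
  - simpl. replace (1 - 1 - 0 * s * 1)%C with (RtoC 0) by ring. rewrite Cmod_0. lra.
  - replace ((x + s) ^ S i - x ^ S i - INR (S i) * s * x ^ pred (S i))%C with
     ((x + s) * ((x + s) ^ i - x ^ i - INR i * s * x ^ (pred i))
       + INR i * s ^ 2 * x ^ (pred i))%C.
    2:{ rewrite S_INR, RtoC_plus. destruct i as [|i]; [simpl; ring|].
        simpl pred. change (x ^ S (S i))%C with (x * (x * x ^ i))%C.
        change ((x + s) ^ S (S i))%C with ((x + s) * (x + s) ^ S i)%C.
        change (x ^ S i)%C with (x * x ^ i)%C. ring. }
    set (P := ((x + s) ^ i - x ^ i - INR i * s * x ^ pred i)%C) in *.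
    apply Rle_trans with ((rho * Cmod P + INR i * Cmod s ^ 2 * Cmod x ^ (pred i)) * rho ^ 2).
    { apply Rmult_le_compat_r; [apply pow_le; lra|]. eapply Rle_trans; [apply Cmod_triangle|].
      rewrite !Cmod_mult, !Cmod_pow, Cmod_R, Rabs_right by apply Rle_ge, pos_INR.
      assert (0 <= Cmod P) by apply Cmod_ge_0. nra. }
    assert (h : INR i * Cmod x ^ (pred i) * rho ^ 2 <= INR i * rho ^ (S i)).
    { destruct i as [|i]; [simpl; lra|]. simpl pred.
      replace (rho ^ S (S i)) with (rho ^ i * rho ^ 2) by (simpl; ring).
      rewrite Rmult_assoc. apply Rmult_le_compat_l; [apply pos_INR|].
      apply Rmult_le_compat_r; [apply pow_le; lra|]. apply pow_incr. split; [apply Cmod_ge_0|easy]. }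
    rewrite S_INR. assert (0 <= INR i) by apply pos_INR.
    assert (0 <= Cmod s ^ 2) by (apply pow_le, Cmod_ge_0).
    assert (0 <= rho ^ S i) by (apply pow_le; lra).
    apply Rle_trans with (rho * (INR i ^ 2 * rho ^ i * Cmod s ^ 2) + INR i * rho ^ S i * Cmod s ^ 2).
    { rewrite Rmult_plus_distr_r. apply Rplus_le_compat.
      - rewrite Rmult_assoc. now apply Rmult_le_compat_l.
      - nra. }
    replace (rho * (INR i ^ 2 * rho ^ i * Cmod s ^ 2) + INR i * rho ^ S i * Cmod s ^ 2)
      with ((INR i ^ 2 + INR i) * (rho ^ S i * Cmod s ^ 2)) by (simpl; ring).
    rewrite Rmult_assoc. apply Rmult_le_compat_r; [now apply Rmult_le_pos|]. simpl. nra.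
Qed.

(** The complex derivative as a first order expansion, without quotients. *)
Definition cder (f : C -> C) (z l : C) : Prop :=
  forall eps, 0 < eps -> exists d, 0 < d /\ forall s, Cmod s < d ->
    Cmod (f (z + s)%C - f z - l * s) <= eps * Cmod s.

Lemma cder_of_bound f z l K d :
  0 < d -> (forall s, Cmod s < d -> Cmod (f (z + s)%C - f z - l * s) <= K * Cmod s ^ 2) ->
  cder f z l.
Proof.
  intros hd h eps he. destruct (small_real K d eps hd he) as (s0 & h0 & h1 & _ & h2).
  exists s0. split; [easy|]. intros s hs. apply Rle_trans with (1 := h s ltac:(lra)).
  assert (p := Cmod_ge_0 s). destruct (Rle_lt_dec K 0); [simpl; nra|].
  simpl. rewrite Rmult_1_r, <- Rmult_assoc. apply Rmult_le_compat_r; [easy|]. nra.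
Qed.

Lemma cder_exact f z l : (forall s, f (z + s)%C = (f z + l * s)%C) -> cder f z l.
Proof.
  intros h eps he. exists 1. split; [lra|]. intros s _. rewrite h.
  replace (f z + l * s - f z - l * s)%C with (RtoC 0) by ring. rewrite Cmod_0.
  apply Rmult_le_pos; [lra|apply Cmod_ge_0].
Qed.

Lemma cder_unique f z l l' : cder f z l -> cder f z l' -> l = l'.
Proof.
  intros h h'. apply Cminus_eq0, Cmod_small_eq0. intros eps he.
  destruct (h (eps/2)) as (d & hd & h1); [lra|]. destruct (h' (eps/2)) as (d' & hd' & h1'); [lra|].
  set (s := Rmin d d' / 2). assert (0 < Rmin d d') by now apply Rmin_glb_lt.
  rmin_bounds.
  assert (cs : Cmod s = s) by (rewrite Cmod_R; apply Rabs_right; unfold s; lra).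
  specialize (h1 (RtoC s)). specialize (h1' (RtoC s)). rewrite cs in *.
  assert (s < d) by (unfold s; lra). assert (s < d') by (unfold s; lra).
  specialize (h1 H2). specialize (h1' H3).
  assert (Cmod (l - l') * s <= eps * s).
  { rewrite <- cs at 1. rewrite <- Cmod_mult.
    replace ((l - l') * s)%C with ((f (z + s)%C - f z - l' * s) - (f (z + s)%C - f z - l * s))%C by ring.
    eapply Rle_trans; [apply Cmod_triangle_minus|]. lra. }
  apply Rmult_le_reg_r with s; [unfold s; lra|easy].
Qed.

Lemma cder_ext f g z l d :
  0 < d -> (forall s, Cmod s < d -> f (z + s)%C = g (z + s)%C) -> cder f z l -> cder g z l.
Proof.
  intros hd e h eps he. destruct (h eps he) as (d' & hd' & h').
  exists (Rmin d d'). split; [now apply Rmin_glb_lt|]. intros s hs.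
  rmin_bounds.
  assert (e0 := e (RtoC 0)). rewrite Cmod_0, Cplus_0_r in e0.
  rewrite <- e, <- e0 by lra. apply h'. lra.
Qed.

(** Both x and x + s stay in the disc of radius r / 4, and the factor i^2 of [pow_taylor] is at most
    4^i, so that i^2 (r / 4)^i is at most r^i: the remainder is bounded by the norm of h itself. *)
Lemma expan_cder r N a h x y :
  expan r N a h -> Cmod x < r / 8 -> Cmod y < r / 8 ->
  cder (fun t => h t y) x (ssum (fun n => hom (dx_coef a) n x y)).
Proof.
  intros ha hx hy. assert (hdx := expan_dx _ _ _ _ ha). destruct ha as (hr & hN & hs).
  destruct hdx as (_ & _ & hs').
  set (rho := r / 4). assert (rp : 0 < rho) by (unfold rho; lra).
  apply cder_of_bound with (K := N / rho ^ 2) (d := r / 8); [lra|]. intros s hsm.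
  assert (x1 : Cmod x <= rho) by (unfold rho; lra).
  assert (x2 : Cmod (x + s) <= rho).
  { eapply Rle_trans; [apply Cmod_triangle|]. unfold rho. lra. }
  assert (y1 : Cmod y <= rho) by (unfold rho; lra).
  set (l := ssum _).
  assert (hl : ser (fun n => hom (dx_coef a) n x y) l) by (apply hs'; unfold rho in *; lra).
  (* The series of the derivative times s, shifted by one degree to face the terms of the same
     degree in h(x + s) - h(x). *)
  set (v := fun n => match n with O => RtoC 0 | S m => (s * hom (dx_coef a) m x y)%C end).
  assert (hv : ser v (l * s)%C).
  { replace (l * s)%C with (v O + s * l)%C by (simpl; ring). apply ser_shift. simpl.
    now apply ser_scal. }
  assert (h1 : ser (fun n => hom a n (x + s) y) (h (x + s)%C y)) by (apply hs; unfold rho in *; lra).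
  assert (h2 : ser (fun n => hom a n x y) (h x y)) by (apply hs; unfold rho in *; lra).
  assert (h3 := ser_minus _ _ _ _ (ser_minus _ _ _ _ h1 h2) hv).
  eapply ser_bound; [|exact h3]. intros n. simpl.
  apply Rle_trans with (rsum (fun k => (Cmod s ^ 2 / rho ^ 2) * (hn a k * r ^ k)) n).
  2:{ rewrite rsum_scal. apply Rle_trans with (Cmod s ^ 2 / rho ^ 2 * N).
      - apply Rmult_le_compat_l; [|easy]. apply Rdiv_le_0_compat; [|now apply pow_lt].
        apply pow_le, Cmod_ge_0.
      - apply Req_le. unfold Rdiv. simpl. ring. }
  apply rsum_le. intros k _.
  assert (E : (hom a k (x + s) y - hom a k x y - v k)%C =
    csum (fun i => a i (k - i)%nat * ((x + s) ^ i - x ^ i - INR i * s * x ^ (pred i))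
       * y ^ (k - i))%C (S k)).
  { replace (v k) with
     (csum (fun i => a i (k - i)%nat * (INR i * s * x ^ (pred i)) * y ^ (k - i))%C (S k)).
    - unfold hom. rewrite !csum_dist. apply csum_ext. intros. ring.
    - destruct k as [|k]; simpl v.
      + cbn [csum]. simpl. ring.
      + now rewrite hom_dx. }
  rewrite E. eapply Rle_trans; [apply csum_Cmod|].
  apply Rle_trans with (rsum (fun i => (Cmod s ^ 2 / rho ^ 2 * r ^ k) * Cmod (a i (k - i)%nat)) (S k)).
  2:{ rewrite rsum_scal. unfold hn. apply Req_le. ring. }
  apply rsum_le. intros i hi. rewrite !Cmod_mult, Cmod_pow.
  rewrite (Rmult_comm (_ * r ^ k)), Rmult_assoc. apply Rmult_le_compat_l; [apply Cmod_ge_0|].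
  assert (T := pow_taylor x s rho i x1 x2).
  set (P := Cmod ((x + s) ^ i - x ^ i - INR i * s * x ^ pred i)) in *.
  assert (P0 : 0 <= P) by apply Cmod_ge_0.
  assert (q : 0 < rho ^ 2) by now apply pow_lt.
  apply Rmult_le_reg_r with (rho ^ 2); [easy|].
  replace (Cmod s ^ 2 / rho ^ 2 * r ^ k * rho ^ 2) with (Cmod s ^ 2 * r ^ k) by (field; lra).
  assert (y2 : Cmod y ^ (k - i) <= r ^ (k - i)).
  { apply pow_incr. split; [apply Cmod_ge_0|]. unfold rho in *; lra. }
  assert (y3 : 0 <= Cmod y ^ (k - i)) by apply pow_le, Cmod_ge_0.
  assert (I : INR i ^ 2 * rho ^ i <= r ^ i).
  { unfold rho. replace (r ^ i) with ((2 ^ i) ^ 2 * (r / 4) ^ i).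
    - apply Rmult_le_compat_r; [apply pow_le; lra|]. apply pow_incr.
      split; [apply pos_INR|apply INR_pow2].
    - rewrite <- pow_mult, Nat.mul_comm, pow_mult, <- Rpow_mult_distr. f_equal. field. }
  assert (s2 : 0 <= Cmod s ^ 2) by apply pow_le, Cmod_ge_0.
  apply Rle_trans with ((INR i ^ 2 * rho ^ i * Cmod s ^ 2) * r ^ (k - i)).
  { replace (P * Cmod y ^ (k - i) * rho ^ 2) with ((P * rho ^ 2) * Cmod y ^ (k - i)) by ring.
    apply Rmult_le_compat; auto. apply Rmult_le_pos; [easy|apply pow_le; lra]. }
  replace (r ^ k) with (r ^ i * r ^ (k - i)) by (rewrite <- pow_add; f_equal; lia).
  replace (Cmod s ^ 2 * (r ^ i * r ^ (k - i))) with (r ^ i * Cmod s ^ 2 * r ^ (k - i)) by ring.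
  apply Rmult_le_compat_r; [apply pow_le; lra|]. now apply Rmult_le_compat_r.
Qed.

(** * Lipschitz and Taylor estimates, chain rule, division by x *)

Lemma an_pow_diff r rho del u u' i :
  an r rho u -> an r rho u' -> an r del (fun x y => u x y - u' x y)%C ->
  0 < rho ->
  an r (INR i * rho ^ i * (del / rho)) (fun x y => u x y ^ i - u' x y ^ i)%C.
Proof.
  intros hu hu' hd hr. assert (hr' := an_r_gt0 _ _ _ hu). induction i as [|i IH].
  - apply an_weaken with 0; [|simpl; lra].
    apply an_ext with (fun _ _ => RtoC 0); [intros; simpl; ring|now apply an_0].
  - apply an_ext with (fun x y => u x y * (u x y ^ i - u' x y ^ i)
       + (u x y - u' x y) * u' x y ^ i)%C; [intros; simpl; ring|].
    apply an_weaken with (rho * (INR i * rho ^ i * (del / rho)) + del * rho ^ i).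
    + apply (an_plus _ _ _ (fun x y => u x y * (u x y ^ i - u' x y ^ i))%C
        (fun x y => (u x y - u' x y) * u' x y ^ i)%C).
      * now apply (an_mult _ _ _ u (fun x y => u x y ^ i - u' x y ^ i)%C).
      * apply (an_mult _ _ _ (fun x y => u x y - u' x y)%C (fun x y => u' x y ^ i)%C); [easy|].
        now apply an_pow.
    + apply Req_le. rewrite S_INR. simpl. field. lra.
Qed.

(** Mean value inequality in norm, where [S] bounds the norm series of g weighted by the degree. It
    makes Picard iteration contract and, for constant arguments, gives pointwise Lipschitz bounds.
    As [S] hides the successor, the latter is written [Datatypes.S]. *)
Lemma an_lip rho Ng b g S r del u w u' w' :
  expan rho Ng b g -> (forall n, rsum (fun k => INR k * (hn b k * rho ^ k)) n <= S) ->
  an r rho u -> an r rho w -> an r rho u' -> an r rho w' ->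
  an r del (fun x y => u x y - u' x y)%C -> an r del (fun x y => w x y - w' x y)%C ->
  an r (S * (del / rho)) (fun x y => g (u x y) (w x y) - g (u' x y) (w' x y))%C.
Proof.
  intros (hrho & hN & hs) hS hu hw hu' hw' du dw. assert (hr := an_r_gt0 _ _ _ hu).
  assert (d0 : 0 <= del / rho).
  { apply Rdiv_le_0_compat; [|easy]. now apply an_N_ge0 in du. }
  apply an_series with (N := fun n => INR n * (hn b n * rho ^ n) * (del / rho))
    (h := fun n x y => (hom b n (u x y) (w x y) - hom b n (u' x y) (w' x y))%C); [easy| | |].
  - intros n. unfold hom, hn.
    apply an_ext with (fun x y => csum (fun k => b k (n - k)%nat *
       (u x y ^ k * (w x y ^ (n - k) - w' x y ^ (n - k))
        + (u x y ^ k - u' x y ^ k) * w' x y ^ (n - k)))%C (Datatypes.S n)).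
    { intros x y _ _. rewrite csum_dist. apply csum_ext. intros. ring. }
    apply an_weaken with (rsum (fun k => (INR n * rho ^ n * (del / rho)) * Cmod (b k (n-k)%nat)) (Datatypes.S n)).
    2:{ rewrite rsum_scal. apply Req_le. ring. }
    apply an_csum; [easy|]. intros k hk. rewrite Rmult_comm.
    apply (an_scal _ _ (fun x y => u x y ^ k * (w x y ^ (n - k) - w' x y ^ (n - k))
        + (u x y ^ k - u' x y ^ k) * w' x y ^ (n - k))%C).
    apply an_weaken with (rho ^ k * (INR (n - k) * rho ^ (n - k) * (del / rho))
        + (INR k * rho ^ k * (del / rho)) * rho ^ (n - k)).
    + apply (an_plus _ _ _ (fun x y => u x y ^ k * (w x y ^ (n - k) - w' x y ^ (n - k)))%C
         (fun x y => (u x y ^ k - u' x y ^ k) * w' x y ^ (n - k))%C).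
      * apply (an_mult _ _ _ (fun x y => u x y ^ k)%C
          (fun x y => w x y ^ (n - k) - w' x y ^ (n - k))%C); [now apply an_pow|].
        now apply an_pow_diff.
      * apply (an_mult _ _ _ (fun x y => u x y ^ k - u' x y ^ k)%C
          (fun x y => w' x y ^ (n - k))%C); [|now apply an_pow].
        now apply an_pow_diff.
    + apply Req_le. replace (rho ^ n) with (rho ^ k * rho ^ (n - k)).
      * replace (INR n) with (INR k + INR (n - k)); [ring|].
        rewrite <- plus_INR. f_equal. lia.
      * rewrite <- pow_add. f_equal. lia.
  - intros n. rewrite (rsum_ext _ (fun k => del / rho * (INR k * (hn b k * rho ^ k))))
      by (intros; ring).
    rewrite rsum_scal, (Rmult_comm S). now apply Rmult_le_compat_l.
  - intros x y hx hy. apply ser_minus; apply hs; eapply an_bound; eauto.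
Qed.

Lemma expan_lip_bound r N a h :
  expan r N a h -> forall n, rsum (fun k => INR k * (hn a k * (r / 2) ^ k)) n <= N.
Proof.
  intros (hr & hN & _) n. apply Rle_trans with (2 := hN n). apply rsum_le. intros k _.
  assert (h1 := INR_pow2 k). assert (h2 := hn_ge0 a k).
  apply Rle_trans with (2 ^ k * (hn a k * (r / 2) ^ k)).
  - apply Rmult_le_compat_r; [|easy]. apply hn_pow_ge0. lra.
  - apply Req_le. unfold Rdiv. rewrite Rpow_mult_distr, pow_inv. field. apply pow_nonzero. lra.
Qed.

Lemma hol_lip h : hol h -> exists K d, 0 < d /\ 0 <= K /\
  forall x y x' y' m, Cmod x <= d -> Cmod y <= d -> Cmod x' <= d -> Cmod y' <= d ->
    Cmod (x - x') <= m -> Cmod (y - y') <= m -> Cmod (h x y - h x' y') <= K * m.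
Proof.
  intros (r & N & a & ha). assert (hr : 0 < r) by apply ha.
  assert (hS := expan_lip_bound _ _ _ _ ha).
  assert (hN := expan_N_ge0 _ _ _ _ ha).
  apply (expan_shrink _ (r/2)) in ha; [|lra].
  exists (N / (r/2)), (r/2). split; [lra|]. split; [apply Rdiv_le_0_compat; lra|].
  intros x y x' y' m hx hy hx' hy' dx dy.
  (* Points are treated as constant functions, whose norms are their moduli. *)
  assert (C1 : forall c, Cmod c <= r/2 -> an 1 (r/2) (fun _ _ => c)).
  { intros c hc. apply an_weaken with (2 := hc). apply an_const. lra. }
  assert (C2 : forall c, Cmod c <= m -> an 1 m (fun _ _ => c)).
  { intros c hc. apply an_weaken with (2 := hc). apply an_const. lra. }
  assert (L := an_lip (r/2) N a h N 1 m (fun _ _ => x) (fun _ _ => y) (fun _ _ => x') (fun _ _ => y')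
    ha hS (C1 _ hx) (C1 _ hy) (C1 _ hx') (C1 _ hy') (C2 _ dx) (C2 _ dy)).
  replace (N / (r/2) * m) with (N * (m / (r/2))) by (field; lra).
  apply (an_bound 1 _ (fun _ _ => h x y - h x' y')%C 0 0 L); rewrite Cmod_0; lra.
Qed.

Lemma hol_lip1 u : hol (fun x _ => u x) -> exists L d, 0 < d /\ 0 <= L /\
  forall x y, Cmod x <= d -> Cmod y <= d -> Cmod (u x - u y) <= L * Cmod (x - y).
Proof.
  intros hu. destruct (hol_lip _ hu) as (L & d & hd & hL & lip). exists L, d.
  split; [easy|]. split; [easy|]. intros x y hx hy.
  apply (lip x (RtoC 0) y (RtoC 0)); rewrite ?Cmod_diag, ?Cmod_0; try lra. apply Cmod_ge_0.
Qed.

Lemma hol_taylor h : hol h -> exists A B K d, 0 < d /\ 0 <= K /\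
  forall x y m, Cmod x <= m -> Cmod y <= m -> m <= d ->
    Cmod (h x y - (h (RtoC 0) (RtoC 0) + A * x + B * y)) <= K * m ^ 2.
Proof.
  intros (r & N & a & ha). assert (hr : 0 < r) by apply ha.
  exists (a 1%nat O), (a O 1%nat), (N / r ^ 2), r.
  split; [easy|]. split.
  { apply Rdiv_le_0_compat; [eapply expan_N_ge0; eauto|now apply pow_lt]. }
  assert (e0 := expan_00 _ _ _ _ ha).
  intros x y m hx hy hm. rewrite e0.
  replace (a O O + a 1%nat O * x + a O 1%nat * y)%C with (csum (fun k => hom a k x y) 2)
    by (unfold hom; simpl; ring).
  apply Rle_trans with (1 := expan_tail r N a h m x y 2 ha hx hy hm).
  apply Req_le. field. lra.
Qed.

Lemma hol_recenter h : hol h -> exists d, 0 < d /\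
  forall p q, Cmod p <= d -> Cmod q <= d -> hol (fun x y => h (p + x) (q + y))%C.
Proof.
  intros (r & N & ha). assert (hr := an_r_gt0 _ _ _ ha).
  exists (r/2). split; [lra|]. intros p q hp hq. exists (r/2), N.
  apply (an_comp r N h (r/2) (fun x _ => p + x)%C (fun _ y => q + y)%C ha).
  - apply an_weaken with (Cmod p + r/2); [|lra].
    apply (an_plus _ _ _ (fun _ _ => p) (fun x _ => x)); [apply an_const|apply an_x]; lra.
  - apply an_weaken with (Cmod q + r/2); [|lra].
    apply (an_plus _ _ _ (fun _ _ => q) (fun _ y => y)); [apply an_const|apply an_y]; lra.
Qed.

Lemma hol_dx h : hol h -> exists h', hol h' /\ near (fun x y => cder (fun t => h t y) x (h' x y)).
Proof.
  intros (r & N & a & ha). assert (hr : 0 < r) by apply ha.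
  eexists. split.
  - exists (r/2), (2/r * N). eexists. now apply (expan_dx r N a h).
  - exists (r/8). split; [lra|]. intros x y hx hy. now apply (expan_cder r N a h).
Qed.

Lemma hol_dy h : hol h -> exists h', hol h' /\ near (fun x y => cder (fun t => h x t) y (h' x y)).
Proof.
  intros hh. destruct (hol_dx _ (hol_swap _ hh)) as (h' & h1 & d & hd & h2).
  exists (fun x y => h' y x). split; [now apply hol_swap|]. exists d. auto.
Qed.

Lemma cder_lip f z l : cder f z l -> exists d, 0 < d /\ forall s, Cmod s < d ->
  Cmod (f (z + s)%C - f z) <= (Cmod l + 1) * Cmod s.
Proof.
  intros h. destruct (h 1) as (d & hd & h1); [lra|]. exists d. split; [easy|]. intros s hs.
  replace (f (z + s)%C - f z)%C with ((f (z + s)%C - f z - l * s) + l * s)%C by ring.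
  eapply Rle_trans; [apply Cmod_triangle|]. rewrite Cmod_mult. specialize (h1 s hs). lra.
Qed.

(** The quadratic Taylor estimate supplies a joint linear part at the point, which uniqueness of
    derivatives identifies with the partial derivatives A and B. *)
Lemma chain_rule h u w t u' w' A B :
  hol (fun x y => h (u t + x) (w t + y))%C ->
  cder u t u' -> cder w t w' ->
  cder (fun s => h s (w t)) (u t) A -> cder (fun s => h (u t) s) (w t) B ->
  cder (fun s => h (u s) (w s)) t (A * u' + B * w')%C.
Proof.
  intros hh hu hw hA hB.
  destruct (hol_taylor _ hh) as (A' & B' & K & d & hd & hK & T). rewrite !Cplus_0_r in T.
  assert (A = A') as <-.
  { apply (cder_unique (fun s => h s (w t)) (u t)); [easy|].
    apply cder_of_bound with K d; [easy|]. intros s hs.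
    assert (h1 := T s (RtoC 0) (Cmod s)). rewrite Cmod_0, Cplus_0_r in h1.
    replace (h (u t + s) (w t) - h (u t) (w t) - A' * s)%C
      with (h (u t + s) (w t) - (h (u t) (w t) + A' * s + B' * 0))%C by ring.
    apply h1; [lra|apply Cmod_ge_0|lra]. }
  assert (B = B') as <-.
  { apply (cder_unique (fun s => h (u t) s) (w t)); [easy|].
    apply cder_of_bound with K d; [easy|]. intros s hs.
    assert (h1 := T (RtoC 0) s (Cmod s)). rewrite Cmod_0, Cplus_0_r in h1.
    replace (h (u t) (w t + s) - h (u t) (w t) - B' * s)%C
      with (h (u t) (w t + s) - (h (u t) (w t) + A * 0 + B' * s))%C by ring.
    apply h1; [apply Cmod_ge_0|lra|lra]. }
  destruct (cder_lip _ _ _ hu) as (d1 & hd1 & L1). destruct (cder_lip _ _ _ hw) as (d2 & hd2 & L2).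
  set (L := Cmod u' + Cmod w' + 1).
  assert (L0 : 1 <= L) by (unfold L; generalize (Cmod_ge_0 u') (Cmod_ge_0 w'); lra).
  intros eps he.
  set (e1 := eps / (3 * (Cmod A + 1))). set (e2 := eps / (3 * (Cmod B + 1))).
  assert (a0 := Cmod_ge_0 A). assert (b0 := Cmod_ge_0 B).
  assert (e10 : 0 < e1) by (apply Rdiv_lt_0_compat; lra).
  assert (e20 : 0 < e2) by (apply Rdiv_lt_0_compat; lra).
  destruct (hu e1 e10) as (d3 & hd3 & U). destruct (hw e2 e20) as (d4 & hd4 & W).
  set (d5 := Rmin (d / L) (eps / (3 * (K * L ^ 2 + 1)))).
  assert (KL : 0 <= K * L ^ 2) by (apply Rmult_le_pos; [easy|apply pow_le; lra]).
  assert (d50 : 0 < d5) by (apply Rmin_glb_lt; apply Rdiv_lt_0_compat; lra).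
  exists (Rmin (Rmin d1 d2) (Rmin (Rmin d3 d4) d5)).
  split.
  { apply Rmin_glb_lt; apply Rmin_glb_lt; auto. now apply Rmin_glb_lt. }
  intros s hs.
  generalize (Rmin_l (Rmin d1 d2) (Rmin (Rmin d3 d4) d5)) (Rmin_r (Rmin d1 d2) (Rmin (Rmin d3 d4) d5))
    (Rmin_l d1 d2) (Rmin_r d1 d2) (Rmin_l (Rmin d3 d4) d5) (Rmin_r (Rmin d3 d4) d5)
    (Rmin_l d3 d4) (Rmin_r d3 d4) (Rmin_l (d / L) (eps / (3 * (K * L ^ 2 + 1))))
    (Rmin_r (d / L) (eps / (3 * (K * L ^ 2 + 1)))). fold d5. intros.
  specialize (L1 s ltac:(lra)). specialize (L2 s ltac:(lra)).
  specialize (U s ltac:(lra)). specialize (W s ltac:(lra)).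
  assert (s0 := Cmod_ge_0 s).
  set (x := (u (t + s)%C - u t)%C) in *. set (y := (w (t + s)%C - w t)%C) in *.
  assert (hx : Cmod x <= L * Cmod s).
  { apply Rle_trans with (1 := L1). apply Rmult_le_compat_r; [easy|].
    unfold L. generalize (Cmod_ge_0 w'); lra. }
  assert (hy : Cmod y <= L * Cmod s).
  { apply Rle_trans with (1 := L2). apply Rmult_le_compat_r; [easy|].
    unfold L. generalize (Cmod_ge_0 u'); lra. }
  assert (hm : L * Cmod s <= d).
  { apply mul_le_of_le_div; lra. }
  specialize (T x y _ hx hy hm).
  replace (u t + x)%C with (u (t + s)%C) in T by (unfold x; ring).
  replace (w t + y)%C with (w (t + s)%C) in T by (unfold y; ring).
  replace (h (u (t + s)%C) (w (t + s)%C) - h (u t) (w t) - (A * u' + B * w') * s)%C with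
    ((h (u (t + s)%C) (w (t + s)%C) - (h (u t) (w t) + A * x + B * y))
     + (A * (x - u' * s) + B * (y - w' * s)))%C by ring.
  eapply Rle_trans; [apply Cmod_triangle|].
  assert (Cmod (A * (x - u' * s) + B * (y - w' * s)) <= 2 * (eps / 3) * Cmod s).
  { eapply Rle_trans; [apply Cmod_triangle|]. rewrite !Cmod_mult.
    assert (Cmod A * Cmod (x - u' * s) <= eps / 3 * Cmod s).
    { apply Rle_trans with ((Cmod A + 1) * (e1 * Cmod s)).
      - apply Rmult_le_compat; try apply Cmod_ge_0; lra.
      - apply Req_le. unfold e1. field. lra. }
    assert (Cmod B * Cmod (y - w' * s) <= eps / 3 * Cmod s).
    { apply Rle_trans with ((Cmod B + 1) * (e2 * Cmod s)).
      - apply Rmult_le_compat; try apply Cmod_ge_0; lra.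
      - apply Req_le. unfold e2. field. lra. }
    lra. }
  assert (K * (L * Cmod s) ^ 2 <= eps / 3 * Cmod s).
  { replace (K * (L * Cmod s) ^ 2) with (K * L ^ 2 * Cmod s * Cmod s) by ring.
    apply Rmult_le_compat_r; [easy|].
    apply Rle_trans with ((K * L ^ 2 + 1) * (eps / (3 * (K * L ^ 2 + 1)))).
    - apply Rmult_le_compat; lra.
    - apply Req_le. field. lra. }
  lra.
Qed.

(** Restricted to x = 0 the series is null, so the coefficients without a factor x vanish and the
    others can be shifted. *)
Lemma hol_divx1 H : hol H -> (exists d, 0 < d /\ forall y, Cmod y < d -> H (RtoC 0) y = 0%C) ->
  exists H1, hol H1 /\ near (fun x y => H x y = (x * H1 x y)%C).
Proof.
  intros (r & N & a & ha) (d & hd & h0). destruct ha as (hr & hN & hs).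
  assert (z : forall j, a O j = 0%C).
  { apply (pser_unique (fun j => a O j) r N (Rmin d r)); auto; [|now apply Rmin_glb_lt|].
    - intros n. apply Rle_trans with (2 := hN n). apply rsum_le. intros k _.
      apply Rmult_le_compat_r; [apply pow_le; lra|]. unfold hn. rewrite rsum_shift.
      replace (k - 0)%nat with k by lia. generalize (rsum_ge0 (fun i => Cmod (a (S i) (k - S i)%nat)) k).
      intros q. specialize (q (fun _ => Cmod_ge_0 _)). lra.
    - intros t ht. rmin_bounds. rewrite <- (h0 t) by lra.
      apply ser_ext with (fun n => hom a n 0 t).
      + intros n. unfold hom. rewrite csum_shift, csum_0.
        * replace (n - 0)%nat with n by lia. simpl. ring.
        * intros k _. simpl. ring.
      + apply hs; [rewrite Cmod_0|]; lra. }
  set (b := fun i j => a (S i) j).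
  assert (hnb : forall n, hn b n = hn a (S n)).
  { intros n. unfold hn, b. rewrite (rsum_shift _ (S n)), z, Cmod_0, Rplus_0_l.
    apply rsum_ext. intros. easy. }
  assert (eb : expan r (N / r) b (fun x y => ssum (fun n => hom b n x y))).
  { apply expan_of_coef; [easy|]. intros n. apply Rmult_le_reg_r with r; [easy|].
    replace (N / r * r) with N by (field; lra). apply Rle_trans with (2 := hN (S n)).
    rewrite rsum_shift, Rmult_comm, <- rsum_scal.
    rewrite (rsum_ext _ (fun k => hn a (S k) * r ^ S k)).
    - generalize (hn_pow_ge0 a 0 r ltac:(lra)). lra.
    - intros k _. rewrite hnb. simpl. ring. }
  exists (fun x y => ssum (fun n => hom b n x y)). split.
  - exists r, (N / r), b. easy.
  - exists r. split; [easy|]. intros x y hx hy.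
    destruct eb as (_ & _ & hb). specialize (hb x y ltac:(lra) ltac:(lra)).
    apply (ser_unique (fun n => hom a n x y)); [apply hs; lra|].
    assert (e : forall i j, a i j = sx_coef b i j) by (intros [|i] j; [apply z|easy]).
    apply ser_ext with (fun n => hom (sx_coef b) n x y).
    + intros n. apply csum_ext. intros. now rewrite e.
    + replace (x * ssum (fun n => hom b n x y))%C
        with (hom (sx_coef b) 0 x y + x * ssum (fun n => hom b n x y))%C by (rewrite hom_sx0; ring).
      apply (ser_shift (fun n => hom (sx_coef b) n x y)).
      apply ser_ext with (fun n => x * hom b n x y)%C; [intros; now rewrite hom_sx|].
      now apply ser_scal.
Qed.

(** Plays the part of the removable singularity theorem: a quotient estimated only where x is
    non-zero is holomorphic across the axis x = 0. *)
Lemma hol_divx H K T : hol H ->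
  near (fun x y => x <> 0%C -> Cmod (H x y) <= K * Cmod x ^ T) ->
  exists H', hol H' /\ near (fun x y => H x y = (x ^ T * H' x y)%C).
Proof.
  revert H. induction T as [|T IH]; intros H hH hK.
  - exists H. split; [easy|]. exists 1. split; [lra|]. intros. simpl. ring.
  - destruct hK as (d & hd & hK). destruct (hol_lip _ hH) as (L & d' & hd' & hL & lip).
    destruct (hol_divx1 H hH) as (H1 & h1 & e1).
    (* On the axis the value is null by continuity: it is compared with the value at a small real s,
       where the bound applies. *)
    { exists (Rmin d d'). split; [now apply Rmin_glb_lt|]. intros y hy.
      rmin_bounds.
      apply Cmod_small_eq0. intros eps he.
      destruct (small_real (Rabs K + L) (Rmin d d') eps) as (s & s0 & s1 & s2 & s3);
        [now apply Rmin_glb_lt|easy|].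
      assert (K1 := Rle_abs K). assert (cs := Cmod_real s ltac:(lra)).
      assert (b1 : Cmod (H s y) <= Rabs K * s).
      { apply Rle_trans with (K * Cmod s ^ S T).
        - apply hK; try lra. intros e. apply RtoC_inj in e. lra.
        - rewrite cs. assert (hp := pow_le_low s 1 (S T) ltac:(lra) ltac:(lia)). rewrite pow_1 in hp.
          assert (0 <= s ^ S T) by (apply pow_le; lra). assert (K2 := Rabs_pos K). nra. }
      assert (b2 : Cmod (H 0 y - H s y) <= L * s).
      { apply lip; rewrite ?Cmod_diag, ?(Cmod_minus_sym 0), ?Cmod_minus_0, ?Cmod_0; lra. }
      replace (H 0 y) with ((H 0 y - H s y) + H s y)%C by ring.
      eapply Rle_trans; [apply Cmod_triangle|]. lra. }
    destruct (IH H1 h1) as (H' & h' & e').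
    { destruct e1 as (d1 & hd1 & e1). exists (Rmin d d1).
      split; [now apply Rmin_glb_lt|]. intros x y hx hy x0.
      rmin_bounds.
      assert (p : 0 < Cmod x) by now apply Cmod_gt_0.
      apply Rmult_le_reg_l with (Cmod x); [easy|]. rewrite <- Cmod_mult, <- e1 by lra.
      apply Rle_trans with (K * Cmod x ^ S T); [apply hK; auto; lra|]. simpl. lra. }
    exists H'. split; [easy|]. apply near_imp with (2 := near_and _ _ e1 e').
    intros x y [-> ->]. simpl. ring.
Qed.

(** * Holomorphic differential equations *)

(** Coefficients recovered from the function alone, so that [prim] acts on functions and Picard
    iteration can be written without carrying expansions along. *)
Definition coef (h : C -> C -> C) : nat -> nat -> C :=
  epsilon (inhabits (fun _ _ => RtoC 0)) (fun a => exists r N, expan r N a h).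

Lemma coef_eq r N a h i j : expan r N a h -> coef h i j = a i j.
Proof.
  intros ha.
  assert (hc : exists r N, expan r N (coef h) h).
  { apply (epsilon_spec (inhabits (fun _ _ => RtoC 0)) (fun a => exists r N, expan r N a h)).
    now exists a, r, N. }
  destruct hc as (r' & N' & hc). apply (expan_unique _ _ _ _ _ _ _ _ hc ha).
  exists 1. split; [lra|easy].
Qed.

Definition pr_coef (a : nat -> nat -> C) (i j : nat) : C :=
  match i with O => RtoC 0 | S i' => (a i' j / INR (S i'))%C end.

Definition prim (h : C -> C -> C) (x y : C) : C :=
  ssum (fun n => hom (pr_coef (coef h)) n x y).

Lemma INR_C_nz n : RtoC (INR (S n)) <> 0%C.
Proof. intros e. apply RtoC_inj in e. now apply not_0_INR in e. Qed.

Lemma dx_pr a i j : dx_coef (pr_coef a) i j = a i j.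
Proof. unfold dx_coef, pr_coef. field. apply INR_C_nz. Qed.

Lemma hom_ext a b n x y : (forall i j, a i j = b i j) -> hom a n x y = hom b n x y.
Proof. intros e. apply csum_ext. intros. now rewrite e. Qed.

Lemma expan_prim r N a h : expan r N a h -> expan r (r * N) (pr_coef a) (prim h).
Proof.
  intros ha.
  assert (e : forall i j, pr_coef (coef h) i j = pr_coef a i j).
  { intros [|i] j; [easy|]. simpl. now rewrite (coef_eq r N a). }
  assert (hN0 := expan_N_ge0 _ _ _ _ ha). destruct ha as (hr & hN & hs).
  assert (hp : forall n, rsum (fun k => hn (pr_coef a) k * r ^ k) n <= r * N).
  { intros [|n]; [simpl; nra|]. rewrite rsum_shift.
    apply Rle_trans with (0 + rsum (fun k => r * (hn a k * r ^ k)) n).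
    - apply Rplus_le_compat.
      + unfold hn. simpl. rewrite Cmod_0. lra.
      + apply rsum_le. intros k _.
        assert (hn (pr_coef a) (S k) <= hn a k).
        { unfold hn. rewrite rsum_shift. cbn [pr_coef]. rewrite Cmod_0, Rplus_0_l.
          apply rsum_le. intros i _. change (S k - S i)%nat with (k - i)%nat.
          unfold Cdiv. rewrite Cmod_mult, Cmod_inv by apply INR_C_nz.
          rewrite Cmod_R, Rabs_right by apply Rle_ge, pos_INR.
          rewrite <- (Rmult_1_r (Cmod (a i (k - i)%nat))) at 2.
          apply Rmult_le_compat_l; [apply Cmod_ge_0|].
          rewrite <- Rinv_1. apply Rinv_le_contravar; [lra|].
          change 1 with (INR 1). apply le_INR. lia. }
        assert (0 <= r ^ S k) by (apply pow_le; lra).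
        apply Rle_trans with (hn a k * r ^ S k); [nra|]. simpl. apply Req_le. ring.
    - rewrite rsum_scal. specialize (hN n). nra. }
  destruct (expan_of_coef r (r * N) (pr_coef a) hr hp) as (_ & _ & hv).
  split; [easy|]. split; [easy|]. intros x y hx hy.
  apply ser_ext with (fun n => hom (pr_coef (coef h)) n x y).
  - intros n. now apply hom_ext.
  - unfold prim. apply ssum_correct with (ssum (fun n => hom (pr_coef a) n x y)).
    apply ser_ext with (2 := hv x y hx hy). intros n. symmetry. now apply hom_ext.
Qed.

Lemma an_prim r N h : an r N h -> an r (r * N) (prim h).
Proof. intros [a ha]. exists (pr_coef a). now apply expan_prim. Qed.

Lemma prim_0 r N h y : an r N h -> Cmod y <= r -> prim h 0 y = 0%C.
Proof.
  intros [a ha] hy. assert (hp := expan_prim _ _ _ _ ha). destruct hp as (hr & _ & hs).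
  apply (ser_unique (fun n => hom (pr_coef a) n 0 y)); [apply hs; [rewrite Cmod_0; lra|easy]|].
  apply ser_ext with (fun _ => RtoC 0); [|apply ser_0]. intros n. symmetry.
  apply csum_0. intros [|i] _; simpl; ring.
Qed.

Lemma prim_cder r N h x y :
  an r N h -> Cmod x < r / 8 -> Cmod y < r / 8 -> cder (fun t => prim h t y) x (h x y).
Proof.
  intros [a ha] hx hy. assert (hp := expan_prim _ _ _ _ ha).
  assert (hc := expan_cder _ _ _ _ x y hp hx hy). destruct ha as (hr & _ & hs).
  replace (h x y) with (ssum (fun n => hom (dx_coef (pr_coef a)) n x y)); [easy|].
  assert (hh : ser (fun n => hom (dx_coef (pr_coef a)) n x y) (h x y)).
  { apply ser_ext with (fun n => hom a n x y); [|apply hs; lra].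
    intros n. apply hom_ext. intros. now rewrite dx_pr. }
  apply (ser_unique (fun n => hom (dx_coef (pr_coef a)) n x y)); [|easy].
  now apply ssum_correct with (h x y).
Qed.

(** As [prim] goes through a choice of coefficients, its linearity has to come from their
    uniqueness. *)
Lemma an_prim_diff r N N' del h g :
  an r N h -> an r N' g -> an r del (fun x y => h x y - g x y)%C ->
  an r (r * del) (fun x y => prim h x y - prim g x y)%C.
Proof.
  intros [a ha] [b hb] [c hc].
  assert (hd := expan_plus _ _ _ _ _ _ _ ha (expan_scal _ _ _ _ (-(1))%C hb)).
  assert (e : forall i j, c i j = (a i j + (-(1)) * b i j)%C).
  { apply (expan_unique _ _ _ _ _ _ _ _ hc hd). exists 1. split; [lra|]. intros. ring. }
  apply an_ext with (prim (fun x y => h x y - g x y)%C).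
  - intros x y hx hy.
    destruct (expan_prim _ _ _ _ ha) as (_ & _ & pa).
    destruct (expan_prim _ _ _ _ hb) as (_ & _ & pb).
    destruct (expan_prim _ _ _ _ hc) as (_ & _ & pc).
    apply (ser_unique _ _ _ (pc x y hx hy)).
    apply ser_ext with (2 := ser_minus _ _ _ _ (pa x y hx hy) (pb x y hx hy)).
    intros n. unfold hom. rewrite csum_dist. apply csum_ext. intros i _.
    replace (pr_coef c i (n - i)%nat) with (pr_coef a i (n - i)%nat - pr_coef b i (n - i)%nat)%C.
    + ring.
    + destruct i as [|i]; simpl pr_coef; [ring|]. rewrite e. field. apply INR_C_nz.
  - apply an_prim. now exists c.
Qed.

Lemma prim_const r c x y : 0 < r -> Cmod x <= r -> Cmod y <= r ->
  prim (fun _ _ => c) x y = (x * c)%C.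
Proof.
  intros hr hx hy. assert (ha := expan_cst r c hr).
  destruct (expan_prim _ _ _ _ ha) as (_ & _ & hp).
  destruct (expan_mul_x _ _ _ _ ha) as (_ & _ & hq).
  apply (ser_unique _ _ _ (hp x y hx hy)). apply ser_ext with (2 := hq x y hx hy).
  intros n. apply hom_ext. intros [|i] j; [easy|]. simpl sx_coef. unfold pr_coef.
  destruct i as [|i].
  - simpl. field.
  - simpl cst_coef. field. apply INR_C_nz.
Qed.

(** The booleans index the two components, [true] for the first. Time is the variable x; y is
    carried along so that the algebra of series in two variables applies unchanged. *)
Fixpoint picard_iter (F : bool -> C -> C -> C) (p : bool -> C) (n : nat) : bool -> C -> C -> C :=
  match n with
  | O => fun i _ _ => p i
  | S m => fun i x y =>
      (p i + prim (fun s t => F i (picard_iter F p m true s t) (picard_iter F p m false s t)) x y)%C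
  end.

Lemma ser_tail_shift (u : nat -> C) l n :
  ser u l -> ser (fun m => u (n + m)%nat) (l - csum u n)%C.
Proof.
  intros h. induction n as [|n IH].
  - cbn [csum]. replace (l - 0)%C with l by ring. easy.
  - cbn [csum]. apply ser_ext with (fun m => u (n + S m)%nat); [intros; f_equal; lia|].
    apply (ser_shift (fun m => u (n + m)%nat)). rewrite Nat.add_0_r.
    now replace (u n + (l - (csum u n + u n)))%C with (l - csum u n)%C by ring.
Qed.

Lemma csum_telescope (u : nat -> C) n : csum (fun k => u (S k) - u k)%C n = (u n - u O)%C.
Proof. induction n as [|n IH]; cbn [csum]; [|rewrite IH]; ring. Qed.

(** A contraction of ratio 1/2 in the weighted norm. The two smallness conditions keep the iterates
    in the ball of radius [rho] and make the integral operator contract. The last clause is one more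
    application of the Lipschitz bound, starting from the distance r M between the solution and the
    constant p. *)
Lemma picard rho M L (b : bool -> nat -> nat -> C) F p r :
  (forall i, expan rho M (b i) (F i)) ->
  (forall i n, rsum (fun k => INR k * (hn (b i) k * rho ^ k)) n <= L) ->
  0 < r -> (forall i, Cmod (p i) + 2 * (r * M) <= rho) -> r * (L / rho) <= / 2 ->
  exists z : bool -> C -> C -> C,
    (forall i, an r rho (z i)) /\
    (forall i y, Cmod y <= r -> z i (RtoC 0) y = p i) /\
    (forall i x y, Cmod x <= r -> Cmod y <= r ->
       z i x y = (p i + prim (fun s t => F i (z true s t) (z false s t)) x y)%C) /\
    (forall i, near (fun x y => cder (fun t => z i t y) x (F i (z true x y) (z false x y)))) /\
    (forall i, an r (r * (L * (r * M / rho)))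
       (fun x y => z i x y - (p i + x * F i (p true) (p false)))%C).
Proof.
  intros hF hL hr hp hq.
  assert (hrho : 0 < rho) by apply (hF true).
  assert (hM : 0 <= M) by (eapply expan_N_ge0, (hF true)).
  assert (hL0 : 0 <= L) by apply (hL true O).
  assert (hrM : 0 <= r * M) by (apply Rmult_le_pos; lra).
  set (Z := picard_iter F p).
  set (Phi := fun i (u w : C -> C -> C) => prim (fun s t => F i (u s t) (w s t))).
  assert (hPhi : forall i u w, an r rho u -> an r rho w -> an r (r * M) (Phi i u w)).
  { intros i u w hu hw. apply an_prim. apply an_comp with rho; auto. now exists (b i). }
  assert (pc : forall i, an r (Cmod (p i)) (fun _ _ => p i)) by (intros; now apply an_const).
  assert (K1 : forall n i, an r rho (Z n i)).
  { induction n as [|n IH]; intros i.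
    - apply an_weaken with (1 := pc i). specialize (hp i). lra.
    - apply an_weaken with (Cmod (p i) + r * M); [|specialize (hp i); lra].
      apply (an_plus _ _ _ (fun _ _ => p i) (Phi i (Z n true) (Z n false))); auto. }
  assert (Lip : forall i u w u' w' del, an r rho u -> an r rho w -> an r rho u' -> an r rho w' ->
    an r del (fun x y => u x y - u' x y)%C -> an r del (fun x y => w x y - w' x y)%C ->
    an r (r * (L * (del / rho))) (fun x y => Phi i u w x y - Phi i u' w' x y)%C).
  { intros i u w u' w' del hu hw hu' hw' du dw. unfold Phi.
    apply an_prim_diff with M M.
    - apply an_comp with rho; auto. now exists (b i).
    - apply an_comp with rho; auto. now exists (b i).
    - apply (an_lip rho M (b i)); auto. }
  assert (half : forall del, 0 <= del -> r * (L * (del / rho)) <= del * / 2).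
  { intros del hd. replace (r * (L * (del / rho))) with (del * (r * (L / rho))) by (field; lra).
    now apply Rmult_le_compat_l. }
  assert (K2 : forall n i, an r (r * M * (/ 2) ^ n) (fun x y => Z (S n) i x y - Z n i x y)%C).
  { induction n as [|n IH]; intros i.
    - apply an_ext with (Phi i (Z O true) (Z O false)).
      + intros x y _ _. simpl. unfold Phi, Z. simpl. ring.
      + simpl. rewrite Rmult_1_r. apply hPhi; auto.
    - apply an_ext with (fun x y => Phi i (Z (S n) true) (Z (S n) false) x y
         - Phi i (Z n true) (Z n false) x y)%C.
      + intros x y _ _. unfold Phi. change (Z (S (S n)) i x y) with
          (p i + Phi i (Z (S n) true) (Z (S n) false) x y)%C.
        change (Z (S n) i x y) with (p i + Phi i (Z n true) (Z n false) x y)%C.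
        unfold Phi. ring.
      + apply an_weaken with (r * (L * (r * M * (/ 2) ^ n / rho))).
        * apply Lip; auto.
        * replace (r * M * (/ 2) ^ S n) with (r * M * (/ 2) ^ n * / 2) by (simpl; ring).
          apply half. apply Rmult_le_pos; [easy|apply pow_le; lra]. }
  assert (geo : forall n q, rsum (fun m => r * M * (/ 2) ^ (n + m)) q <= 2 * (r * M) * (/ 2) ^ n).
  { intros n q. rewrite (rsum_ext _ (fun m => r * M * (/ 2) ^ n * (/ 2) ^ m)).
    - rewrite rsum_scal. assert (g := rsum_geom (/ 2) q ltac:(lra)).
      assert (0 <= r * M * (/ 2) ^ n) by (apply Rmult_le_pos; [easy|apply pow_le; lra]).
      replace (/ (1 - / 2)) with 2 in g by field.
      apply Rle_trans with (r * M * (/ 2) ^ n * 2); [now apply Rmult_le_compat_l|].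
      apply Req_le. ring.
    - intros. rewrite pow_add. ring. }
  set (u := fun i x y n => (Z (S n) i x y - Z n i x y)%C).
  assert (cv : forall i x y, Cmod x <= r -> Cmod y <= r -> ser (u i x y) (ssum (u i x y))).
  { intros i x y hx hy. destruct (ser_abs_conv (u i x y) (2 * (r * M) * (/ 2) ^ 0)) as [l hl].
    - intros n. apply Rle_trans with (2 := geo O n). apply rsum_le. intros k _.
      apply (an_bound r _ _ x y (K2 k i)); easy.
    - now apply ssum_correct with l. }
  set (z := fun i x y => (p i + ssum (u i x y))%C).
  assert (K3 : forall n i, an r (2 * (r * M) * (/ 2) ^ n) (fun x y => z i x y - Z n i x y)%C).
  { intros n i. apply an_series with (N := fun m => r * M * (/ 2) ^ (n + m))
      (h := fun m x y => u i x y (n + m)%nat); auto.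
    - intros m. apply (K2 (n + m)%nat i).
    - intros x y hx hy. replace (z i x y - Z n i x y)%C
        with (ssum (u i x y) - csum (u i x y) n)%C; [apply ser_tail_shift; auto|].
      unfold u at 2. rewrite (csum_telescope (fun n => Z n i x y)). unfold z.
      change (Z O i x y) with (p i). ring. }
  assert (zr : forall i, an r rho (z i)).
  { intros i. apply an_weaken with (Cmod (p i) + 2 * (r * M) * (/ 2) ^ 0); [|simpl; specialize (hp i); lra].
    apply an_ext with (fun x y => p i + (z i x y - Z O i x y))%C.
    - intros. unfold Z. simpl. ring.
    - apply (an_plus _ _ _ (fun _ _ => p i) (fun x y => z i x y - Z O i x y)%C); auto. }
  (* Both sides are within a geometric remainder of the same iterate, for every n. *)
  assert (eq : forall i x y, Cmod x <= r -> Cmod y <= r ->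
    z i x y = (p i + Phi i (z true) (z false) x y)%C).
  { intros i x y hx hy.
    apply Cminus_eq0.
    assert (bd : forall n, Cmod (z i x y - (p i + Phi i (z true) (z false) x y))%C
       <= 2 * (r * M) * (/ 2) ^ n).
    { intros n. replace (z i x y - (p i + Phi i (z true) (z false) x y))%C with
       ((z i x y - Z (S n) i x y) - (Phi i (z true) (z false) x y - Phi i (Z n true) (Z n false) x y))%C
       by (change (Z (S n) i x y) with (p i + Phi i (Z n true) (Z n false) x y)%C; ring).
      eapply Rle_trans; [apply Cmod_triangle_minus|].
      assert (h1 := an_bound _ _ _ x y (K3 (S n) i) hx hy).
      assert (h2 := an_bound _ _ _ x y (Lip i _ _ _ _ _ (zr true) (zr false) (K1 n true) (K1 n false)
        (K3 n true) (K3 n false)) hx hy).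
      simpl in h1, h2. simpl pow in h1.
      assert (h3 := half (2 * (r * M) * (/ 2) ^ n)).
      assert (0 <= 2 * (r * M) * (/ 2) ^ n) by (apply Rmult_le_pos; [lra|apply pow_le; lra]).
      specialize (h3 H). simpl in *. lra. }
    apply Cmod_small_eq0. intros eps he.
    destruct (pow_lt_1_zero (/ 2) ltac:(rewrite Rabs_right; lra) (eps / (2 * (r * M) + 1))) as [N hN].
    { apply Rdiv_lt_0_compat; lra. }
    specialize (hN N (le_n _)). rewrite Rabs_right in hN by (apply Rle_ge, pow_le; lra).
    apply Rle_trans with (1 := bd N).
    apply Rle_trans with ((2 * (r * M) + 1) * (eps / (2 * (r * M) + 1))).
    - apply Rmult_le_compat; try lra. apply pow_le. lra.
    - apply Req_le. field. lra. }
  assert (hFz : forall i, an r M (fun s t => F i (z true s t) (z false s t))).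
  { intros i. apply an_comp with rho; auto. now exists (b i). }
  exists z. split; [easy|]. split; [|split; [exact eq|split]].
  - intros i y hy. rewrite eq; [|rewrite Cmod_0; lra|easy].
    unfold Phi. rewrite (prim_0 r M); auto. ring.
  - intros i. exists (r/8). split; [lra|]. intros x y hx hy.
    assert (hc := prim_cder r M _ x y (hFz i) hx hy).
    assert (hd : 0 < r / 8 - Cmod x) by lra.
    apply cder_ext with (fun t => p i + Phi i (z true) (z false) t y)%C (r / 8 - Cmod x); [easy| |].
    + intros s hs. symmetry. apply eq; [|lra].
      eapply Rle_trans; [apply Cmod_triangle|]. lra.
    + intros eps he. destruct (hc eps he) as (d & hd' & h). exists d. split; [easy|].
      intros s hs. replace (p i + Phi i (z true) (z false) (x + s) y - (p i + Phi i (z true) (z false) x y))%C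
        with (Phi i (z true) (z false) (x + s) y - Phi i (z true) (z false) x y)%C by ring.
      now apply h.
  (* The affine term is the first iterate, so the difference is that of [Phi] at the solution and at
     the constant p. *)
  - intros i. apply an_ext with (fun x y => Phi i (z true) (z false) x y
      - Phi i (Z O true) (Z O false) x y)%C.
    + intros x y hx hy. rewrite (eq i x y hx hy).
      assert (e : Phi i (Z O true) (Z O false) x y = (x * F i (p true) (p false))%C).
      { unfold Phi, Z. simpl. now apply (prim_const r). }
      rewrite e. ring.
    + apply Lip; auto; [set (j := true)|set (j := false)];
        (apply an_ext with (Phi j (z true) (z false));
         [intros x y hx hy; rewrite (eq j x y hx hy); unfold Z; simpl; ring|now apply hPhi]).
Qed.

(** * Exponentials and flows *)

(** Balls of C are squares in the two real coordinates, whence the halved radius. *)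
Lemma locally_C (z : C) (P : C -> Prop) :
  locally z P <-> exists d, 0 < d /\ forall w, Cmod (w - z) < d -> P w.
Proof.
  split.
  - intros [e he]. exists e. split; [apply cond_pos|]. intros w hw. apply he. split.
    + eapply Rle_lt_trans; [apply (Re_le w z)|easy].
    + eapply Rle_lt_trans; [apply (Im_le w z)|easy].
  - intros (d & hd & h). assert (hd2 : 0 < d / 2) by lra. exists (mkposreal _ hd2).
    intros w [h1 h2]. apply h. change (Rabs (fst w - fst z) < d / 2) in h1.
    change (Rabs (snd w - snd z) < d / 2) in h2.
    eapply Rle_lt_trans; [apply Cmod_le_parts|]. simpl. unfold Rminus in *. lra.
Qed.

Lemma locally_O2 (P : C * C -> Prop) :
  locally (O2 : C * C) P <-> near (fun x y => P (x, y)).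
Proof.
  split.
  - intros [e he]. exists e. split; [apply cond_pos|]. intros x y hx hy. apply he.
    assert (b : forall w, Cmod w < e -> ball (RtoC 0) e w).
    { intros w hw. replace w with (w - 0)%C in hw by ring. split.
      + eapply Rle_lt_trans; [apply (Re_le w 0)|easy].
      + eapply Rle_lt_trans; [apply (Im_le w 0)|easy]. }
    split; now apply b.
  - intros (d & hd & h). assert (hd2 : 0 < d / 2) by lra. exists (mkposreal _ hd2).
    intros [x y] [h1 h2].
    assert (b : forall w, ball (RtoC 0) (d/2) w -> Cmod w < d).
    { intros w [h3 h4]. change (Rabs (fst w - 0) < d / 2) in h3.
      change (Rabs (snd w - 0) < d / 2) in h4. rewrite Rminus_0_r in *.
      eapply Rle_lt_trans; [apply Cmod_le_parts|]. lra. }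
    apply h; now apply b.
Qed.

Lemma sum_n_csum (a : nat -> C) n : sum_n a n = csum a (S n).
Proof.
  induction n as [|n IH].
  - rewrite sum_O. simpl. ring.
  - rewrite sum_Sn, IH. easy.
Qed.

Lemma is_series_ser (a : nat -> C) (l : C) :
  is_series (K := C_AbsRing) (V := C_NormedModule) a l <-> ser a l.
Proof.
  split.
  - intros h eps he. destruct (h (fun w => Cmod (w - l) < eps)) as [N hN].
    { apply locally_C. exists eps. auto. }
    exists (S N). intros [|n] hn; [lia|]. rewrite <- sum_n_csum. apply hN. lia.
  - intros h P hP. apply locally_C in hP. destruct hP as (d & hd & hP).
    destruct (h d hd) as [N hN]. exists N. intros n hn. apply hP.
    generalize (hN (S n) ltac:(lia)). rewrite <- sum_n_csum. intros q; exact q.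
Qed.

Lemma cder_is_derive f z l :
  cder f z l -> is_derive (K := C_AbsRing) (V := C_NormedModule) f z l.
Proof.
  intros h. split; [apply is_linear_scal_l|]. intros x hx.
  assert (e : z = x).
  { apply (@is_filter_lim_locally_unique C_AbsRing (AbsRing_NormedModule C_AbsRing)). exact hx. }
  subst x. intros eps. destruct (h eps (cond_pos eps)) as (d & hd & hh).
  assert (G : forall y : C, Cmod (y - z) < d ->
    Cmod (f y - f z - (y - z) * l) <= eps * Cmod (y - z)).
  { intros y hy. specialize (hh (y - z)%C hy). replace (z + (y - z))%C with y in hh by ring.
    now rewrite (Cmult_comm (y - z)). }
  exists (mkposreal d hd). intros y hy. exact (G y hy).
Qed.

Lemma cder_C_derive f z l : cder f z l -> C_derive f z = l.
Proof. intros h. now apply is_C_derive_unique, cder_is_derive. Qed.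

Definition hol_at (h : C * C -> C) (p : C * C) : Prop :=
  hol (fun x y => h (fst p + x, snd p + y)%C).

Lemma rsum_half n : rsum (fun k => (/ 2) ^ k) n <= 2.
Proof. eapply Rle_trans; [apply rsum_geom; lra|]. apply Req_le. field. Qed.

(** From a bound on coefficients to a bound in norm: degree k has k + 1 coefficients, and (k + 1) /
    4^k is at most 1 / 2^k, of total at most 2. Hence the radius r / 4 and the norm 2 K. *)
Lemma holomorphic2_hol g p : holomorphic2_at g p <-> hol_at g p.
Proof.
  split.
  - intros (a & r & K & hr & hK & hs).
    assert (K0 : 0 <= K).
    { apply Rle_trans with (2 := hK O O). apply Rmult_le_pos; [apply Cmod_ge_0|apply pow_le; lra]. }
    exists (r/4), (2 * K), a. split; [lra|]. split.
    + intros n. apply Rle_trans with (K * rsum (fun k => (/ 2) ^ k) n).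
      2:{ generalize (rsum_half n). nra. }
      rewrite <- rsum_scal. apply rsum_le. intros k _.
      apply Rle_trans with (INR (S k) * K * (/ 4) ^ k).
      * unfold Rdiv. rewrite Rpow_mult_distr, <- Rmult_assoc.
        apply Rmult_le_compat_r; [apply pow_le; lra|]. unfold hn.
        rewrite Rmult_comm, <- rsum_scal.
        apply Rle_trans with (rsum (fun _ => K * 1) (S k)).
        -- apply rsum_le. intros i hi. specialize (hK i (k - i)%nat).
           replace (i + (k - i))%nat with k in hK by lia. lra.
        -- apply Req_le. rewrite rsum_scal, Rmult_comm. f_equal.
           clear. generalize (S k). intros m. induction m as [|m IH]; [easy|].
           cbn [rsum]. rewrite IH, S_INR. ring.
      * assert (h2 : INR (S k) <= 2 ^ k).
        { clear. induction k as [|k IH]; [simpl; lra|]. rewrite S_INR. cbn [pow].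
          assert (1 <= 2 ^ k) by (apply pow_R1_Rle; lra). lra. }
        apply Rle_trans with (2 ^ k * K * (/ 4) ^ k).
        -- apply Rmult_le_compat_r; [apply pow_le; lra|]. now apply Rmult_le_compat_r.
        -- apply Req_le. replace (/ 2) with (2 * / 4) by field. rewrite Rpow_mult_distr. ring.
    + intros x y hx hy. apply is_series_ser.
      apply is_series_ext with (2 := hs x y ltac:(lra) ltac:(lra)).
      intros n. apply sum_n_csum.
  - intros (r & N & a & hr & hN & hs). exists a, r, N. split; [easy|]. split.
    + intros i j. apply (expan_term r N a (fun x y => g (fst p + x, snd p + y)%C)). now split.
    + intros x y hx hy. apply is_series_ext with (fun n => hom a n x y).
      * intros n. symmetry. apply sum_n_csum.
      * apply is_series_ser, hs; lra.
Qed.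

Lemma hol_at_Dx g p : hol_at g p -> hol_at (Dx g) p.
Proof.
  intros h. destruct (hol_dx _ h) as (h' & hh & e). apply hol_ext with (2 := hh).
  apply near_imp with (2 := e). intros x y hc. symmetry. unfold Dx. simpl.
  apply cder_C_derive. intros eps he. destruct (hc eps he) as (d & hd & k).
  exists d. split; [easy|]. intros s hs. rewrite <- Cplus_assoc. now apply k.
Qed.

Lemma hol_at_Dy g p : hol_at g p -> hol_at (Dy g) p.
Proof.
  intros h. destruct (hol_dy _ h) as (h' & hh & e). apply hol_ext with (2 := hh).
  apply near_imp with (2 := e). intros x y hc. symmetry. unfold Dy. simpl.
  apply cder_C_derive. intros eps he. destruct (hc eps he) as (d & hd & k).
  exists d. split; [easy|]. intros s hs. rewrite <- Cplus_assoc. now apply k.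
Qed.

Lemma hol_at_lie X g p :
  hol_at (fun q => fst (X q)) p -> hol_at (fun q => snd (X q)) p -> hol_at g p ->
  hol_at (lie X g) p.
Proof.
  intros h1 h2 hg. unfold lie. apply hol_plus.
  - apply hol_mult; [easy|now apply hol_at_Dx].
  - apply hol_mult; [easy|now apply hol_at_Dy].
Qed.

Lemma hol_at_fst p : hol_at fst p.
Proof. apply (hol_plus (fun _ _ => fst p) (fun x _ => x)); [apply hol_const|apply hol_x]. Qed.

Lemma hol_at_snd p : hol_at snd p.
Proof. apply (hol_plus (fun _ _ => snd p) (fun _ y => y)); [apply hol_const|apply hol_y]. Qed.

Lemma hol_at_Dx_cder g p : hol_at g p -> cder (fun t => g (t, snd p)) (fst p) (Dx g p).
Proof.
  intros h. destruct (hol_dx _ h) as (h' & _ & d & hd & e).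
  assert (k := e (RtoC 0) (RtoC 0)). rewrite Cmod_0, Cplus_0_r in k. specialize (k hd hd).
  assert (k' : cder (fun t => g (t, snd p)) (fst p) (h' (RtoC 0) (RtoC 0))).
  { intros eps he. destruct (k eps he) as (d' & hd' & l). exists d'. split; [easy|].
    intros s hs. specialize (l s hs). now rewrite Cplus_0_l, Cplus_0_r in l. }
  unfold Dx. now rewrite (cder_C_derive _ _ _ k').
Qed.

Lemma hol_at_Dy_cder g p : hol_at g p -> cder (fun t => g (fst p, t)) (snd p) (Dy g p).
Proof.
  intros h. destruct (hol_dy _ h) as (h' & _ & d & hd & e).
  assert (k := e (RtoC 0) (RtoC 0)). rewrite Cmod_0, Cplus_0_r in k. specialize (k hd hd).
  assert (k' : cder (fun t => g (fst p, t)) (snd p) (h' (RtoC 0) (RtoC 0))).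
  { intros eps he. destruct (k eps he) as (d' & hd' & l). exists d'. split; [easy|].
    intros s hs. specialize (l s hs). now rewrite Cplus_0_l, Cplus_0_r in l. }
  unfold Dy. now rewrite (cder_C_derive _ _ _ k').
Qed.

(** The induction replaces h by its x-derivative and drops the first term of the chain W of
    successive derivatives. *)
Lemma taylor_coef n : forall r N a h (W : nat -> C -> C) d,
  expan r N a h -> 0 < d -> (forall t, Cmod t < d -> W O t = h t (RtoC 0)) ->
  (forall k t, Cmod t < d -> cder (W k) t (W (S k) t)) ->
  W n (RtoC 0) = (INR (fact n) * a n O)%C.
Proof.
  induction n as [|n IH]; intros r N a h W d ha hd h0 hW.
  - rewrite h0 by now rewrite Cmod_0. rewrite (expan_00 _ _ _ _ ha). simpl. ring.
  - assert (hdx := expan_dx _ _ _ _ ha). assert (hr : 0 < r) by apply ha.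
    rewrite (IH (r/2) (2/r*N) (dx_coef a) _ (fun k => W (S k)) (Rmin d (r/8)) hdx).
    + unfold dx_coef. change (fact (S n)) with (S n * fact n)%nat.
      rewrite mult_INR, RtoC_mult. ring.
    + apply Rmin_glb_lt; lra.
    + intros t ht. rmin_bounds.
      apply (cder_unique (W O) t); [apply hW; lra|].
      apply cder_ext with (fun s => h s (RtoC 0)) (d - Cmod t); [lra| |].
      * intros s hs. symmetry. apply h0. eapply Rle_lt_trans; [apply Cmod_triangle|]. lra.
      * apply (expan_cder r N); [easy|lra|rewrite Cmod_0; lra].
    + intros k t ht. apply hW. generalize (Rmin_l d (r/8)). lra.
Qed.

(* The iterated Lie derivatives of a coordinate are its successive derivatives
   along the flow, so the exponential is the Taylor series of the flow, evaluated
   at time 1. *)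
Lemma exp_of_flow (X : C * C -> C * C) r N1 N2 Z1 Z2 d :
  1 < r -> an r N1 Z1 -> an r N2 Z2 -> 0 < d ->
  (forall t, Cmod t < d ->
     let p := (Z1 t (RtoC 0), Z2 t (RtoC 0)) in
     hol_at (fun q => fst (X q)) p /\ hol_at (fun q => snd (X q)) p /\
     cder (fun s => Z1 s (RtoC 0)) t (fst (X p)) /\ cder (fun s => Z2 s (RtoC 0)) t (snd (X p))) ->
  let p := (Z1 (RtoC 0) (RtoC 0), Z2 (RtoC 0) (RtoC 0)) in
  ser (fun n => / RtoC (INR (fact n)) * Nat.iter n (lie X) fst p)%C (Z1 (RtoC 1) (RtoC 0)) /\
  ser (fun n => / RtoC (INR (fact n)) * Nat.iter n (lie X) snd p)%C (Z2 (RtoC 1) (RtoC 0)).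
Proof.
  intros hr hZ1 hZ2 hd H p.
  (* The series of Z converges beyond 1, so its coefficients at time 0 determine the value at time
     1; the differential equation is used near time 0 only. *)
  assert (key : forall g N Z, (forall q, hol_at g q) -> an r N Z ->
    (forall t, Cmod t < d -> Z t (RtoC 0) = g (Z1 t (RtoC 0), Z2 t (RtoC 0))) ->
    ser (fun n => / RtoC (INR (fact n)) * Nat.iter n (lie X) g p)%C (Z (RtoC 1) (RtoC 0))).
  { intros g N Z hg [a ha] e.
    set (W := fun n t => Nat.iter n (lie X) g (Z1 t (RtoC 0), Z2 t (RtoC 0))).
    assert (hol_it : forall n t, Cmod t < d ->
       hol_at (Nat.iter n (lie X) g) (Z1 t (RtoC 0), Z2 t (RtoC 0))).
    { induction n as [|n IH]; intros t ht; simpl; [apply hg|].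
      destruct (H t ht) as (h1 & h2 & _ & _). now apply hol_at_lie; [..|apply IH]. }
    assert (hW : forall k t, Cmod t < d -> cder (W k) t (W (S k) t)).
    { intros k t ht. destruct (H t ht) as (_ & _ & c1 & c2).
      assert (hk := hol_it k t ht).
      set (q := (Z1 t (RtoC 0), Z2 t (RtoC 0))) in *.
      replace (W (S k) t) with (Dx (Nat.iter k (lie X) g) q * fst (X q)
        + Dy (Nat.iter k (lie X) g) q * snd (X q))%C
        by (unfold W; fold q; simpl; unfold lie at 3; ring).
      apply (chain_rule (fun x y => Nat.iter k (lie X) g (x, y))
        (fun t => Z1 t (RtoC 0)) (fun t => Z2 t (RtoC 0)) t).
      - exact hk.
      - exact c1.
      - exact c2.
      - apply (hol_at_Dx_cder _ _ hk).
      - apply (hol_at_Dy_cder _ _ hk). }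
    apply ser_ext with (fun n => hom a n 1 0).
    - intros n. assert (T := taylor_coef n r N a Z W d ha hd
        (fun t ht => eq_sym (e t ht)) hW).
      change (Nat.iter n (lie X) g p) with (W n (RtoC 0)). rewrite T.
      unfold hom. cbn [csum]. rewrite csum_0.
      + rewrite Nat.sub_diag, Cpow_1_l. simpl. field. intros q. apply RtoC_inj in q.
        generalize (INR_fact_neq_0 n). auto.
      + intros k hk. replace (n - k)%nat with (S (n - k - 1)) by lia. simpl. ring.
    - apply ha; [rewrite Cmod_1|rewrite Cmod_0]; lra. }
  split.
  - apply (key fst N1 Z1); auto. apply hol_at_fst.
  - apply (key snd N2 Z2); auto. apply hol_at_snd.
Qed.

(** * Flows of fields with a given order of vanishing *)

Definition vanish_below (k : nat) (a : nat -> nat -> C) : Prop :=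
  forall i j, (i + j < k)%nat -> a i j = 0%C.

(** Vanishing to order k turns a reduction of the radius into a k-th power. The factor 2 in 2 rho /
    r pays for the weights of the Lipschitz bound, a degree n being at most 2^n, so that one
    constant serves for both. *)
Lemma expan_vanish_bounds r N a h k rho :
  expan r N a h -> vanish_below k a -> 0 < rho -> rho <= r / 2 ->
  expan rho (N * (2 * rho / r) ^ k) a h /\
  (forall n, rsum (fun k => INR k * (hn a k * rho ^ k)) n <= N * (2 * rho / r) ^ k).
Proof.
  intros ha hv h1 h2. assert (hrho := expan_shrink _ rho _ _ _ ha). destruct ha as (hr & hN & hs).
  assert (q0 : 0 < 2 * rho / r) by (apply Rdiv_lt_0_compat; lra).
  assert (q1 : 2 * rho / r <= 1).
  { apply Rmult_le_reg_r with r; [easy|]. replace (2 * rho / r * r) with (2 * rho) by (field; lra). lra. }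
  assert (term : forall n, 2 ^ n * (hn a n * rho ^ n) <= (2 * rho / r) ^ k * (hn a n * r ^ n)).
  { intros n. destruct (le_lt_dec k n) as [hk|hk].
    - replace (2 ^ n * (hn a n * rho ^ n)) with ((2 * rho / r) ^ n * (hn a n * r ^ n)).
      + apply Rmult_le_compat_r; [apply hn_pow_ge0; lra|].
        apply pow_le_low; [lra|easy].
      + unfold Rdiv. rewrite !Rpow_mult_distr, pow_inv. field. apply pow_nonzero. lra.
    - assert (hn a n = 0) as ->.
      { unfold hn. rewrite (rsum_ext _ (fun _ => 0 * 0)), rsum_scal; [ring|].
        intros i hi. rewrite hv, Cmod_0 by lia. ring. }
      lra. }
  assert (tot : forall n, rsum (fun n => 2 ^ n * (hn a n * rho ^ n)) n <= N * (2 * rho / r) ^ k).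
  { intros n. eapply Rle_trans; [apply rsum_le; intros; apply term|].
    rewrite rsum_scal, Rmult_comm. apply Rmult_le_compat_r; [apply pow_le; lra|easy]. }
  split.
  - destruct (hrho ltac:(lra)) as (_ & _ & hs'). split; [easy|]. split; [|easy].
    intros n. apply Rle_trans with (2 := tot n). apply rsum_le. intros i _.
    assert (1 <= 2 ^ i) by (apply pow_R1_Rle; lra).
    generalize (hn_pow_ge0 a i rho ltac:(lra)). nra.
  - intros n. apply Rle_trans with (2 := tot n). apply rsum_le. intros i _.
    apply Rmult_le_compat_r; [apply hn_pow_ge0; lra|apply INR_pow2].
Qed.

(** Picard iteration over the time disc of radius 2, which contains time 1, with values in the
    polydisc of radius 2 m. There a field of order k >= 2 has norm O(m^k), negligible before m, so
    the conditions of [picard] hold for m small. The error of the first iterate is O(m^(2k-1)), and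
    2k - 1 >= k + 1. *)
Lemma flow_exists r N (b : bool -> nat -> nat -> C) F k :
  (2 <= k)%nat -> (forall i, expan r N (b i) (F i)) -> (forall i, vanish_below k (b i)) ->
  exists m0 K, 0 < m0 /\ forall m p, 0 < m -> m <= m0 -> (forall i, Cmod (p i) <= m) ->
    exists z : bool -> C -> C -> C,
      (forall i, an 2 (2 * m) (z i)) /\
      (forall i, z i (RtoC 0) (RtoC 0) = p i) /\
      (forall i, near (fun x y => cder (fun t => z i t y) x (F i (z true x y) (z false x y)))) /\
      (forall i, Cmod (z i (RtoC 1) (RtoC 0) - (p i + F i (p true) (p false))) <= K * m ^ (k + 1)).
Proof.
  intros hk hF hv. assert (hr : 0 < r) by apply (hF true).
  assert (hN : 0 <= N) by (eapply expan_N_ge0, (hF true)).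
  (* The conditions of [picard] reduce to 4 M <= m, where M is at most N (4 m / r)^2: this asks for
     (64 N / r^2) m <= 1. *)
  set (c := 64 * N / r ^ 2 + 1). assert (r2 : 0 < r ^ 2) by now apply pow_lt.
  assert (c1 : 1 <= c).
  { unfold c. assert (0 <= 64 * N / r ^ 2) by (apply Rdiv_le_0_compat; lra). lra. }
  exists (Rmin (Rmin (r / 4) 1) (/ c)), (2 * (N * (4 / r) ^ k) * (N * (4 / r) ^ k)).
  split.
  { repeat apply Rmin_glb_lt; try lra. apply Rinv_0_lt_compat. lra. }
  intros m p hm hm0 hp.
  rmin_bounds.
  set (M := N * (2 * (2 * m) / r) ^ k).
  assert (hMe : M = N * (4 / r) ^ k * m ^ k).
  { unfold M. replace (2 * (2 * m) / r) with (4 / r * m) by (field; lra).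
    rewrite Rpow_mult_distr. ring. }
  assert (cm : c * m <= 1).
  { apply Rle_trans with (c * / c); [apply Rmult_le_compat_l; lra|]. apply Req_le. field. lra. }
  assert (hM : 4 * M <= m).
  { unfold M. replace (2 * (2 * m) / r) with (4 * m / r) by (field; lra).
    assert (q0 : 0 <= 4 * m / r) by (apply Rdiv_le_0_compat; lra).
    assert (q1 : 4 * m / r <= 1).
    { apply Rmult_le_reg_r with r; [easy|]. replace (4 * m / r * r) with (4 * m) by (field; lra). lra. }
    assert ((4 * m / r) ^ k <= (4 * m / r) ^ 2) by (apply pow_le_low; [lra|easy]).
    apply Rle_trans with (4 * (N * (4 * m / r) ^ 2)).
    - apply Rmult_le_compat_l; [lra|]. now apply Rmult_le_compat_l.
    - replace (4 * (N * (4 * m / r) ^ 2)) with (m * (64 * N / r ^ 2 * m)) by (field; lra).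
      assert (64 * N / r ^ 2 * m <= 1) by (unfold c in cm; lra). nra. }
  assert (B := fun i => expan_vanish_bounds r N (b i) (F i) k (2 * m) (hF i) (hv i)
     ltac:(lra) ltac:(lra)).
  assert (M0 : 0 <= M) by (eapply expan_N_ge0, (B true)).
  destruct (picard (2 * m) M M b F p 2) as (z & z1 & z2 & _ & z3 & z4).
  - intros i. apply (B i).
  - intros i. apply (B i).
  - lra.
  - intros i. specialize (hp i). lra.
  - apply Rmult_le_reg_r with (2 * m); [lra|].
    replace (2 * (M / (2 * m)) * (2 * m)) with (2 * M) by (field; lra). lra.
  - exists z. split; [easy|]. split; [|split; [easy|]].
    + intros i. apply z2. rewrite Cmod_0. lra.
    + intros i. assert (h := an_bound _ _ _ (RtoC 1) (RtoC 0) (z4 i)).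
      rewrite Cmod_1, Cmod_0, Cmult_1_l in h. specialize (h ltac:(lra) ltac:(lra)).
      apply Rle_trans with (1 := h).
      replace (2 * (M * (2 * M / (2 * m)))) with (2 * M * (M / m)) by (field; lra).
      rewrite hMe. replace (N * (4 / r) ^ k * m ^ k / m) with (N * (4 / r) ^ k * m ^ (k - 1)).
      * replace (2 * (N * (4 / r) ^ k * m ^ k) * (N * (4 / r) ^ k * m ^ (k - 1))) with
          (2 * (N * (4 / r) ^ k) * (N * (4 / r) ^ k) * (m ^ k * m ^ (k - 1))) by ring.
        apply Rmult_le_compat_l.
        -- assert (0 <= N * (4 / r) ^ k).
           { apply Rmult_le_pos; [easy|]. apply pow_le. apply Rdiv_le_0_compat; lra. }
           nra.
        -- rewrite pow_add. apply Rmult_le_compat_l; [apply pow_le; lra|].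
           apply pow_le_low; [lra|lia].
      * replace k with (S (k - 1)) at 4 by lia. simpl. field. lra.
Qed.

Lemma hol_at_near h : hol_at h O2 -> exists d, 0 < d /\
  forall x y, Cmod x <= d -> Cmod y <= d -> hol_at h (x, y).
Proof.
  intros hh. destruct (hol_recenter _ hh) as (d & hd & k). exists d. split; [easy|].
  intros x y hx hy. specialize (k x y hx hy). apply hol_ext with (2 := k).
  exists 1. split; [lra|]. intros s t _ _. simpl. f_equal. f_equal; ring.
Qed.

Lemma hol_at_O2 h : hol_at h O2 <-> hol (fun x y => h (x, y)).
Proof.
  split; apply hol_ext; (exists 1; split; [lra|]); intros s t _ _; simpl; f_equal; f_equal; ring.
Qed.

Definition comp (i : bool) (z : C * C) : C := if i then fst z else snd z.

Section Exponential.

Variables (X f : C * C -> C * C).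
Hypothesis (exp_f : is_exp X f).
Hypothesis (hX1 : hol_at (fun q => fst (X q)) O2) (hX2 : hol_at (fun q => snd (X q)) O2).

(** The exponential is the flow at time 1, whose first Picard iterate is the identity plus X. *)
Lemma exp_estimate r N b k :
  (2 <= k)%nat -> (forall i, expan r N (b i) (fun x y => comp i (X (x, y)))) ->
  (forall i, vanish_below k (b i)) ->
  exists K m0, 0 < m0 /\ forall i x y m, 0 < m -> m <= m0 -> Cmod x <= m -> Cmod y <= m ->
    Cmod (comp i (f (x, y)) - (comp i (x, y) + comp i (X (x, y)))) <= K * m ^ (k + 1).
Proof.
  intros hk hb hv. destruct (flow_exists r N b _ k hk hb hv) as (m0 & K & hm0 & flow).
  destruct (hol_at_near _ hX1) as (d1 & hd1 & near1).
  destruct (hol_at_near _ hX2) as (d2 & hd2 & near2).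
  apply locally_O2 in exp_f. destruct exp_f as (d3 & hd3 & hexp).
  exists K, (Rmin (Rmin m0 (d3 / 2)) (Rmin (d1 / 2) (d2 / 2))).
  split; [repeat apply Rmin_glb_lt; lra|]. intros i x y m hm hm' hx hy.
  rmin_bounds.
  destruct (flow m (fun i => comp i (x, y)) hm ltac:(lra)) as (z & z1 & z2 & z3 & z4).
  { now intros [|]. }
  destruct (near_and _ _ (z3 true) (z3 false)) as (d & hd & hc).
  assert (dd : 0 < Rmin d 1) by (apply Rmin_glb_lt; lra).
  rmin_bounds.
  destruct (exp_of_flow X 2 _ _ (z true) (z false) (Rmin d 1) ltac:(lra) (z1 true) (z1 false) dd)
    as [s1 s2].
  - intros t ht p.
    assert (b0 : forall i, Cmod (z i t (RtoC 0)) <= 2 * m).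
    { intros j. apply (an_bound 2 _ _ _ _ (z1 j)); [lra|rewrite Cmod_0; lra]. }
    destruct (hc t (RtoC 0)) as [c1 c2]; [lra|rewrite Cmod_0; lra|].
    repeat split; auto.
    + apply near1; eapply Rle_trans; [apply b0|lra|apply b0|lra].
    + apply near2; eapply Rle_trans; [apply b0|lra|apply b0|lra].
  - rewrite (z2 true), (z2 false) in s1, s2.
    destruct (hexp x y ltac:(lra) ltac:(lra)) as [e1 e2].
    apply is_series_ser in e1. apply is_series_ser in e2.
    specialize (z4 i). simpl in z4. destruct i; simpl in *.
    + now rewrite (ser_unique _ _ _ e1 s1).
    + now rewrite (ser_unique _ _ _ e2 s2).
Qed.

(* The flow on the leaf [y = Y x] is the lift of the flow of the one-dimensional
   field [x' = X1 (x, Y x)]. *)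
Lemma exp_leaf (Y l : C -> C) K :
  hol (fun x _ => Y x) -> Y (RtoC 0) = 0%C -> f O2 = O2 ->
  near (fun x _ => Cmod (fst (X (x, Y x))) <= K * Cmod x ^ 2) ->
  near (fun x _ => cder Y x (l x) /\ snd (X (x, Y x)) = (l x * fst (X (x, Y x)))%C) ->
  exists d, 0 < d /\ forall t, Cmod t < d -> exists e,
    Cmod e <= 2 * Cmod t /\ f (t, Y t) = (e, Y e).
Proof.
  intros hY Y0 f0 hK hl.
  destruct (hol_at_near _ hX1) as (d1 & hd1 & near1).
  destruct (hol_at_near _ hX2) as (d2 & hd2 & near2).
  assert (hA : hol (fun x _ => fst (X (x, Y x)))).
  { apply (hol_comp (fun x y => fst (X (x, y))) (fun x _ => x) (fun x _ => Y x)); auto.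
    - now apply (hol_at_O2 (fun q => fst (X q))).
    - apply hol_x. }
  destruct (hol_divx _ K 2 hA) as (g & (rg & Ng & ag & hg) & eg).
  { apply near_imp with (2 := hK). auto. }
  (* The scalar field is completed by a null second component, so that the planar flow theorem
     applies to it. *)
  set (F := fun (i : bool) (x y : C) => if i then (x * (x * g x y))%C else RtoC 0).
  assert (hrg : 0 < rg) by apply hg.
  assert (hF1 := expan_mul_x _ _ _ _ (expan_mul_x _ _ _ _ hg)).
  assert (hF2 := expan_cst rg (RtoC 0) hrg).
  set (b := fun i : bool => if i then sx_coef (sx_coef ag) else cst_coef (RtoC 0)).
  set (NN := Rmax (rg * (rg * Ng)) (Cmod 0)).
  assert (hF : forall i, expan rg NN (b i) (F i)).
  { intros [|].
    - destruct hF1 as (h1 & h2 & h3). split; [easy|]. split; [|easy].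
      intros n. eapply Rle_trans; [apply h2|apply Rmax_l].
    - destruct hF2 as (h1 & h2 & h3). split; [easy|]. split; [|easy].
      intros n. eapply Rle_trans; [apply h2|apply Rmax_r]. }
  assert (hv : forall i, vanish_below 2 (b i)).
  { intros [|] i j hij; simpl.
    - destruct i as [|[|i]]; [easy|easy|lia].
    - destruct i; [destruct j|]; easy. }
  destruct (flow_exists rg NN b F 2 (le_n _) hF hv) as (m0 & K0 & hm0 & flow).
  destruct hY as (rY & NY & aY).
  assert (hrY := an_r_gt0 _ _ _ aY).
  destruct (hol_lip1 Y) as (LY & dY & hdY & hLY & lipY); [now exists rY, NY|].
  destruct (near_and _ _ eg hl) as (d4 & hd4 & hnear).
  apply locally_O2 in exp_f. destruct exp_f as (d3 & hd3 & hexp).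
  assert (small : exists m1, 0 < m1 /\ forall m, m <= m1 ->
    m <= m0 /\ 2 * m <= rY / 2 /\ 2 * m <= dY /\ 2 * m < d4 /\ m < d3 /\ 2 * m <= d1 /\ 2 * m <= d2 /\
    LY * (2 * m) <= d1 /\ LY * (2 * m) <= d2 /\ LY * (2 * m) < d3 ).
  { set (e := Rmin (Rmin d1 d2) (d3 / 2)).
    assert (he : 0 < e) by (repeat apply Rmin_glb_lt; lra).
    assert (e1 : e <= d1) by (unfold e; eapply Rle_trans; [apply Rmin_l|apply Rmin_l]).
    assert (e2 : e <= d2) by (unfold e; eapply Rle_trans; [apply Rmin_l|apply Rmin_r]).
    assert (e3 : e <= d3 / 2) by (unfold e; apply Rmin_r).
    set (w := Rmin (Rmin m0 (rY / 4)) (Rmin (dY / 2) (d4 / 4))).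
    assert (hw : 0 < w) by (repeat apply Rmin_glb_lt; lra).
    assert (w1 : w <= m0) by (unfold w; eapply Rle_trans; [apply Rmin_l|apply Rmin_l]).
    assert (w2 : w <= rY / 4) by (unfold w; eapply Rle_trans; [apply Rmin_l|apply Rmin_r]).
    assert (w3 : w <= dY / 2) by (unfold w; eapply Rle_trans; [apply Rmin_r|apply Rmin_l]).
    assert (w4 : w <= d4 / 4) by (unfold w; eapply Rle_trans; [apply Rmin_r|apply Rmin_r]).
    destruct (small_real (2 * (LY + 1)) w e hw he) as (s & s0 & s1 & _ & s2).
    exists s. split; [easy|]. intros m hm.
    assert (2 * m * (LY + 1) <= e) by nra.
    destruct (Rle_lt_dec m 0); repeat split; nra. }
  destruct small as (m1 & hm1 & small).
  exists m1. split; [easy|]. intros t ht.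
  (* The flow theorem wants m > 0, so the origin is treated apart. *)
  destruct (Ceq_dec t (RtoC 0)) as [->|t0].
  { exists (RtoC 0). split; [rewrite Cmod_0; lra|]. rewrite Y0. exact f0. }
  assert (mp : 0 < Cmod t) by now apply Cmod_gt_0. set (m := Cmod t) in *.
  destruct (small m ltac:(lra)) as (q1 & q2 & q3 & q4 & q5 & q6 & q7 & q8 & q9 & q10).
  destruct (flow m (fun i : bool => if i then t else RtoC 0) mp q1) as (z & z1 & z2 & z3 & _).
  { intros [|]; [unfold m; lra|rewrite Cmod_0; lra]. }
  set (T := z true).
  assert (Tb : forall x y, Cmod x <= 2 -> Cmod y <= 2 -> Cmod (T x y) <= 2 * m).
  { intros x y hx hy. apply (an_bound 2 _ _ _ _ (z1 true)); easy. }
  assert (Yb : forall x, Cmod x <= 2 * m -> Cmod (Y x) <= LY * (2 * m)).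
  { intros x hx. replace (Y x) with (Y x - Y 0)%C by (rewrite Y0; ring).
    apply Rle_trans with (1 := lipY x (RtoC 0) ltac:(lra) ltac:(rewrite Cmod_0; lra)).
    rewrite Cmod_minus_0. now apply Rmult_le_compat_l. }
  assert (hT : an 2 rY T) by (apply an_weaken with (1 := z1 true); lra).
  assert (hYT : an 2 NY (fun x y => Y (T x y))).
  { apply (an_comp rY NY (fun x _ => Y x) 2 T T); auto. }
  destruct (z3 true) as (d & hd & hc).
  assert (dd : 0 < Rmin d 1) by (apply Rmin_glb_lt; lra).
  rmin_bounds.
  destruct (exp_of_flow X 2 _ _ T (fun x y => Y (T x y)) (Rmin d 1) ltac:(lra) hT hYT dd)
    as [s1 s2].
  - intros s hs p.
    assert (b0 : Cmod (T s (RtoC 0)) <= 2 * m) by (apply Tb; [lra|rewrite Cmod_0; lra]).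
    assert (b1 := Yb _ b0).
    assert (b2 : Cmod (z false s (RtoC 0)) <= 2 * m).
    { apply (an_bound 2 _ _ _ _ (z1 false)); [lra|rewrite Cmod_0; lra]. }
    destruct (hnear (T s (RtoC 0)) (z false s (RtoC 0)) ltac:(lra) ltac:(lra)) as (n1 & n2 & n3).
    assert (c1 : cder (fun s => T s (RtoC 0)) s (fst (X p))).
    { unfold p. rewrite n1. specialize (hc s (RtoC 0) ltac:(lra) ltac:(rewrite Cmod_0; lra)).
      unfold F in hc. fold T in hc.
      replace (T s 0 ^ 2 * g (T s 0) (z false s 0))%C
        with (T s 0 * (T s 0 * g (T s 0) (z false s 0)))%C by (simpl; ring).
      exact hc. }
    repeat split.
    + apply near1; lra.
    + apply near2; lra.
    + exact c1.
    + unfold p. rewrite n3.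
      replace (l (T s 0) * fst (X (T s 0, Y (T s 0))))%C with
        (l (T s 0) * fst (X p) + 0 * fst (X p))%C by (unfold p; ring).
      (* The chain rule in two variables, for a function of the first one: its null partial
         derivative in the second accounts for the added zero term. *)
      apply (chain_rule (fun x _ => Y x) (fun s => T s (RtoC 0)) (fun s => T s (RtoC 0)) s); auto.
      * apply hol_ext with (fun x _ => Y (T s 0 + x)%C); [exists 1; split; [lra|easy]|].
        exists (rY / 2), NY.
        apply (an_comp rY NY (fun x _ => Y x) (rY/2) (fun x _ => T s 0 + x)%C (fun x _ => T s 0 + x)%C);
          auto; (apply an_weaken with (Cmod (T s 0) + rY / 2); [|lra];
          apply (an_plus _ _ _ (fun _ _ => T s (RtoC 0)) (fun x _ => x)); [apply an_const|apply an_x]; lra).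
      * apply cder_exact. intros. ring.
  - unfold T in s1, s2. rewrite (z2 true) in s1, s2. fold T in s1, s2.
    assert (yt : Cmod (Y t) < d3).
    { apply Rle_lt_trans with (LY * (2 * m)); [apply Yb; unfold m in *; lra|easy]. }
    destruct (hexp t (Y t) ltac:(unfold m in *; lra) yt) as [e1 e2].
    apply is_series_ser in e1. apply is_series_ser in e2.
    exists (T (RtoC 1) (RtoC 0)). split.
    + apply Tb; [rewrite Cmod_1|rewrite Cmod_0]; lra.
    + rewrite (surjective_pairing (f (t, Y t))). f_equal.
      * apply (ser_unique _ _ _ e1 s1).
      * apply (ser_unique _ _ _ e2 s2).
Qed.

End Exponential.

(** * The leading homogeneous part *)

Lemma expan_10 r N a h : expan r N a h -> cder (fun t => h t (RtoC 0)) (RtoC 0) (a 1%nat O).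
Proof.
  intros ha. assert (hr : 0 < r) by apply ha. assert (e := expan_00 _ _ _ _ (expan_dx _ _ _ _ ha)).
  simpl in e. unfold dx_coef in e. simpl INR in e. rewrite Cmult_1_l in e. rewrite <- e.
  apply (expan_cder r N); [easy|rewrite Cmod_0; lra..].
Qed.

Lemma expan_01 r N a h : expan r N a h -> cder (fun t => h (RtoC 0) t) (RtoC 0) (a O 1%nat).
Proof. intros ha. exact (expan_10 _ _ _ _ (expan_swap _ _ _ _ ha)). Qed.

Lemma vanish_order2 g r N a :
  vanishes_to_order 2 g -> expan r N a (fun x y => g (x, y)) -> vanish_below 2 a.
Proof.
  intros hv ha [|[|i]] [|[|j]] hij; try lia.
  - rewrite <- (expan_00 _ _ _ _ ha). apply (hv O O). lia.
  - rewrite <- (cder_C_derive _ _ _ (expan_01 _ _ _ _ ha)). apply (hv O 1%nat). lia.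
  - rewrite <- (cder_C_derive _ _ _ (expan_10 _ _ _ _ ha)). apply (hv 1%nat O). lia.
Qed.

Lemma least_nonzero (b : bool -> nat -> nat -> C) :
  (forall i p q, b i p q = 0%C) \/
  exists k, (forall i, vanish_below k (b i)) /\ exists i p q, (p + q = k)%nat /\ b i p q <> 0%C.
Proof.
  destruct (classic (exists k, exists i p q, (p + q = k)%nat /\ b i p q <> 0%C)) as [[k hk]|no].
  - right. induction k as [k IH] using lt_wf_ind.
    destruct (classic (exists l, (l < k)%nat /\ exists i p q, (p + q = l)%nat /\ b i p q <> 0%C))
      as [(l & hl & h)|no].
    + now apply (IH l).
    + exists k. split; [|easy]. intros i p q hpq. apply NNPP. intros hn. apply no.
      exists (p + q)%nat. split; [easy|]. now exists i, p, q.
  - left. intros i p q. apply NNPP. intros hn. apply no. now exists (p + q)%nat, i, p, q.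
Qed.

Lemma hom_vanish k a n x y : vanish_below k a -> (n < k)%nat -> hom a n x y = 0%C.
Proof. intros hv hn. apply csum_0. intros i hi. rewrite hv by lia. ring. Qed.

Lemma vanish_tail r N a h k m x y :
  expan r N a h -> vanish_below k a -> Cmod x <= m -> Cmod y <= m -> m <= r ->
  Cmod (h x y) <= N / r ^ k * m ^ k /\
  Cmod (h x y - hom a k x y) <= N / r ^ (k + 1) * m ^ (k + 1).
Proof.
  intros ha hv hx hy hm. assert (hr : 0 < r) by apply ha.
  assert (z : csum (fun n => hom a n x y) k = 0%C).
  { apply csum_0. intros n hn. now apply hom_vanish with k. }
  assert (h1 := expan_tail r N a h m x y k ha hx hy hm).
  assert (h2 := expan_tail r N a h m x y (S k) ha hx hy hm).
  cbn [csum] in h2. rewrite z in h1, h2. rewrite Cplus_0_l in h2.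
  replace (h x y - 0)%C with (h x y) in h1 by ring.
  replace (k + 1)%nat with (S k) by lia. unfold Rdiv in h1, h2.
  rewrite Rpow_mult_distr, pow_inv in h1, h2. split; unfold Rdiv; lra.
Qed.

(** At a zero of X all Lie derivatives vanish, so only the constant term of the exponential series
    is left. This gives f(0) = 0, and shows that X = 0 would make f the identity, so that X has a
    leading part. *)
Lemma exp_fixes_zeros X f : is_exp X f -> near (fun x y => X (x, y) = O2 -> f (x, y) = (x, y)).
Proof.
  intros hexp. apply locally_O2 in hexp. apply near_imp with (2 := hexp). intros x y [s1 s2] X0.
  apply is_series_ser in s1, s2.
  assert (fin : forall g l, ser (fun n => / RtoC (INR (fact n)) * Nat.iter n (lie X) g (x, y))%C l ->
    l = g (x, y)).
  { intros g l hl. apply (ser_unique _ _ _ hl).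
    replace (g (x, y)) with (csum (fun n => / RtoC (INR (fact n)) * Nat.iter n (lie X) g (x, y))%C 1).
    - apply ser_finite. intros [|n] hn; [lia|]. simpl. unfold lie. rewrite X0. simpl. ring.
    - simpl. field. }
  rewrite (surjective_pairing (f (x, y))). f_equal; [now rewrite (fin _ _ s1)|now rewrite (fin _ _ s2)].
Qed.

Lemma exp_leading (f : C * C -> C * C) :
  Phi_ge2 f -> ~ locally (O2 : C * C) (fun p => f p = p) ->
  exists X k b r N, is_exp X f /\ hol_at (fun q => fst (X q)) O2 /\ hol_at (fun q => snd (X q)) O2 /\
    f O2 = O2 /\ (2 <= k)%nat /\
    (forall i, expan r N (b i) (fun x y => comp i (X (x, y)))) /\
    (forall i, vanish_below k (b i)) /\ exists i p q, (p + q = k)%nat /\ b i p q <> 0%C.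
Proof.
  intros (X & h1 & h2 & v1 & v2 & hexp) hid. apply holomorphic2_hol in h1, h2.
  assert (g1 := h1). assert (g2 := h2). apply hol_at_O2 in g1, g2.
  destruct (hol_common _ _ g1 g2) as (r & N1 & N2 & (a1 & e1) & (a2 & e2)).
  set (b := fun i : bool => if i then a1 else a2). set (N := Rmax N1 N2).
  assert (hb : forall i, expan r N (b i) (fun x y => comp i (X (x, y)))).
  { intros [|]; [destruct e1 as (u1 & u2 & u3)|destruct e2 as (u1 & u2 & u3)];
      (split; [easy|]); (split; [|easy]); intros n; (eapply Rle_trans; [apply u2|]).
    - apply Rmax_l.
    - apply Rmax_r. }
  assert (hv2 : forall i, vanish_below 2 (b i)).
  { intros [|]; [apply (vanish_order2 _ _ _ _ v1 e1)|apply (vanish_order2 _ _ _ _ v2 e2)]. }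
  assert (fz := exp_fixes_zeros X f hexp).
  assert (f0 : f O2 = O2).
  { destruct fz as (d & hd & fz). apply (fz (RtoC 0) (RtoC 0)); try now rewrite Cmod_0.
    rewrite (surjective_pairing (X _)). unfold O2. f_equal.
    - exact (eq_trans (expan_00 _ _ _ _ (hb true)) (hv2 true O O ltac:(simpl; lia))).
    - exact (eq_trans (expan_00 _ _ _ _ (hb false)) (hv2 false O O ltac:(simpl; lia))). }
  destruct (least_nonzero b) as [zero|(k & hk & nz)].
  - exfalso. apply hid. apply locally_O2.
    apply near_imp with (2 := near_and _ _ fz (near_lt r ltac:(apply (hb true)))).
    intros x y [e [hx hy]]. apply e.
    assert (Xz : forall i, comp i (X (x, y)) = 0%C).
    { intros i. apply (ser_unique (fun n => hom (b i) n x y)); [apply hb; lra|].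
      apply ser_ext with (fun _ => RtoC 0); [|apply ser_0]. intros n. symmetry.
      apply csum_0. intros j _. rewrite zero. ring. }
    rewrite (surjective_pairing (X _)). unfold O2. f_equal; [apply (Xz true)|apply (Xz false)].
  - assert (k2 : (2 <= k)%nat); [|now exists X, k, b, r, N].
    destruct (le_lt_dec 2 k) as [h|h]; [easy|]. exfalso. destruct nz as (i & p & q & e & nz).
    apply nz. apply (hv2 i). lia.
Qed.

(** Setting x = 1 dehomogenises: [c m] is the coefficient of v^m. *)
Lemma hom_vanish_poly (a : nat -> nat -> C) k : (forall v, hom a k (RtoC 1) v = 0%C) ->
  forall i j, (i + j = k)%nat -> a i j = 0%C.
Proof.
  intros h i j hij.
  set (c := fun m => if le_lt_dec m k then a (k - m)%nat m else RtoC 0).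
  assert (z : forall m, c m = 0%C).
  { apply (pser_unique c 1 (rsum (fun k => Cmod (c k) * 1 ^ k) (S k)) 1); try lra.
    - intros m. apply rsum_finite.
      + intros q. apply Rmult_le_pos; [apply Cmod_ge_0|apply pow_le; lra].
      + intros q hq. unfold c. destruct (le_lt_dec q k); [lia|]. rewrite Cmod_0. ring.
    - intros t _. rewrite <- (h t). unfold hom. rewrite csum_rev.
      rewrite (csum_ext _ (fun m => c m * t ^ m)%C).
      + apply ser_finite. intros m hm. unfold c. destruct (le_lt_dec m k); [lia|]. ring.
      + intros m hm. unfold c. destruct (le_lt_dec m k); [|lia].
        replace (k - (k - m))%nat with m by lia. rewrite Cpow_1_l. ring. }
  specialize (z j). unfold c in z. destruct (le_lt_dec j k); [|lia].
  now replace (k - j)%nat with i in z by lia.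
Qed.

(** The lowest non-zero coefficient of the polynomial in v dominates the others near 0. A punctured
    disc without zeros is enough to choose infinitely many directions. *)
Lemma hom_nonvanishing (a : nat -> nat -> C) k : (exists i j, (i + j = k)%nat /\ a i j <> 0%C) ->
  exists d, 0 < d /\ forall v, 0 < Cmod v < d -> hom a k (RtoC 1) v <> 0%C.
Proof.
  intros (i0 & j0 & e0 & nz0).
  set (c := fun m => if le_lt_dec m k then a (k - m)%nat m else RtoC 0).
  assert (hc : exists m, c m <> 0%C /\ forall q, (q < m)%nat -> c q = 0%C).
  { assert (h : exists m, c m <> 0%C).
    { exists j0. unfold c. destruct (le_lt_dec j0 k); [|lia].
      now replace (k - j0)%nat with i0 by lia. }
    destruct h as [m h]. induction m as [m IH] using lt_wf_ind.
    destruct (classic (exists l, (l < m)%nat /\ c l <> 0%C)) as [(l & hl & h')|no]; [now apply (IH l)|].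
    exists m. split; [easy|]. intros q hq. apply NNPP. intros hn. apply no. now exists q. }
  destruct hc as (m & cm & cz).
  set (B := rsum (fun k => Cmod (c k) * 1 ^ k) (S k)).
  assert (hB : forall n, rsum (fun k => Cmod (c k) * 1 ^ k) n <= B).
  { intros n. apply rsum_finite.
    - intros q. apply Rmult_le_pos; [apply Cmod_ge_0|apply pow_le; lra].
    - intros q hq. unfold c. destruct (le_lt_dec q k); [lia|]. rewrite Cmod_0. ring. }
  assert (B0 : 0 <= B) by apply (hB O).
  assert (cp : 0 < Cmod (c m)) by now apply Cmod_gt_0.
  exists (Rmin 1 (Cmod (c m) / (B + 1))). split.
  { apply Rmin_glb_lt; [lra|]. apply Rdiv_lt_0_compat; lra. }
  intros v [v0 v1] hv. generalize (Rmin_l 1 (Cmod (c m) / (B + 1))) (Rmin_r 1 (Cmod (c m) / (B + 1))).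
  intros.
  assert (hs : ser (fun m => c m * v ^ m)%C 0%C).
  { rewrite <- hv. unfold hom. rewrite csum_rev.
    rewrite (csum_ext _ (fun m => c m * v ^ m)%C).
    + apply ser_finite. intros q hq. unfold c. destruct (le_lt_dec q k); [lia|]. ring.
    + intros q hq. unfold c. destruct (le_lt_dec q k); [|lia].
      replace (k - (k - q))%nat with q by lia. rewrite Cpow_1_l. ring. }
  assert (T := pser_tail c 1 B v 0 (S m) ltac:(lra) hB ltac:(lra) hs).
  cbn [csum] in T. rewrite csum_0 in T by (intros q hq; rewrite cz by easy; ring).
  replace (0 - (0 + c m * v ^ m))%C with (- (c m * v ^ m))%C in T by ring.
  rewrite Cmod_opp, Cmod_mult, Cmod_pow in T. unfold Rdiv in T. rewrite Rinv_1, Rmult_1_r in T.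
  simpl in T. assert (p : 0 < Cmod v ^ m) by now apply pow_lt.
  assert (Cmod (c m) <= B * Cmod v) by nra.
  assert (B * Cmod v < Cmod (c m)); [|lra].
  apply Rle_lt_trans with ((B + 1) * Cmod v); [nra|].
  apply Rlt_le_trans with ((B + 1) * (Cmod (c m) / (B + 1))); [apply Rmult_lt_compat_l; lra|].
  apply Req_le. field. lra.
Qed.

Lemma near_intro d (P : C -> C -> Prop) :
  0 < d -> (forall x y, Cmod x < d -> Cmod y < d -> P x y) -> near P.
Proof. intros hd h. now exists d. Qed.

(** Identifies the value at the origin of a quotient by x^k, which is controlled for x non-zero
    only. *)
Lemma hol_lim_axis A c K : hol A ->
  near (fun x y => x <> 0%C -> Cmod (A x (RtoC 0) - c) <= K * Cmod x) ->
  A (RtoC 0) (RtoC 0) = c.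
Proof.
  intros hA (d & hd & h). destruct (hol_lip A hA) as (L & d' & hd' & hL & lip).
  apply Cminus_eq0, Cmod_small_eq0. intros eps he.
  destruct (small_real (K + L) (Rmin d d') eps) as (s & s0 & s1 & _ & s2);
    [now apply Rmin_glb_lt|easy|].
  rmin_bounds.
  assert (cs := Cmod_real s ltac:(lra)).
  assert (h1 : Cmod (A s 0 - c) <= K * s).
  { rewrite <- cs at 2. apply (h s (RtoC 0)); [lra|rewrite Cmod_0; lra|].
    intros e. apply RtoC_inj in e. lra. }
  assert (h2 : Cmod (A 0 0 - A s 0) <= L * s).
  { apply lip; rewrite ?(Cmod_minus_sym 0), ?Cmod_minus_0, ?Cmod_0; lra. }
  replace (A 0 0 - c)%C with ((A 0 0 - A s 0) + (A s 0 - c))%C by ring.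
  eapply Rle_trans; [apply Cmod_triangle|]. lra.
Qed.

(** The non-autonomous equation is read as an autonomous planar system whose first component has
    derivative 1, hence equals x. *)
Lemma scalar_ode F : hol F ->
  exists u, hol (fun x _ => u x) /\ u (RtoC 0) = 0%C /\
    near (fun x _ => cder u x (F x (u x))).
Proof.
  intros (r0 & N0 & b0 & hF). assert (hr0 : 0 < r0) by apply hF.
  assert (hN0 := expan_N_ge0 _ _ _ _ hF). assert (hL := expan_lip_bound _ _ _ _ hF).
  assert (hF' := expan_shrink _ (r0/2) _ _ _ hF ltac:(lra)).
  set (b := fun i : bool => if i then cst_coef (RtoC 1) else b0).
  set (G := fun (i : bool) (x y : C) => if i then RtoC 1 else F x y).
  set (M := N0 + 1). set (L := N0 + 1). set (rho := r0 / 2) in *.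
  assert (hrho : 0 < rho) by (unfold rho; lra).
  (* With this r, 2 r M = rho / 2 and r L / rho = 1 / 4, which meets both conditions of [picard]. *)
  set (r := rho / (4 * M)). assert (hr : 0 < r) by (apply Rdiv_lt_0_compat; unfold M; lra).
  assert (c1 := expan_cst rho (RtoC 1) hrho). rewrite Cmod_1 in c1.
  destruct (picard rho M L b G (fun _ => RtoC 0) r) as (z & z1 & z2 & z3 & z4 & _); auto.
  - intros [|].
    + destruct c1 as (h1 & h2 & h3). split; [easy|]. split; [|easy].
      intros n. apply Rle_trans with (1 := h2 n). unfold M. lra.
    + destruct hF' as (h1 & h2 & h3). split; [easy|]. split; [|easy].
      intros n. apply Rle_trans with (1 := h2 n). unfold M. lra.
  - intros [|] n; simpl.
    + rewrite (rsum_ext _ (fun _ => 0 * 0)), rsum_scal; [unfold L; lra|].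
      intros [|k] _; [simpl; ring|]. unfold hn. rewrite (rsum_ext _ (fun _ => 0 * 0)), rsum_scal; [ring|].
      intros [|i] hi; simpl; rewrite Cmod_0; ring.
    + apply Rle_trans with (1 := hL n). unfold L. lra.
  - intros i. rewrite Cmod_0. unfold r.
    replace (0 + 2 * (rho / (4 * M) * M)) with (rho / 2) by (field; unfold M; lra). lra.
  - unfold r. replace (rho / (4 * M) * (L / rho)) with (/ 4); [lra|].
    unfold L, M. field. lra.
  - assert (zx : forall x y, Cmod x <= r -> Cmod y <= r -> z true x y = x).
    { intros x y hx hy. rewrite z3 by easy. unfold G. rewrite (prim_const r) by easy. ring. }
    exists (fun x => z false x (RtoC 0)). split; [|split].
    + exists (Rmin r rho), rho. assert (hm : 0 < Rmin r rho) by now apply Rmin_glb_lt.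
      rmin_bounds.
      apply (an_comp r rho (z false) (Rmin r rho) (fun x _ => x) (fun _ _ => RtoC 0)); [apply z1| |].
      * apply an_weaken with (Rmin r rho); [now apply an_x|easy].
      * apply an_weaken with 0; [now apply an_0|lra].
    + apply z2. rewrite Cmod_0. lra.
    + destruct (z4 false) as (d & hd & hc). exists (Rmin d r). split; [now apply Rmin_glb_lt|].
      intros x _ hx _. rmin_bounds.
      specialize (hc x (RtoC 0) ltac:(lra) ltac:(rewrite Cmod_0; lra)). unfold G in hc.
      rewrite zx in hc; [easy|lra|rewrite Cmod_0; lra].
Qed.

Lemma cder_mul_x v u x u' : cder u x u' -> cder (fun t => t * (v + u t))%C x (v + u x + x * u')%C.
Proof.
  intros hu.
  replace (v + u x + x * u')%C with ((v + u x) * 1 + x * u')%C by ring.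
  apply (chain_rule (fun s w => s * (v + w))%C (fun t => t) u x); [| |easy| |].
  - apply (hol_mult (fun s _ => x + s)%C (fun _ w => v + (u x + w))%C).
    + apply (hol_plus (fun _ _ => x) (fun s _ => s)); [apply hol_const|apply hol_x].
    + apply (hol_plus (fun _ _ => v) (fun _ w => u x + w)%C); [apply hol_const|].
      apply (hol_plus (fun _ _ => u x) (fun _ w => w)); [apply hol_const|apply hol_y].
  - apply cder_exact. intros. ring.
  - apply cder_exact. intros. ring.
  - apply cder_exact. intros. ring.
Qed.

Lemma near_snd0 (P : C -> C -> Prop) (u : C -> C) :
  hol (fun x _ => u x) -> u (RtoC 0) = 0%C -> near P -> near (fun x _ => P x (u x)).
Proof.
  intros hu u0 hP.
  apply near_imp with (2 := near_comp P (fun x _ => x) (fun x _ => u x) hP hol_x hu eq_refl u0). easy.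
Qed.

Lemma near_at0 (P : C -> Prop) : near (fun x _ => P x) -> exists d, 0 < d /\ forall x, Cmod x < d -> P x.
Proof.
  intros (d & hd & h). exists d. split; [easy|]. intros x hx.
  apply (h x (RtoC 0)); [easy|now rewrite Cmod_0].
Qed.

Section Leaf.

Variables (X f : C * C -> C * C) (k : nat) (b : bool -> nat -> nat -> C) (r N : R).
Hypotheses (exp_f : is_exp X f)
  (hX1 : hol_at (fun q => fst (X q)) O2) (hX2 : hol_at (fun q => snd (X q)) O2)
  (f0 : f O2 = O2) (hk : (2 <= k)%nat)
  (hb : forall i, expan r N (b i) (fun x y => comp i (X (x, y))))
  (hv : forall i, vanish_below k (b i)).

Let lead (i : bool) (v : C) : C := hom (b i) k (RtoC 1) v.

(** By homogeneity the part of degree k of X at (x, x w) is x^k times its value at (1, w); the rest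
    is O(x^(k+1)) for w bounded. *)
Lemma field_chart v0 i : exists K, 0 <= K /\ near (fun x y =>
  Cmod (comp i (X (x, x * (v0 + y))%C)) <= K * Cmod x ^ k /\
  Cmod (comp i (X (x, x * (v0 + y))%C) - x ^ k * lead i (v0 + y)%C) <= K * Cmod x ^ (k + 1)).
Proof.
  assert (hr : 0 < r) by apply (hb true). assert (hN := expan_N_ge0 _ _ _ _ (hb true)).
  assert (c0 := Cmod_ge_0 v0).
  set (K1 := N / r ^ k * (Cmod v0 + 1) ^ k).
  set (K2 := N / r ^ (k + 1) * (Cmod v0 + 1) ^ (k + 1)).
  assert (p1 : 0 <= N / r ^ k) by (apply Rdiv_le_0_compat; [easy|now apply pow_lt]).
  assert (p2 : 0 <= N / r ^ (k + 1)) by (apply Rdiv_le_0_compat; [easy|now apply pow_lt]).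
  assert (hK1 : 0 <= K1) by (apply Rmult_le_pos; [easy|apply pow_le; lra]).
  assert (hK2 : 0 <= K2) by (apply Rmult_le_pos; [easy|apply pow_le; lra]).
  exists (K1 + K2). split; [lra|].
  apply near_intro with (Rmin 1 (r / (Cmod v0 + 1))).
  { apply Rmin_glb_lt; [lra|]. apply Rdiv_lt_0_compat; lra. }
  intros x y hx hy. generalize (Rmin_l 1 (r / (Cmod v0 + 1))) (Rmin_r 1 (r / (Cmod v0 + 1))). intros.
  assert (x0 := Cmod_ge_0 x).
  set (m := (Cmod v0 + 1) * Cmod x).
  assert (m1 : Cmod x <= m) by (unfold m; nra).
  assert (m2 : Cmod (x * (v0 + y)) <= m).
  { unfold m. rewrite Cmod_mult, Rmult_comm. apply Rmult_le_compat_r; [easy|].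
    eapply Rle_trans; [apply Cmod_triangle|]. lra. }
  assert (m3 : m <= r).
  { apply Rle_trans with ((Cmod v0 + 1) * (r / (Cmod v0 + 1))).
    - apply Rmult_le_compat_l; lra.
    - apply Req_le. field. lra. }
  destruct (vanish_tail r N (b i) _ k m x (x * (v0 + y))%C (hb i) (hv i) m1 m2 m3) as [e1 e2].
  replace (hom (b i) k x (x * (v0 + y))%C) with (x ^ k * lead i (v0 + y))%C in e2.
  2:{ unfold lead. rewrite Cmult_comm, <- hom_scale. now rewrite Cmult_1_r. }
  unfold m in e1, e2. rewrite Rpow_mult_distr, <- Rmult_assoc in e1, e2.
  fold K1 in e1. fold K2 in e2.
  assert (0 <= Cmod x ^ k) by now apply pow_le.
  assert (0 <= Cmod x ^ (k + 1)) by now apply pow_le.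
  split; [apply Rle_trans with (1 := e1)|apply Rle_trans with (1 := e2)]; nra.
Qed.

(* In the chart [(x, x (v0 + y))] the field is [x ^ k] times a field that is
   transverse to [x = 0]; its leaf through the origin is the graph of the
   solution of [u' = R / A]. *)
Lemma leaf v0 :
  (forall v, lead false v = (v * lead true v)%C) -> lead true v0 <> 0%C ->
  exists u d K, hol (fun x _ => u x) /\ u (RtoC 0) = 0%C /\ 0 < d /\
    forall t, Cmod t < d -> exists e,
      f (t, t * (v0 + u t))%C = (e, e * (v0 + u e))%C /\
      Cmod (e - (t + lead true v0 * t ^ k)) <= K * Cmod t ^ (k + 1).
Proof.
  intros hdic hc.
  set (H := fun i x y => comp i (X (x, x * (v0 + y))%C)).
  assert (hH : forall i, hol (H i)).
  { intros i. apply (hol_comp (fun x y => comp i (X (x, y))) (fun x _ => x) (fun x y => x * (v0 + y))%C).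
    - exists r, N, (b i). apply hb.
    - apply hol_x.
    - apply (hol_mult (fun x _ => x) (fun _ y => v0 + y)%C); [apply hol_x|].
      apply (hol_plus (fun _ _ => v0) (fun _ y => y)); [apply hol_const|apply hol_y].
    - easy.
    - ring. }
  destruct (field_chart v0 true) as (K1 & hK1 & e1). destruct (field_chart v0 false) as (K2 & hK2 & e2).
  fold (H true) in e1. fold (H false) in e2.
  (* The components of X, written in the chart, are x^k A and x^k B. *)
  destruct (hol_divx (H true) K1 k (hH true)) as (A & hA & eA).
  { apply near_imp with (2 := e1). now intros x y [h _] _. }
  destruct (hol_divx (H false) K2 k (hH false)) as (B & hB & eB).
  { apply near_imp with (2 := e2). now intros x y [h _] _. }
  assert (pk : forall x : C, x <> 0%C -> 0 < Cmod x ^ k) by (intros; now apply pow_lt, Cmod_gt_0).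
  assert (cA : near (fun x y => x <> 0%C -> Cmod (A x y - lead true (v0 + y)%C) <= K1 * Cmod x)).
  { apply near_imp with (2 := near_and _ _ e1 eA). intros x y [[_ h] e] x0.
    unfold H in e. rewrite e in h. apply Rmult_le_reg_l with (Cmod x ^ k); [now apply pk|].
    rewrite <- Cmod_pow, <- Cmod_mult, Cmod_pow.
    replace (x ^ k * (A x y - lead true (v0 + y)))%C with (x ^ k * A x y - x ^ k * lead true (v0 + y))%C by ring.
    apply Rle_trans with (1 := h). rewrite pow_add. apply Req_le. simpl. ring. }
  assert (cB : near (fun x y => x <> 0%C -> Cmod (B x y - lead false (v0 + y)%C) <= K2 * Cmod x)).
  { apply near_imp with (2 := near_and _ _ e2 eB). intros x y [[_ h] e] x0.
    unfold H in e. rewrite e in h. apply Rmult_le_reg_l with (Cmod x ^ k); [now apply pk|].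
    rewrite <- Cmod_pow, <- Cmod_mult, Cmod_pow.
    replace (x ^ k * (B x y - lead false (v0 + y)))%C with (x ^ k * B x y - x ^ k * lead false (v0 + y))%C by ring.
    apply Rle_trans with (1 := h). rewrite pow_add. apply Req_le. simpl. ring. }
  assert (A0 : A (RtoC 0) (RtoC 0) = lead true v0).
  { apply (hol_lim_axis A _ K1 hA). destruct cA as (d & hd & h). exists d. split; [easy|].
    intros x y hx hy x0. specialize (h x (RtoC 0) hx). rewrite Cmod_0, Cplus_0_r in h. auto. }
  (* From x' = x^k A and (x (v0 + y))' = x^k B follows x y' = x^k (B - (v0 + y) A). The Euler
     condition makes the bracket vanish on x = 0, hence equal to x [Rr], so y' = x^k [Rr] and the
     factor x^k cancels in dy/dx = [Rr] / A. *)
  destruct (hol_divx (fun x y => B x y - (v0 + y) * A x y)%C (K2 + (Cmod v0 + 1) * K1) 1) as (Rr & hR & eR).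
  { apply hol_minus; [easy|]. apply hol_mult; [|easy].
    apply (hol_plus (fun _ _ => v0) (fun _ y => y)); [apply hol_const|apply hol_y]. }
  { apply near_imp with (2 := near_and _ _ (near_and _ _ cA cB) (near_lt 1 Rlt_0_1)).
    intros x y [[ha hb'] [hx hy]] x0. specialize (ha x0). specialize (hb' x0).
    rewrite hdic in hb'.
    replace (B x y - (v0 + y) * A x y)%C with ((B x y - (v0 + y) * lead true (v0 + y))
      - (v0 + y) * (A x y - lead true (v0 + y)))%C by ring.
    eapply Rle_trans; [apply Cmod_triangle_minus|]. rewrite Cmod_mult.
    assert (Cmod (v0 + y) <= Cmod v0 + 1) by (eapply Rle_trans; [apply Cmod_triangle|lra]).
    assert (Cmod (v0 + y) * Cmod (A x y - lead true (v0 + y)) <= (Cmod v0 + 1) * (K1 * Cmod x)).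
    { apply Rmult_le_compat; auto; apply Cmod_ge_0. }
    simpl. lra. }
  assert (hA0 : A (RtoC 0) (RtoC 0) <> 0%C) by now rewrite A0.
  destruct (scalar_ode (fun x y => Rr x y / A x y)%C) as (u & hu & u0 & ode).
  { now apply hol_div. }
  set (Y := fun x => (x * (v0 + u x))%C).
  assert (Anz := hol_nonzero_near A hA hA0).
  assert (all := near_snd0 _ u hu u0 (near_and _ _ (near_and _ _ eA eB) (near_and _ _ eR Anz))).
  assert (allb := near_snd0 _ u hu u0 e1).
  assert (hY : hol (fun x _ => Y x)).
  { apply (hol_mult (fun x _ => x) (fun x _ => v0 + u x)%C); [apply hol_x|].
    apply (hol_plus (fun _ _ => v0) (fun x _ => u x)); [apply hol_const|easy]. }
  assert (Y0 : Y (RtoC 0) = 0%C) by (unfold Y; ring).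
  destruct (exp_leaf X f exp_f hX1 hX2 Y (fun x => v0 + u x + x * (Rr x (u x) / A x (u x)))%C K1 hY Y0 f0)
    as (d & hd & inv).
  { apply near_imp with (2 := near_and _ _ allb (near_lt 1 Rlt_0_1)).
    intros x y [[h _] [hx _]]. unfold H, comp in h. fold (Y x) in h. apply Rle_trans with (1 := h).
    apply Rmult_le_compat_l; [easy|]. assert (x0 := Cmod_ge_0 x).
    apply pow_le_low; [lra|easy]. }
  { apply near_imp with (2 := near_and _ _ all ode).
    intros x _ [[[h1 h2] [h3 h4]] h5]. split; [now apply cder_mul_x|].
    unfold H, comp in h1, h2. fold (Y x) in h1, h2. rewrite h1, h2.
    replace (B x (u x)) with ((v0 + u x) * A x (u x) + x ^ 1 * Rr x (u x))%C by (rewrite <- h3; ring).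
    field. easy. }
  destruct (exp_estimate X f exp_f hX1 hX2 r N b k hk hb hv) as (K3 & m0 & hm0 & est).
  destruct (near_at0 (fun x => H true x (u x) = (x ^ k * A x (u x))%C /\ Cmod (u x) < 1)) as (d1 & hd1 & near1).
  { apply near_imp with (2 := near_and _ _ all (near_snd0 _ u hu u0 (near_lt 1 Rlt_0_1))).
    intros x y [[[h _] _] [_ h']]. now split. }
  (* [exp_estimate] involves A at the current point of the leaf; replacing it by its value at the
     origin costs an error of the same order t^(k+1). *)
  destruct (hol_lip1 (fun x => A x (u x))) as (LA & dA & hdA & hLA & lipA).
  { apply (hol_comp A (fun x _ => x) (fun x _ => u x)); auto. apply hol_x. }
  assert (c0 := Cmod_ge_0 v0). set (c := Cmod v0 + 1).
  exists u, (Rmin (Rmin d (m0 / c)) (Rmin d1 dA)), (Rabs K3 * c ^ (k + 1) + LA).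
  split; [easy|]. split; [easy|]. split.
  { repeat apply Rmin_glb_lt; try easy. apply Rdiv_lt_0_compat; unfold c; lra. }
  intros t ht. rmin_bounds.
  destruct (inv t ltac:(lra)) as (e & _ & he). exists e. split; [exact he|].
  destruct (Ceq_dec t (RtoC 0)) as [->|t0].
  { unfold Y in he. rewrite Cmult_0_l in he. change (RtoC 0, RtoC 0) with O2 in he. rewrite f0 in he.
    assert (e = 0%C) as -> by (symmetry; exact (f_equal fst he)).
    rewrite Cmod_0. replace k with (S (k - 1)) by lia. simpl.
    replace (0 - (0 + lead true v0 * (0 * 0 ^ (k - 1))))%C with (RtoC 0) by ring.
    rewrite Cmod_0. lra. }
  assert (tp : 0 < Cmod t) by now apply Cmod_gt_0.
  destruct (near1 t ltac:(lra)) as [n1 n2].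
  assert (cm : c * Cmod t <= m0).
  { apply mul_le_of_le_div; unfold c in *; lra. }
  assert (es := est true t (Y t) (c * Cmod t) ltac:(unfold c; nra) cm ltac:(unfold c; nra)).
  simpl in es. rewrite he in es. simpl in es.
  unfold H, comp in n1. fold (Y t) in n1. rewrite n1 in es.
  assert (es' : Cmod (e - (t + t ^ k * A t (u t))) <= K3 * (c * Cmod t) ^ (k + 1)).
  { apply es. unfold Y, c. rewrite Cmod_mult, Rmult_comm. apply Rmult_le_compat_r; [lra|].
    eapply Rle_trans; [apply Cmod_triangle|]. lra. }
  assert (la : Cmod (A t (u t) - A (RtoC 0) (u (RtoC 0))) <= LA * Cmod t).
  { rewrite <- (Cmod_minus_0 t). apply lipA; rewrite ?Cmod_0; lra. }
  rewrite u0, A0 in la.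
  replace (e - (t + lead true v0 * t ^ k))%C with
    ((e - (t + t ^ k * A t (u t))) + t ^ k * (A t (u t) - lead true v0))%C by ring.
  eapply Rle_trans; [apply Cmod_triangle|]. rewrite Rmult_plus_distr_r.
  apply Rplus_le_compat.
  - apply Rle_trans with (1 := es'). rewrite Rpow_mult_distr, <- Rmult_assoc.
    apply Rmult_le_compat_r; [apply pow_le; lra|]. apply Rmult_le_compat_r; [|apply Rle_abs].
    apply pow_le. unfold c. lra.
  - rewrite Cmod_mult, Cmod_pow. rewrite pow_add. simpl (Cmod t ^ 1).
    assert (0 <= Cmod t ^ k) by (apply pow_le; lra). nra.
Qed.

End Leaf.

(** * Attracting petals in one variable *)

Lemma de_moivre t n : ((cos t, sin t) ^ n)%C = (cos (INR n * t), sin (INR n * t)).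
Proof.
  induction n as [|n IH].
  - simpl. now rewrite Rmult_0_l, cos_0, sin_0.
  - rewrite Cpow_S, IH, S_INR. unfold Cmult. simpl.
    replace ((INR n + 1) * t) with (t + INR n * t) by ring. now rewrite cos_plus, sin_plus, (Rplus_comm (sin t * _)).
Qed.

Lemma unit_angle a b : a ^ 2 + b ^ 2 = 1 -> exists t, a = cos t /\ b = sin t.
Proof.
  intros h. assert (ha : -1 <= a <= 1) by nra.
  assert (hs : sin (acos a) = sqrt (1 - a²)) by now apply sin_acos.
  assert (e : 1 - a² = b²) by (unfold Rsqr; lra).
  rewrite e in hs. destruct (Rle_dec 0 b) as [hb|hb].
  - exists (acos a). rewrite cos_acos, hs, sqrt_Rsqr; auto.
  - exists (- acos a). rewrite cos_neg, sin_neg, cos_acos, hs by easy. split; [easy|].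
    rewrite Rsqr_neg, sqrt_Rsqr; lra.
Qed.

Lemma unit_root (c : C) p : (1 <= p)%nat -> c <> 0%C ->
  exists w : C, Cmod w = 1 /\ (c * w ^ p)%C = RtoC (- Cmod c).
Proof.
  intros hp hc. assert (cp : 0 < Cmod c) by now apply Cmod_gt_0.
  set (z := (- RtoC (Cmod c) / c)%C).
  assert (hz : Cmod z = 1).
  { unfold z. rewrite Cmod_div, Cmod_opp, Cmod_real; [field|..]; auto; lra. }
  destruct (unit_angle (fst z) (snd z)) as (t & e1 & e2).
  { unfold Cmod in hz. assert (h := f_equal (fun x => x ^ 2) hz). cbv beta in h.
    rewrite pow2_sqrt in h; [lra|]. nra. }
  exists (cos (t / INR p), sin (t / INR p)). split.
  - unfold Cmod. cbn [fst snd]. replace (cos (t / INR p) ^ 2 + sin (t / INR p) ^ 2) with 1.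
    + apply sqrt_1.
    + generalize (sin2_cos2 (t / INR p)). unfold Rsqr. lra.
  - rewrite de_moivre. replace (INR p * (t / INR p)) with t.
    + rewrite <- e1, <- e2, <- surjective_pairing. unfold z. rewrite RtoC_opp. field. easy.
    + field. apply not_0_INR. lia.
Qed.

Lemma pow_1_plus_i n : exists K, 0 <= K /\ forall s, -1 <= s <= 1 ->
  Rabs (fst ((1, s) ^ n)%C - 1) <= K * s ^ 2 /\ Rabs (snd ((1, s) ^ n)%C - INR n * s) <= K * s ^ 2.
Proof.
  induction n as [|n (K & hK & IH)].
  - exists 0. split; [lra|]. intros s _. simpl.
    replace (1 - 1) with 0 by ring. replace (0 - 0 * s) with 0 by ring. rewrite Rabs_R0. lra.
  - exists (2 * K + INR n). assert (hn := pos_INR n). split; [lra|]. intros s hs.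
    destruct (IH s hs) as [h1 h2]. rewrite Cpow_S, S_INR. simpl.
    set (a := fst _) in *. set (b := snd _) in *.
    apply Rabs_le_between in h1. apply Rabs_le_between in h2.
    assert (0 <= s ^ 2) by (simpl; nra). assert (0 <= K * s ^ 2) by nra.
    assert (q : forall w, - (K * s ^ 2) <= w <= K * s ^ 2 -> - (K * s ^ 2) <= s * w <= K * s ^ 2).
    { intros w hw. nra. }
    assert (q1 := q _ h1). assert (q2 := q _ h2).
    split; apply Rabs_le; simpl in *; nra.
Qed.

(** One edge of the cone, for the point x (1 + i s): k' stands for x^(k-1), R and I for the parts of
    (1 + i s)^k. If s >= 3 mu / 4, then mu R - I <= - mu / 4 and the inward push of order g x^k
    exceeds the errors. Otherwise the room x mu / 4 left before the edge exceeds the whole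
    displacement. *)
Lemma cone_step mu g x s R I e1 e2 K k k' :
  0 < mu <= 1 -> 0 < g -> 0 < x -> 0 <= K -> (2 <= k)%nat -> 0 < k' <= x ->
  - mu < s < mu -> 7 / 8 <= R <= 9 / 8 -> INR k * s - mu / 8 <= I ->
  Rabs e1 <= K * x * (x * k') -> Rabs e2 <= K * x * (x * k') ->
  8 * K * x <= g * mu / 2 -> g * (INR k + 2) * x <= / 16 -> 2 * K * x <= mu / 32 -> x <= 1 ->
  0 < mu * (x - g * (x * k') * R + e1) - (x * s - g * (x * k') * I + e2).
Proof.
  intros hmu hg hx hK hk hk' hs hR hI h1 h2 c1 c2 c3 x1.
  apply Rabs_le_between in h1. apply Rabs_le_between in h2.
  assert (k2 : 2 <= INR k) by (change 2 with (INR 2); now apply le_INR).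
  set (w := x * k') in *. assert (hw : 0 < w <= x * x) by (unfold w; nra).
  assert (E : 0 <= K * x * w) by (apply Rmult_le_pos; nra).
  assert (b1 : - (K * x * w) <= mu * e1) by nra.
  assert (gw : 0 < g * w) by nra.
  destruct (Rle_lt_dec (3 / 4 * mu) s) as [h|h].
  - assert (d1 : mu * R - I <= - (mu / 4)) by nra.
    assert (d2 : g * w * (mu * R - I) <= - (g * w * mu / 4)) by nra.
    assert (d3 : 2 * (K * x * w) <= g * w * mu / 8) by nra.
    assert (0 < g * w * mu) by nra. nra.
  - assert (d1 : mu * R - I <= (INR k + 2) * mu) by nra.
    assert (d2 : g * w * (mu * R - I) <= g * w * ((INR k + 2) * mu)) by nra.
    assert (d3 : g * w * ((INR k + 2) * mu) <= x * mu / 16).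
    { apply Rle_trans with (g * (x * x) * ((INR k + 2) * mu)).
      - apply Rmult_le_compat_r; [nra|]. nra.
      - replace (g * (x * x) * ((INR k + 2) * mu)) with ((g * (INR k + 2) * x) * (x * mu)) by ring.
        assert (0 < x * mu) by nra. nra. }
    assert (d4 : 2 * (K * x * w) <= x * mu / 32).
    { apply Rle_trans with ((2 * K * x) * x); [|nra].
      replace (2 * (K * x * w)) with (2 * K * x * w) by ring. apply Rmult_le_compat_l; nra. }
    assert (x * (mu - s) >= x * (mu / 4)) by nra. assert (0 < x * mu) by nra. nra.
Qed.

(** While u stays above eps, each step lowers it by at least the fixed amount c eps^k, which cannot
    last. *)
Lemma power_decay (u : nat -> R) c k :
  0 < c -> (forall n, 0 < u n) -> (forall n, u (S n) <= u n - c * u n ^ k) ->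
  forall eps, 0 < eps -> exists N, forall n, (N <= n)%nat -> u n < eps.
Proof.
  intros hc hu hs eps he.
  assert (dec : forall n m, (n <= m)%nat -> u m <= u n).
  { induction 1 as [|m h IH]; [lra|]. specialize (hs m).
    assert (0 < u m ^ k) by now apply pow_lt. nra. }
  destruct (classic (exists N, u N < eps)) as [[N hN]|no].
  - exists N. intros n hn. specialize (dec N n hn). lra.
  - exfalso. assert (big : forall n, eps <= u n).
    { intros n. apply Rnot_lt_le. intros h. apply no. now exists n. }
    assert (p : 0 < c * eps ^ k) by (apply Rmult_lt_0_compat; [easy|now apply pow_lt]).
    assert (lin : forall n, u n <= u O - INR n * (c * eps ^ k)).
    { induction n as [|n IH]; [simpl; lra|]. rewrite S_INR. specialize (hs n).
      assert (eps ^ k <= u n ^ k) by (apply pow_incr; specialize (big n); lra). nra. }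
    set (q := c * eps ^ k) in *.
    destruct (INR_unbounded (u O / q)) as [n hn].
    specialize (lin n). specialize (hu n).
    assert (u O / q * q < INR n * q)
      by (apply Rmult_lt_compat_r; lra).
    replace (u O / q * q) with (u O) in H by (field; lra). lra.
Qed.

(* The cone is narrow so that, close to its edges, the imaginary part of
   [g s ^ k] pulls [s] inwards at a rate that dominates the error term. *)
Lemma step_in_cone (g K : R) (k : nat) :
  0 < g -> 0 <= K -> (2 <= k)%nat ->
  exists mu rho0, 0 < mu <= 1 /\ 0 < rho0 <= 1 /\
    forall s s' : C, 0 < fst s <= rho0 -> Rabs (snd s) < mu * fst s ->
      Cmod (s' - (s - g * s ^ k)) <= K * Cmod s ^ (k + 1) ->
      0 < fst s' /\ fst s' <= fst s - g / 2 * fst s ^ k /\ Rabs (snd s') < mu * fst s'.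
Proof.
  intros hg hK hk. destruct (pow_1_plus_i k) as (Ck & hCk & hpow).
  (* Chosen so that the quadratic error Ck mu^2 of [pow_1_plus_i] is at most mu / 8. *)
  set (mu := / (8 * (Ck + 1))).
  assert (hmu : 0 < mu <= / 8).
  { unfold mu. split; [apply Rinv_0_lt_compat; lra|]. apply Rinv_le_contravar; lra. }
  assert (cmu : Ck * mu <= / 8).
  { unfold mu. apply Rmult_le_reg_r with (8 * (Ck + 1)); [lra|].
    replace (Ck * / (8 * (Ck + 1)) * (8 * (Ck + 1))) with Ck by (field; lra).
    replace (/ 8 * (8 * (Ck + 1))) with (Ck + 1) by field. lra. }
  set (K' := K * 2 ^ (k + 1)).
  assert (hK' : 0 <= K') by (apply Rmult_le_pos; [easy|apply pow_le; lra]).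
  assert (kp := pos_INR k).
  (* D exceeds each coefficient whose product with x has to be at most 1, so that x <= 1 / D meets
     all smallness conditions at once. *)
  set (D := 64 * (K' + 1) / (g * mu) + 64 * (K' + 1) / mu + 16 * g * (INR k + 3) + 8 * (K' + 1) / g + 1).
  assert (D1 : 0 < 64 * (K' + 1) / (g * mu)) by (apply Rdiv_lt_0_compat; nra).
  assert (D2 : 0 < 64 * (K' + 1) / mu) by (apply Rdiv_lt_0_compat; nra).
  assert (D3 : 0 < 16 * g * (INR k + 3)) by nra.
  assert (D4 : 0 < 8 * (K' + 1) / g) by (apply Rdiv_lt_0_compat; nra).
  assert (hD : 1 <= D) by (unfold D; lra).
  exists mu, (/ D). split; [lra|]. split.
  { split; [apply Rinv_0_lt_compat; lra|]. rewrite <- Rinv_1. apply Rinv_le_contravar; lra. }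
  intros s s' [hx hx'] hy herr. set (x := fst s) in *. set (sg := snd s / x).
  assert (Dx : D * x <= 1).
  { apply Rle_trans with (D * / D); [apply Rmult_le_compat_l; lra|]. apply Req_le. field. lra. }
  assert (U : forall T, 0 <= T -> T <= D -> T * x <= 1) by (intros; nra).
  assert (u1 : 64 * (K' + 1) * x <= g * mu).
  { assert (h := U (64 * (K' + 1) / (g * mu)) ltac:(lra) ltac:(unfold D; lra)).
    apply Rmult_le_reg_r with (/ (g * mu)); [apply Rinv_0_lt_compat; nra|].
    replace (g * mu * / (g * mu)) with 1 by (field; lra). unfold Rdiv in h. lra. }
  assert (u2 : 64 * (K' + 1) * x <= mu).
  { assert (h := U (64 * (K' + 1) / mu) ltac:(lra) ltac:(unfold D; lra)).
    apply Rmult_le_reg_r with (/ mu); [apply Rinv_0_lt_compat; lra|].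
    replace (mu * / mu) with 1 by (field; lra). unfold Rdiv in h. lra. }
  assert (u3 : 16 * g * (INR k + 3) * x <= 1) by (apply U; unfold D; lra).
  assert (u4 : 8 * (K' + 1) * x <= g).
  { assert (h := U (8 * (K' + 1) / g) ltac:(lra) ltac:(unfold D; lra)).
    apply Rmult_le_reg_r with (/ g); [now apply Rinv_0_lt_compat|].
    replace (g * / g) with 1 by (field; lra). unfold Rdiv in h. lra. }
  assert (x1 : x <= 1) by (assert (h := U 1 ltac:(lra) hD); lra).
  assert (es : s = (RtoC x * (1, sg))%C).
  { unfold sg, x. rewrite (surjective_pairing s) at 1. unfold Cmult. simpl.
    f_equal; [ring|]. field. fold x. lra. }
  assert (hsg : - mu < sg < mu).
  { apply Rabs_def2 in hy. unfold sg. split; apply Rmult_lt_reg_r with x; auto;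
      replace (snd s / x * x) with (snd s) by (field; lra); lra. }
  destruct (hpow sg ltac:(lra)) as [p1 p2].
  set (R := fst ((1, sg) ^ k)%C) in *. set (I := snd ((1, sg) ^ k)%C) in *.
  assert (ep : (s ^ k)%C = (x ^ k * R, x ^ k * I)).
  { rewrite es at 1. rewrite Cpow_mult_l, <- RtoC_pow, (surjective_pairing ((1, sg) ^ k)%C).
    fold R I. unfold Cmult. simpl. f_equal; ring. }
  assert (sq : Ck * sg ^ 2 <= mu / 8).
  { assert (sg ^ 2 <= mu * mu) by (simpl; nra). apply Rle_trans with (Ck * (mu * mu)); [nra|]. nra. }
  apply Rabs_le_between in p1. apply Rabs_le_between in p2.
  assert (hR : 7 / 8 <= R <= 9 / 8) by lra.
  assert (ms : Cmod s <= 2 * x).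
  { eapply Rle_trans; [apply Cmod_le_parts|]. fold x. rewrite Rabs_right by lra. nra. }
  set (k' := x ^ (k - 1)).
  assert (xk : x ^ k = x * k').
  { unfold k'. replace k with (S (k - 1)) at 1 by lia. easy. }
  assert (hk' : 0 < k' <= x).
  { unfold k'. split; [now apply pow_lt|]. rewrite <- (pow_1 x) at 2. apply pow_le_low; [lra|lia]. }
  set (err := (s' - (s - g * s ^ k))%C) in *.
  assert (herr' : Cmod err <= K' * x * (x * k')).
  { apply Rle_trans with (1 := herr). apply Rle_trans with (K * (2 * x) ^ (k + 1)).
    - apply Rmult_le_compat_l; [easy|]. apply pow_incr. split; [apply Cmod_ge_0|easy].
    - unfold K'. rewrite Rpow_mult_distr. replace (x ^ (k + 1)) with (x * (x * k')).
      + apply Req_le. ring.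
      + rewrite <- xk, pow_add. simpl. ring. }
  assert (e1 : Rabs (fst err) <= K' * x * (x * k')).
  { eapply Rle_trans; [|exact herr']. apply (re_le_Cmod err). }
  assert (e2 : Rabs (snd err) <= K' * x * (x * k')).
  { eapply Rle_trans; [|exact herr']. eapply Rle_trans; [|apply Rmax_Cmod]. apply Rmax_r. }
  assert (es' : s' = ((s - g * s ^ k) + err)%C) by (unfold err; ring).
  assert (f1 : fst s' = x - g * (x * k') * R + fst err).
  { rewrite es', ep, <- xk. simpl. fold x. ring. }
  assert (f2 : snd s' = x * sg - g * (x * k') * I + snd err).
  { rewrite es', ep, <- xk. simpl. unfold sg. field. lra. }
  assert (kx : 0 < x * k') by nra.
  assert (err_small : K' * x * (x * k') <= g / 8 * (x * k')) by nra.
  assert (q1 := e1). apply Rabs_le_between in q1.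
  assert (gk : 16 * g * (x * k') * 3 <= x).
  { apply Rle_trans with ((16 * g * (INR k + 3) * x) * x); [|nra].
    apply Rle_trans with (16 * g * (x * x) * (INR k + 3)); [|apply Req_le; ring].
    apply Rmult_le_compat; nra. }
  (* The lower edge is the upper edge of the complex conjugate, whence the opposite signs. *)
  assert (up := cone_step mu g x sg R I (fst err) (snd err) K' k k').
  assert (lo := cone_step mu g x (- sg) R (- I) (fst err) (- snd err) K' k k').
  rewrite Rabs_Ropp in lo.
  assert (0 < mu * fst s' - snd s').
  { rewrite f1, f2. apply up; try lra; try easy; nra. }
  assert (0 < mu * fst s' + snd s').
  { rewrite f1, f2. replace (mu * (x - g * (x * k') * R + fst err) + (x * sg - g * (x * k') * I + snd err))
      with (mu * (x - g * (x * k') * R + fst err) - (x * - sg - g * (x * k') * - I + - snd err)) by ring.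
    apply lo; try lra; try easy; nra. }
  split; [|split].
  - rewrite f1. nra.
  - rewrite f1, xk. nra.
  - apply Rabs_def1; lra.
Qed.

Definition convex_dom (D : C -> Prop) : Prop :=
  forall a b t, D a -> D b -> 0 <= t <= 1 -> D (a + t * (b - a))%C.

Lemma continuous_on_C {T : UniformSpace} (A : T -> Prop) (g : T -> C) :
  (forall x, A x -> forall eps, 0 < eps -> locally x (fun y => A y -> Cmod (g y - g x) < eps)) ->
  continuous_on A g.
Proof.
  intros h x hx P hP. apply locally_C in hP. destruct hP as (d & hd & hP).
  specialize (h x hx d hd). unfold filtermap, within.
  apply filter_imp with (2 := h). intros y hy ay. apply hP. auto.
Qed.

Lemma continuous_on_C_elim {T : UniformSpace} (A : T -> Prop) (g : T -> C) x eps :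
  continuous_on A g -> A x -> 0 < eps -> locally x (fun y => A y -> Cmod (g y - g x) < eps).
Proof.
  intros h hx he. apply (h x hx (fun w => Cmod (w - g x) < eps)).
  apply locally_C. now exists eps.
Qed.

(** Segments join points, and the straight-line contraction to the base point stays in the domain;
    it keeps both ends fixed because the path is a loop. *)
Lemma convex_simply_connected D : convex_dom D -> simply_connected D.
Proof.
  intros hc. split.
  - intros a b ha hb. exists (fun t => a + t * (b - a))%C.
    assert (c0 := Cmod_ge_0 (b - a)).
    split; [split|split; [ring|]].
    + apply continuous_on_C. intros x hx eps he.
      assert (hd : 0 < eps / (Cmod (b - a) + 1)) by (apply Rdiv_lt_0_compat; lra).
      exists (mkposreal _ hd). intros y hy _. change (Rabs (y - x) < eps / (Cmod (b - a) + 1)) in hy.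
      replace (a + y * (b - a) - (a + x * (b - a)))%C with (RtoC (y - x) * (b - a))%C
        by (rewrite RtoC_minus; ring).
      rewrite Cmod_mult, Cmod_R.
      apply Rle_lt_trans with (Rabs (y - x) * (Cmod (b - a) + 1)).
      * apply Rmult_le_compat_l; [apply Rabs_pos|lra].
      * apply Rlt_le_trans with (eps / (Cmod (b - a) + 1) * (Cmod (b - a) + 1)).
        -- apply Rmult_lt_compat_r; lra.
        -- apply Req_le. field. lra.
    + intros t ht. now apply hc.
    + ring.
  - intros g [gc gD] loop.
    exists (fun st => g (snd st) + RtoC (fst st) * (g 0 - g (snd st)))%C.
    assert (u0 : unit_interval 0) by (unfold unit_interval; lra).
    split; [|split; [|split; [|split]]].
    + apply continuous_on_C. intros [s t] [hs ht] eps he. simpl in hs, ht |- *.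
      assert (c0 := Cmod_ge_0 (g 0 - g t)).
      assert (hd : 0 < eps / 2 / (Cmod (g 0 - g t) + 1)) by (apply Rdiv_lt_0_compat; lra).
      destruct (continuous_on_C_elim _ _ t (eps / 2) gc ht ltac:(lra)) as [e1 h1].
      assert (hm : 0 < Rmin e1 (eps / 2 / (Cmod (g 0 - g t) + 1))).
      { apply Rmin_glb_lt; [apply cond_pos|easy]. }
      exists (mkposreal _ hm). intros [s' t'] [b1 b2] [as' at']. simpl in *.
      assert (k1 : Cmod (g t' - g t) < eps / 2).
      { apply h1; [|easy]. apply ball_le with (2 := b2). apply Rmin_l. }
      assert (k2 : Rabs (s' - s) < eps / 2 / (Cmod (g 0 - g t) + 1)).
      { eapply Rlt_le_trans; [apply b1|]. apply Rmin_r. }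
      replace (g t' + s' * (g 0 - g t') - (g t + s * (g 0 - g t)))%C with
        (RtoC (1 - s') * (g t' - g t) + RtoC (s' - s) * (g 0 - g t))%C
        by (rewrite !RtoC_minus; ring).
      eapply Rle_lt_trans; [apply Cmod_triangle|]. rewrite !Cmod_mult, !Cmod_R.
      unfold unit_interval in *.
      assert (Rabs (1 - s') * Cmod (g t' - g t) <= Cmod (g t' - g t)).
      { rewrite Rabs_right by lra. generalize (Cmod_ge_0 (g t' - g t)). nra. }
      assert (Rabs (s' - s) * Cmod (g 0 - g t) <= eps / 2).
      { apply Rle_trans with (eps / 2 / (Cmod (g 0 - g t) + 1) * (Cmod (g 0 - g t) + 1)).
        - apply Rmult_le_compat; try apply Rabs_pos; lra.
        - apply Req_le. field. lra. }
      lra.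
    + intros [s t] [hs ht]. simpl in *. apply hc; auto.
    + intros t ht. simpl. ring.
    + intros t ht. simpl. ring.
    + intros s hs. simpl. split; [ring|]. rewrite <- loop. ring.
Qed.

(** After the rotation taking w to 1: apex 0, axis from 0 to rho, and sides of slope mu and - mu. *)
Definition triangle (w : C) (mu rho : R) (t : C) : Prop :=
  0 < fst (t / w)%C < rho /\ Rabs (snd (t / w)%C) < mu * fst (t / w)%C.

Lemma triangle_convex (w : C) mu rho : w <> 0%C -> convex_dom (triangle w mu rho).
Proof.
  intros hw a b t [[a1 a2] a3] [[b1 b2] b3] ht. unfold triangle.
  replace ((a + t * (b - a)) / w)%C with (a / w + t * (b / w - a / w))%C by (unfold Cdiv; ring).
  set (p := (a / w)%C) in *. set (q := (b / w)%C) in *. clearbody p q.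
  apply Rabs_def2 in a3. apply Rabs_def2 in b3. simpl.
  replace (fst p + (t * (fst q + - fst p) - 0 * (snd q + - snd p)))
    with ((1 - t) * fst p + t * fst q) by ring.
  replace (snd p + (t * (snd q + - snd p) + 0 * (fst q + - fst p)))
    with ((1 - t) * snd p + t * snd q) by ring.
  destruct (Rle_lt_or_eq_dec 0 t (proj1 ht)) as [t0|<-].
  - repeat split; try nra. apply Rabs_def1; nra.
  - repeat split; try lra. apply Rabs_def1; lra.
Qed.

Lemma triangle_open w mu rho : Cmod w = 1 -> 0 < mu <= 1 -> open (triangle w mu rho).
Proof.
  intros hw hmu t [[t1 t2] t3]. apply locally_C.
  assert (w0 : w <> 0%C) by (intros e; rewrite e, Cmod_0 in hw; lra).
  set (x := fst (t / w)%C) in *. set (y := snd (t / w)%C) in *.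
  set (d := Rmin (Rmin x (rho - x)) ((mu * x - Rabs y) / 2)).
  assert (hd : 0 < d) by (repeat apply Rmin_glb_lt; lra).
  generalize (Rmin_l (Rmin x (rho - x)) ((mu * x - Rabs y) / 2))
   (Rmin_r (Rmin x (rho - x)) ((mu * x - Rabs y) / 2)) (Rmin_l x (rho - x)) (Rmin_r x (rho - x)).
  fold d. intros.
  exists d. split; [easy|]. intros s hs.
  assert (e : Cmod (s / w - t / w) < d).
  { replace (s / w - t / w)%C with ((s - t) / w)%C by (unfold Cdiv; ring).
    rewrite Cmod_div by easy. rewrite hw. lra. }
  assert (e1 := Re_le (s / w) (t / w)). assert (e2 := Im_le (s / w) (t / w)).
  fold x in e1. fold y in e2.
  apply Rabs_le_between in e1. apply Rabs_le_between in e2.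
  unfold triangle. set (x' := fst (s / w)%C) in *. set (y' := snd (s / w)%C) in *.
  assert (ay := Rabs_pos y). assert (by' := Rle_abs y). assert (by2 := Rle_abs (- y)).
  rewrite Rabs_Ropp in by2.
  split; [lra|]. assert (mu * x' > mu * x - d) by nra. apply Rabs_def1; lra.
Qed.

Lemma triangle_boundary w mu rho : Cmod w = 1 -> 0 < mu -> 0 < rho ->
  boundary_point (triangle w mu rho) (RtoC 0).
Proof.
  intros hw hmu hrho P hP. apply locally_C in hP. destruct hP as (d & hd & hP).
  assert (w0 : w <> 0%C) by (intros e; rewrite e, Cmod_0 in hw; lra).
  split.
  - set (s := Rmin d rho / 2). assert (0 < Rmin d rho) by now apply Rmin_glb_lt.
    rmin_bounds.
    exists (RtoC s * w)%C. split.
    + apply hP. replace (s * w - 0)%C with (s * w)%C by ring.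
      rewrite Cmod_mult, hw, Cmod_real; unfold s; lra.
    + unfold triangle. replace (s * w / w)%C with (RtoC s) by (field; easy). simpl.
      rewrite Rabs_R0. unfold s. repeat split; try lra. apply Rmult_lt_0_compat; lra.
  - exists (RtoC 0). split.
    + apply hP. replace (0 - 0)%C with (RtoC 0) by ring. now rewrite Cmod_0.
    + intros [[h _] _]. replace (0 / w)%C with (RtoC 0) in h by (field; easy). simpl in h. lra.
Qed.

(** In the coordinate t / w, with w given by [unit_root], E becomes s - |c| s^k + O(s^(k+1)) and
    [step_in_cone] applies. The bound [delta] serves to fit the petal into a prescribed domain. *)
Lemma attracting_petal (E : C -> C) (c : C) k K d :
  c <> 0%C -> (2 <= k)%nat -> 0 < d ->
  (forall t, Cmod t < d -> Cmod (E t - (t + c * t ^ k)) <= K * Cmod t ^ (k + 1)) ->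
  forall delta, 0 < delta -> exists D : C -> Prop,
    open D /\ simply_connected D /\ boundary_point D (RtoC 0) /\
    (forall t, D t -> t <> 0%C /\ Cmod t < delta /\ D (E t)) /\
    (forall t, D t -> forall eps, 0 < eps ->
       exists N, forall n, (N <= n)%nat -> Cmod (Nat.iter n E t) < eps).
Proof.
  intros hc hk hd hE delta hdelta. destruct (unit_root c (k - 1) ltac:(lia) hc) as (w & hw & ew).
  assert (cp : 0 < Cmod c) by now apply Cmod_gt_0.
  assert (w0 : w <> 0%C) by (intros e; rewrite e, Cmod_0 in hw; lra).
  destruct (step_in_cone (Cmod c) (Rabs K) k cp (Rabs_pos K) hk) as (mu & rho0 & hmu & hrho0 & step).
  set (rho := Rmin rho0 (Rmin (d / 2) (delta / 2))).
  assert (hrho : 0 < rho) by (repeat apply Rmin_glb_lt; lra).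
  generalize (Rmin_l rho0 (Rmin (d / 2) (delta / 2))) (Rmin_r rho0 (Rmin (d / 2) (delta / 2)))
   (Rmin_l (d / 2) (delta / 2)) (Rmin_r (d / 2) (delta / 2)). fold rho. intros r1 r2 r3 r4.
  assert (small : forall t, triangle w mu rho t -> t <> 0%C /\ Cmod t <= 2 * fst (t / w)%C /\ Cmod t < 2 * rho).
  { intros t [[t1 t2] t3].
    assert (e : Cmod t = Cmod (t / w)) by (rewrite Cmod_div, hw by easy; field).
    split.
    - intros ->. replace (0 / w)%C with (RtoC 0) in t1 by (field; easy). simpl in t1. lra.
    - assert (Cmod t <= 2 * fst (t / w)%C); [|lra]. rewrite e.
      eapply Rle_trans; [apply Cmod_le_parts|]. rewrite (Rabs_right (fst _)) by lra. nra. }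
  assert (dyn : forall t, triangle w mu rho t -> triangle w mu rho (E t) /\
    fst (E t / w)%C <= fst (t / w)%C - Cmod c / 2 * fst (t / w)%C ^ k).
  { intros t ht. destruct (small t ht) as (t0 & s1 & s2). destruct ht as [[t1 t2] t3].
    destruct (step (t / w)%C (E t / w)%C) as (c1 & c2 & c3); [lra|easy| |].
    - replace (E t / w - (t / w - Cmod c * (t / w) ^ k))%C with ((E t - (t + c * t ^ k)) / w)%C.
      + rewrite !Cmod_div, hw by easy. unfold Rdiv. rewrite Rinv_1, !Rmult_1_r.
        apply Rle_trans with (1 := hE t ltac:(lra)).
        apply Rmult_le_compat_r; [apply pow_le, Cmod_ge_0|apply Rle_abs].
      + assert (e : (t ^ k)%C = ((t / w) ^ k * (w * w ^ (k - 1)))%C).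
        { rewrite <- Cpow_S. replace (S (k - 1)) with k by lia. rewrite <- Cpow_mult_l.
          f_equal. field. easy. }
        rewrite e. replace (c * ((t / w) ^ k * (w * w ^ (k - 1))))%C
          with ((c * w ^ (k - 1)) * w * (t / w) ^ k)%C by ring.
        rewrite ew, RtoC_opp. field. easy.
    - split; [|easy]. split; [|easy]. split; [easy|].
      assert (0 <= fst (t / w)%C ^ k) by (apply pow_le; lra). nra. }
  exists (triangle w mu rho). split; [now apply triangle_open|].
  split; [now apply convex_simply_connected, triangle_convex|].
  split; [apply triangle_boundary; lra|]. split.
  - intros t ht. destruct (small t ht) as (t0 & s1 & s2). repeat split; auto; [lra|now apply dyn..].
  - intros t ht eps he.
    assert (it : forall n, triangle w mu rho (Nat.iter n E t)).
    { induction n as [|n IH]; [easy|]. simpl. now apply dyn. }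
    (* The real part decays and controls the modulus up to a factor 2, hence eps / 2. *)
    destruct (power_decay (fun n => fst (Nat.iter n E t / w)%C) (Cmod c / 2) k) with (eps := eps / 2)
      as [N hN]; [lra| | |lra|].
    + intros n. apply (it n).
    + intros n. simpl. now apply dyn.
    + exists N. intros n hn. specialize (hN n hn). cbv beta in hN.
      destruct (small _ (it n)) as (_ & s1 & _). lra.
Qed.

(** * Lifting to blow-ups *)

(** The case m = 0 of the bound says that the origin is fixed. *)
Definition tangent_id (G1 G2 : C -> C -> C) : Prop :=
  hol G1 /\ hol G2 /\ exists K d, 0 < d /\ 0 <= K /\
    forall x y m, Cmod x <= m -> Cmod y <= m -> m <= d ->
      Cmod (G1 x y - x) <= K * m ^ 2 /\ Cmod (G2 x y - y) <= K * m ^ 2.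

Lemma hol_scal_x v : hol (fun x y => x * (y + v))%C.
Proof.
  apply (hol_mult (fun x _ => x) (fun _ y => y + v)%C); [apply hol_x|].
  apply (hol_plus (fun _ y => y) (fun _ _ => v)); [apply hol_y|apply hol_const].
Qed.

(* In the chart [(x, x (y + v))], the map [(G1, G2)] becomes [(x q, y + x beta)]. *)
Definition is_chart (G1 G2 : C -> C -> C) (v : C) (q beta : C -> C -> C) (K : R) (x y : C) : Prop :=
  G1 x (x * (y + v))%C = (x * q x y)%C /\
  G2 x (x * (y + v))%C = (x * q x y * (y + x * beta x y + v))%C /\
  q x y <> 0%C /\ Cmod (x * q x y - x) <= K * Cmod x ^ 2.

(** In the chart the two components move by x^2 a and x^2 b. Hence q = 1 + x a, and the quotient of
    the new components minus v is y + x beta with beta = (b - (y + v) a) / q. *)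
Lemma tangent_id_chart G1 G2 v : tangent_id G1 G2 ->
  exists q beta K, hol q /\ hol beta /\ 0 <= K /\ near (is_chart G1 G2 v q beta K).
Proof.
  intros (h1 & h2 & K & d & hd & hK & est).
  set (c := Cmod v + 1). assert (hc : 1 <= c) by (unfold c; generalize (Cmod_ge_0 v); lra).
  assert (bd : near (fun x y => Cmod (G1 x (x * (y + v))%C - x) <= K * c ^ 2 * Cmod x ^ 2 /\
     Cmod (G2 x (x * (y + v))%C - x * (y + v)) <= K * c ^ 2 * Cmod x ^ 2)).
  { apply near_intro with (Rmin 1 (d / c)).
    { apply Rmin_glb_lt; [lra|]. apply Rdiv_lt_0_compat; lra. }
    intros x y hx hy. rmin_bounds.
    assert (x0 := Cmod_ge_0 x).
    rewrite Rmult_assoc, <- Rpow_mult_distr. apply est.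
    - nra.
    - rewrite Cmod_mult, Rmult_comm. apply Rmult_le_compat_r; [easy|].
      eapply Rle_trans; [apply Cmod_triangle|]. unfold c. lra.
    - apply Rle_trans with (c * (d / c)); [apply Rmult_le_compat_l; lra|]. apply Req_le. field. lra. }
  assert (hx2 := hol_scal_x v). assert (z : (0 * (0 + v))%C = 0%C) by ring.
  destruct (hol_divx (fun x y => G1 x (x * (y + v)) - x)%C (K * c ^ 2) 2) as (a & ha & ea).
  { apply hol_minus; [|apply hol_x].
    apply (hol_comp G1 (fun x _ => x) (fun x y => x * (y + v))%C); auto. apply hol_x. }
  { apply near_imp with (2 := bd). now intros x y [h _] _. }
  destruct (hol_divx (fun x y => G2 x (x * (y + v)) - x * (y + v))%C (K * c ^ 2) 2) as (b & hb & eb).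
  { apply hol_minus; [|easy].
    apply (hol_comp G2 (fun x _ => x) (fun x y => x * (y + v))%C); auto. apply hol_x. }
  { apply near_imp with (2 := bd). now intros x y [_ h] _. }
  set (q := fun x y => (1 + x * a x y)%C).
  assert (hxa : hol (fun x y => x * a x y)%C) by (apply hol_mult; [apply hol_x|easy]).
  assert (hq : hol q) by (apply (hol_plus (fun _ _ => RtoC 1)); [apply hol_const|easy]).
  assert (q0 : q (RtoC 0) (RtoC 0) <> 0%C).
  { unfold q. intros e. apply (f_equal fst) in e. simpl in e. lra. }
  set (beta := fun x y => ((b x y - (y + v) * a x y) / q x y)%C).
  assert (hbeta : hol beta).
  { apply hol_div; [|easy|easy]. apply hol_minus; [easy|]. apply hol_mult; [|easy].
    apply (hol_plus (fun _ y => y) (fun _ _ => v)); [apply hol_y|apply hol_const]. }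
  exists q, beta, (K * c ^ 2). split; [easy|]. split; [easy|].
  split; [apply Rmult_le_pos; [easy|apply pow_le; lra]|].
  apply near_imp with (2 := near_and _ _ (near_and _ _ bd (near_and _ _ ea eb)) (hol_nonzero_near q hq q0)).
  intros x y [[[b1 b2] [e1 e2]] nz].
  assert (E1 : G1 x (x * (y + v))%C = (x * q x y)%C).
  { replace (G1 x (x * (y + v))%C) with (G1 x (x * (y + v)) - x + x)%C by ring.
    rewrite e1. unfold q. simpl. ring. }
  split; [easy|]. split; [|split; [easy|now rewrite <- E1]].
  replace (G2 x (x * (y + v))%C) with (G2 x (x * (y + v)) - x * (y + v) + x * (y + v))%C by ring.
  rewrite e2. replace (x * q x y * (y + x * beta x y + v))%C with
    (x * (q x y * (y + v) + x * (beta x y * q x y)))%C by ring.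
  unfold beta. replace ((b x y - (y + v) * a x y) / q x y * q x y)%C with (b x y - (y + v) * a x y)%C
    by (field; easy). unfold q. simpl. ring.
Qed.

Lemma tangent_id_swap G1 G2 :
  tangent_id G1 G2 -> tangent_id (fun x y => G2 y x) (fun x y => G1 y x).
Proof.
  intros (h1 & h2 & K & d & hd & hK & est). split; [now apply hol_swap|]. split; [now apply hol_swap|].
  exists K, d. split; [easy|]. split; [easy|]. intros x y m hx hy hm.
  destruct (est y x m hy hx hm). now split.
Qed.

Section BlowUp.

Variables (M : surface) (q : M).

Lemma over_same l : over q q l = inr l.
Proof. unfold over. destruct (excluded_middle_informative (q = q)); [easy|contradiction]. Qed.

Lemma over_ne m l (ne : m <> q) : over q m l = inl (exist _ m ne).
Proof.
  unfold over. destruct (excluded_middle_informative (m = q)) as [e|n]; [contradiction|].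
  do 2 f_equal. apply Classical_Prop.proof_irrelevance.
Qed.

Lemma over_indep m l l' : m <> q -> over q m l = over q m l'.
Proof. intros ne. now rewrite !(over_ne _ _ ne). Qed.

Lemma proj_over m l : proj (over q m l : blowup M q) = m.
Proof. unfold over. now destruct (excluded_middle_informative (m = q)). Qed.

(** What a blow-up at q asks of the charts, as a [surface] records no axioms: near its origin the
    chart at q takes the value q only there, and charts at other points avoid q near their centres.
    This is inherited by the blow-up at the directions [1 : v]. *)
Definition centered_chart : Prop :=
  par q O2 = q /\ near (fun x y => par q (x, y) = q -> x = 0%C /\ y = 0%C) /\
  forall m, m <> q -> near (fun x y => par m (x, y) <> q).

Hypothesis good : centered_chart.

Lemma centered_chart_blowup v :
  @par (blowup M q) (inr (Some v)) O2 = inr (Some v) /\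
  near (fun x y => @par (blowup M q) (inr (Some v)) (x, y) = inr (Some v) -> x = 0%C /\ y = 0%C) /\
  forall m : blowup M q, m <> inr (Some v) -> near (fun x y => par m (x, y) <> inr (Some v)).
Proof.
  destruct good as (g1 & g2 & g3). unfold O2 in g1.
  assert (g2' := near_comp _ (fun x _ => x) (fun x y => x * (y + v))%C g2 hol_x (hol_scal_x v)
     eq_refl ltac:(cbv beta; ring)).
  split; [|split].
  - simpl. replace (0 * (0 + v))%C with (RtoC 0) by ring. rewrite g1, Cplus_0_l. apply over_same.
  - apply near_imp with (2 := g2'). intros x y h e. simpl in e.
    unfold over in e. destruct (excluded_middle_informative _) as [e'|n]; [|discriminate].
    destruct (h e') as [x0 _]. split; [easy|]. assert (e2 : (y + v)%C = v) by congruence.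
    replace y with (y + v - v)%C by ring. rewrite e2. ring.
  - intros [m0|[v'|]] ne.
    + exists 1. split; [lra|]. intros x y _ _. simpl. unfold over.
      destruct (excluded_middle_informative _); discriminate.
    + assert (dv : 0 < Cmod (v - v')).
      { apply Cmod_gt_0. intros e. apply ne. do 2 f_equal.
        replace v with (v - v' + v')%C by ring. rewrite e. ring. }
      exists (Cmod (v - v')). split; [easy|]. intros x y _ hy. simpl. unfold over.
      destruct (excluded_middle_informative _) as [em|em]; [|discriminate]. intros e. assert (e2 : (y + v')%C = v) by congruence.
      rewrite <- e2 in hy. replace (y + v' - v')%C with y in hy by ring. lra.
    (* Around [0 : 1] the slope is 1 / x, of modulus larger than that of v for x small; the case v =
       0 is set apart because the radius is the modulus of 1 / v. *)
    + destruct (Ceq_dec v (RtoC 0)) as [v0|v0].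
      * exists 1. split; [lra|]. intros x y _ _. simpl. unfold over.
        destruct (excluded_middle_informative _) as [em|em]; [|discriminate].
        destruct (Ceq_dec x 0) as [x0|x0]; [discriminate|]. intros e.
        assert (e2 : (/ x)%C = 0%C) by congruence. assert (h := Cinv_r x x0). rewrite e2 in h.
        apply (f_equal fst) in h. simpl in h. lra.
      * assert (p : 0 < Cmod (/ v))
          by (rewrite Cmod_inv by easy; apply Rinv_0_lt_compat, Cmod_gt_0; easy).
        exists (Cmod (/ v)). split; [easy|]. intros x y hx _. simpl. unfold over.
        destruct (excluded_middle_informative _) as [em|em]; [|discriminate].
        destruct (Ceq_dec x 0) as [x0|x0]; [discriminate|]. intros e. assert (e2 : (/ x)%C = v) by congruence.
        rewrite <- e2 in hx. replace (/ / x)%C with x in hx by (field; easy). lra.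
Qed.

(** As the differential at q is the identity, every direction is fixed. Elsewhere [None] is a
    placeholder, read only if the image is q, a case outside [lift_dom]. *)
Definition lift_map (g : M -> M) (m : blowup M q) : blowup M q :=
  match m with inl m0 => over q (g (proj1_sig m0)) None | inr l => inr l end.

Variables (U : M -> Prop) (g : M -> M) (G1 G2 : C -> C -> C).
Hypotheses (fix_q : g q = q)
  (rep : near (fun x y => g (par q (x, y)) = par q (G1 x y, G2 x y)))
  (tid : tangent_id G1 G2).

Lemma lift_map_over m l : (m <> q) -> lift_map g (over q m l) = over q (g m) None.
Proof. intros ne. now rewrite (over_ne _ _ ne). Qed.

Lemma hol_x_mult h : hol h -> hol (fun x y => x * h x y)%C.
Proof. intros hh. apply hol_mult; [apply hol_x|easy]. Qed.

Lemma hol_y_plus_x h : hol h -> hol (fun x y => y + x * h x y)%C.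
Proof. intros hh. apply hol_plus; [apply hol_y|now apply hol_x_mult]. Qed.

(** [centered_chart] is used at the point and at its image: neither is q when x is non-zero, so the
    direction passed to [over] is immaterial. *)
Lemma lift_map_rep_some v s beta K :
  hol s -> hol beta -> near (is_chart G1 G2 v s beta K) ->
  near (fun x y => lift_map g (@par (blowup M q) (inr (Some v)) (x, y)) =
     @par (blowup M q) (inr (Some v)) (x * s x y, y + x * beta x y)%C).
Proof.
  intros hs hb ch. destruct good as (g1 & g2 & g3). unfold O2 in g1.
  assert (g2a := near_comp _ (fun x _ => x) (fun x y => x * (y + v))%C g2 hol_x (hol_scal_x v)
     eq_refl ltac:(cbv beta; ring)).
  assert (rep' := near_comp _ (fun x _ => x) (fun x y => x * (y + v))%C rep hol_x (hol_scal_x v)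
     eq_refl ltac:(cbv beta; ring)).
  assert (hH : hol (fun x y => x * s x y * (y + x * beta x y + v))%C).
  { apply hol_mult; [now apply hol_x_mult|].
    apply hol_plus; [now apply hol_y_plus_x|apply hol_const]. }
  assert (g2b := near_comp _ (fun x y => x * s x y)%C _ g2 (hol_x_mult _ hs) hH
    ltac:(cbv beta; ring) ltac:(cbv beta; ring)).
  apply near_imp with (2 := near_and _ _ ch (near_and _ _ rep' (near_and _ _ g2a g2b))).
  intros x y [(e1 & e2 & e3 & _) [r [n1 n2]]]. simpl.
  destruct (Ceq_dec x (RtoC 0)) as [->|x0].
  - rewrite !Cmult_0_l, !Cplus_0_r, g1. now rewrite over_same.
  - rewrite lift_map_over by (intros e; now apply x0, n1). rewrite r, e1, e2.
    apply over_indep. intros e. destruct (n2 e) as [e4 _]. now apply (Cmult_neq_0 _ _ x0 e3).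
Qed.

(** The chart at [0 : 1] is the chart of slope 0 after exchanging the coordinates. *)
Lemma lift_map_rep_none :
  exists s beta, hol s /\ hol beta /\
  near (fun x y => lift_map g (@par (blowup M q) (inr None) (x, y)) =
     @par (blowup M q) (inr None) (x + y * beta y x, y * s y x)%C).
Proof.
  destruct (tangent_id_chart _ _ (RtoC 0) (tangent_id_swap _ _ tid))
    as (s & beta & K & hs & hb & _ & (d & hd & ch)).
  destruct good as (g1 & g2 & g3). unfold O2 in g1.
  exists s, beta. split; [easy|]. split; [easy|].
  assert (ch' : near (fun x y => G2 (x * y)%C y = (y * s y x)%C /\
      G1 (x * y)%C y = (y * s y x * (x + y * beta y x))%C /\ s y x <> 0%C)).
  { exists d. split; [easy|]. intros x y hx hy. destruct (ch y x hy hx) as (e1 & e2 & e3 & _).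
    rewrite Cplus_0_r, (Cmult_comm y x) in e1, e2. rewrite Cplus_0_r in e2. auto. }
  assert (hxy : hol (fun x y => x * y)%C) by (apply hol_mult; [apply hol_x|apply hol_y]).
  assert (g2a := near_comp _ (fun x y => x * y)%C (fun _ y => y) g2 hxy hol_y ltac:(cbv beta; ring) eq_refl).
  assert (rep' := near_comp _ (fun x y => x * y)%C (fun _ y => y) rep hxy hol_y ltac:(cbv beta; ring) eq_refl).
  assert (hs1 := hol_swap _ (hol_x_mult _ hs)). assert (hs2 := hol_swap _ (hol_y_plus_x _ hb)).
  assert (g2b := near_comp _ _ _ g2 (hol_mult _ _ hs2 hs1) hs1 ltac:(cbv beta; ring) ltac:(cbv beta; ring)).
  apply near_imp with (2 := near_and _ _ ch' (near_and _ _ rep' (near_and _ _ g2a g2b))).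
  intros x y [(e1 & e2 & e3) [r [n1 n2]]]. simpl.
  destruct (Ceq_dec y (RtoC 0)) as [->|y0].
  - rewrite !Cmult_0_l, !Cmult_0_r, !Cplus_0_r, g1. now rewrite !over_same.
  - rewrite lift_map_over by (intros e; now apply y0, n1). rewrite r, e1, e2, (Cmult_comm (y * s y x)).
    apply over_indep. intros e. destruct (n2 e) as [_ e4]. now apply (Cmult_neq_0 _ _ y0 e3).
Qed.

Hypothesis hol_g : forall m, U m -> holomorphic_map m g.

Lemma lift_map_is_lift : is_lift q U g (lift_map g).
Proof.
  intros m [hm hm']. assert (good' := good). destruct good' as (g1 & g2 & g3).
  assert (build : forall (p : blowup M q) H1 H2, hol H1 -> hol H2 ->
     H1 (RtoC 0) (RtoC 0) = 0%C -> H2 (RtoC 0) (RtoC 0) = 0%C -> lift_map g p = p ->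
     near (fun x y => lift_map g (par p (x, y)) = par p (H1 x y, H2 x y)) ->
     holomorphic_map p (lift_map g)).
  { intros p H1 H2 h1 h2 e1 e2 fixp r.
    exists (fun z => (H1 (fst z) (snd z), H2 (fst z) (snd z))).
    split; [|split; [|split]].
    - apply holomorphic2_hol, hol_at_O2. exact h1.
    - apply holomorphic2_hol, hol_at_O2. exact h2.
    - unfold O2. simpl. now rewrite e1, e2.
    - apply locally_O2. rewrite fixp. exact r. }
  destruct m as [[m0 ne]|[v|]].
  - simpl in hm, hm'. destruct hm' as [hm'|hm']; [contradiction|].
    split; [|apply proj_over].
    destruct (hol_g m0 hm) as (Gm & k1 & k2 & k0 & kr). exists Gm.
    split; [easy|]. split; [easy|]. split; [easy|].
    apply locally_O2. apply locally_O2 in kr.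
    apply near_imp with (2 := near_and _ _ kr (g3 m0 ne)). intros x y [e n].
    simpl par. rewrite lift_map_over by easy. simpl lift_map. rewrite (over_ne _ _ hm'). simpl.
    now rewrite e.
  - split; [|simpl; now rewrite fix_q].
    destruct (tangent_id_chart G1 G2 v tid) as (s & beta & K & hs & hb & _ & ch).
    apply (build (inr (Some v)) (fun x y => x * s x y)%C (fun x y => y + x * beta x y)%C); auto;
      [now apply hol_x_mult|now apply hol_y_plus_x|ring|ring|].
    now apply lift_map_rep_some with K.
  - split; [|simpl; now rewrite fix_q].
    destruct lift_map_rep_none as (s & beta & hs & hb & r).
    apply (build (inr None) (fun x y => x + y * beta y x)%C (fun x y => y * s y x)%C); auto; try ring.
    + apply (hol_swap (fun x y => y + x * beta x y)%C). now apply hol_y_plus_x.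
    + apply (hol_swap (fun x y => x * s x y)%C). now apply hol_x_mult.
Qed.

End BlowUp.

(** * Curves transverse to the exceptional divisor *)

Record petal (D : C -> Prop) (E : C -> C) : Prop := Petal {
  petal_open : open D;
  petal_sc : simply_connected D;
  petal_bd : boundary_point D (RtoC 0);
  petal_nz : forall t, D t -> t <> 0%C;
  petal_step : forall t, D t -> D (E t);
  petal_lim : forall t, D t -> forall eps, 0 < eps ->
    exists N, forall n, (N <= n)%nat -> Cmod (Nat.iter n E t) < eps }.

(** The invariant carried up the tower of blow-ups. The curve is a graph over the first coordinate,
    which is also the parameter t and is preserved by the chart at [1 : v]; so D and E are the same
    at every level. The conjugacy with E is repeated in coordinates in [tc_coord], as [par q] is not
    known to be injective. *)
Record transverse_curve (D : C -> Prop) (E : C -> C) (M : surface) (U : M -> Prop) (g : M -> M)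
    (q : M) (G1 G2 : C -> C -> C) (y : C -> C) (phi : C -> M) : Prop := Transverse {
  tc_chart : centered_chart M q;
  tc_fix : g q = q;
  tc_dom : U q;
  tc_hol : forall m, U m -> holomorphic_map m g;
  tc_rep : near (fun x z => g (par q (x, z)) = par q (G1 x z, G2 x z));
  tc_tid : tangent_id G1 G2;
  tc_y : hol (fun x _ => y x);
  tc_y0 : y (RtoC 0) = 0%C;
  tc_phi : forall t, D t -> phi t = par q (t, y t);
  tc_ne : forall t, D t -> phi t <> q;
  tc_curve : forall t, D t -> holomorphic_curve t phi;
  tc_inj : forall s t, D s -> D t -> phi s = phi t -> s = t;
  tc_inv : forall t, D t -> U (phi t) /\ g (phi t) = phi (E t);
  tc_coord : exists d, 0 < d /\ forall t, D t -> Cmod t < d ->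
    G1 t (y t) = E t /\ G2 t (y t) = y (E t) }.

Section Curves.

Variables (D : C -> Prop) (E : C -> C).
Hypothesis pet : petal D E.

Lemma petal_iter n t : D t -> D (Nat.iter n E t).
Proof. intros h. induction n as [|n IH]; [easy|]. simpl. now apply (petal_step D E pet). Qed.

Lemma curve_limit (M : surface) (q : M) (y : C -> C) (phi : C -> M) (P : M -> Prop) :
  hol (fun x _ => y x) -> y (RtoC 0) = 0%C -> (forall t, D t -> phi t = par q (t, y t)) ->
  nbhs q P -> exists d, 0 < d /\ forall t, D t -> Cmod t < d -> P (phi t).
Proof.
  intros hy y0 hphi hP. apply locally_O2 in hP.
  destruct (near_at0 _ (near_snd0 _ y hy y0 hP)) as (d & hd & h).
  exists d. split; [easy|]. intros t ht htd. rewrite hphi by easy. now apply h.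
Qed.

Lemma iter_curve (M : surface) (g : M -> M) (phi : C -> M) t :
  (forall t, D t -> g (phi t) = phi (E t)) -> D t ->
  forall n, Nat.iter n g (phi t) = phi (Nat.iter n E t).
Proof.
  intros h ht n. induction n as [|n IH]; [easy|]. simpl. rewrite IH. apply h. now apply petal_iter.
Qed.

Lemma transverse_parabolic M U g q G1 G2 y phi :
  transverse_curve D E M U g q G1 G2 y phi -> parabolic_curve U g q D phi.
Proof.
  intros [h1 h2 h3 h4 h5 h6 h7 h8 h9 h10 h11 h12 h13 h14].
  split; [easy|]. split; [apply pet|]. split; [apply pet|]. split; [apply pet|].
  split; [easy|]. split; [easy|]. split; [|split].
  - intros P hP. destruct (curve_limit M q y phi P h7 h8 h9 hP) as (d & hd & h).
    apply locally_C. exists d. split; [easy|]. intros t ht htD. apply h; [easy|].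
    now replace (t - 0)%C with t in ht by ring.
  - intros t ht. destruct (h13 t ht) as [u e]. split; [easy|]. exists (E t).
    split; [now apply (petal_step D E pet)|easy].
  - intros t ht P hP. destruct (curve_limit M q y phi P h7 h8 h9 hP) as (d & hd & h).
    destruct (petal_lim D E pet t ht d hd) as [N hN]. exists N. intros n hn.
    rewrite (iter_curve M g phi t (fun t ht => proj2 (h13 t ht)) ht).
    apply h; [now apply petal_iter|now apply hN].
Qed.

Lemma petal_small d : 0 < d -> exists t, D t /\ Cmod t < d.
Proof.
  intros hd. destruct (petal_bd D E pet (fun w => Cmod w < d)) as [[t [h1 h2]] _].
  - apply locally_C. exists d. split; [easy|]. intros w hw. now replace (w - 0)%C with w in hw by ring.
  - now exists t.
Qed.

(** The limit direction v is the derivative of y at 0, and the lifted curve is the graph of y / x -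
    v. *)
Lemma transverse_lift M U g q G1 G2 y phi :
  transverse_curve D E M U g q G1 G2 y phi ->
  exists v H1 H2 y' psi,
    (forall t, D t -> proj (psi t : blowup M q) = phi t) /\
    transverse_curve D E (blowup M q) (lift_dom q U g) (lift_map M q g) (inr (Some v)) H1 H2 y' psi /\
    forall t, D t -> y t = (t * (v + y' t))%C.
Proof.
  intros [h1 h2 h3 h4 h5 h6 h7 h8 h9 h10 h11 h12 h13 h14].
  destruct (hol_divx1 (fun x _ => y x) h7) as (w & hw & ew).
  { exists 1. split; [lra|]. now intros. }
  set (v := w (RtoC 0) (RtoC 0)).
  set (y' := fun t => if Ceq_dec t 0 then RtoC 0 else (y t / t - v)%C).
  assert (y'0 : y' (RtoC 0) = 0%C) by (unfold y'; now destruct (Ceq_dec 0 0)).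
  assert (hy' : hol (fun x _ => y' x)).
  { apply hol_ext with (fun x _ => w x (RtoC 0) - v)%C.
    - destruct ew as (d & hd & ew). exists d. split; [easy|]. intros x z hx _. unfold y'.
      destruct (Ceq_dec x 0) as [->|x0]; [unfold v; ring|].
      rewrite (ew x (RtoC 0)) by (auto; now rewrite Cmod_0). field. easy.
    - apply hol_minus; [|apply hol_const].
      apply (hol_comp w (fun x _ => x) (fun _ _ => RtoC 0)); auto; [apply hol_x|apply hol_const]. }
  assert (ey : forall t, D t -> y t = (t * (v + y' t))%C).
  { intros t ht. assert (t0 := petal_nz D E pet t ht). unfold y'.
    destruct (Ceq_dec t 0); [contradiction|]. field. easy. }
  set (psi := fun t => over q (phi t) None : blowup M q).
  destruct (tangent_id_chart G1 G2 v h6) as (sl & beta & K & ks & kb & hK & ch).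
  assert (rep' := lift_map_rep_some M q h1 g G1 G2 h5 v sl beta K ks kb ch).
  set (H1 := fun x z => (x * sl x z)%C). set (H2 := fun x z => (z + x * beta x z)%C).
  destruct (centered_chart_blowup M q h1 v) as (c1 & c2 & c3).
  assert (ch' := near_snd0 _ y' hy' y'0 ch).
  destruct (near_at0 _ ch') as (d1 & hd1 & chy). destruct h14 as (d2 & hd2 & h14).
  (* The second equation holds after multiplication by the first coordinate E t, which is non-zero
     on D. *)
  assert (coord : forall t, D t -> Cmod t < Rmin d1 d2 -> H1 t (y' t) = E t /\ H2 t (y' t) = y' (E t)).
  { intros t ht htd. rmin_bounds.
    destruct (chy t ltac:(lra)) as (e1 & e2 & _). destruct (h14 t ht ltac:(lra)) as [e4 e5].
    change (t * sl t (y' t))%C with (H1 t (y' t)) in e1, e2.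
    change (y' t + t * beta t (y' t))%C with (H2 t (y' t)) in e2.
    rewrite (Cplus_comm (y' t)), <- ey, e4 in e1 by easy.
    rewrite (Cplus_comm (y' t)), <- ey, e5, <- e1 in e2 by easy.
    split; [easy|]. assert (hE := petal_step D E pet t ht). assert (E0 := petal_nz D E pet _ hE).
    rewrite (ey (E t) hE) in e2.
    assert (e3 : (E t * (H2 t (y' t) - y' (E t)))%C = 0%C).
    { replace (E t * (H2 t (y' t) - y' (E t)))%C with
        (E t * (H2 t (y' t) + v) - E t * (v + y' (E t)))%C by ring. rewrite <- e2. ring. }
    destruct (Ceq_dec (H2 t (y' t)) (y' (E t))) as [|n]; [easy|]. exfalso.
    apply (Cmult_neq_0 (E t) (H2 t (y' t) - y' (E t))%C); [easy| |easy].
    intros e6. apply n. replace (H2 t (y' t)) with (H2 t (y' t) - y' (E t) + y' (E t))%C by ring.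
    rewrite e6. ring. }
  exists v, H1, H2, y', psi. split; [intros; apply proj_over|]. split; [|easy].
  assert (hcoord : 0 < Rmin d1 d2) by now apply Rmin_glb_lt.
  assert (psi_inl : forall t (ht : D t), psi t = inl (exist _ (phi t) (h10 t ht))).
  { intros t ht. apply over_ne. }
  (* The tangent of the lifted curve is fixed by the differential of the lift,
     which is therefore the identity. *)
  assert (b0 : beta (RtoC 0) (RtoC 0) = 0%C).
  { destruct (hol_lip1 y' hy') as (L & dL & hdL & hL & lip).
    destruct (hol_lip1 (fun x => beta x (y' x))) as (L' & dL' & hdL' & hL' & lip').
    { apply (hol_comp beta (fun x _ => x) (fun x _ => y' x)); auto. apply hol_x. }
    apply Cmod_small_eq0. intros eps he.
    (* The bound [s1] keeps E t in the disc where y' is Lipschitz; [mm] makes the final estimate (L'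
       + L K) |t| at most eps. *)
    destruct (small_real (K + 1) (Rmin (Rmin d1 d2) dL') dL) as (s1 & p1 & p2 & p3 & p4);
      [now repeat apply Rmin_glb_lt|easy|].
    destruct (small_real (L' + L * K) s1 eps p1 he) as (mm & hmm & m1 & _ & m2).
    rmin_bounds.
    assert (LK : 0 <= L * K) by now apply Rmult_le_pos.
    destruct (petal_small mm hmm) as (t & ht & htm).
    destruct (coord t ht ltac:(lra)) as [e1 e2].
    destruct (chy t ltac:(lra)) as (_ & _ & _ & e4). assert (e5 : H2 t (y' t) = (y' t + t * beta t (y' t))%C) by easy.
    change (t * sl t (y' t))%C with (H1 t (y' t)) in e4.
    assert (t0 := petal_nz D E pet t ht). assert (tp : 0 < Cmod t) by now apply Cmod_gt_0.
    rewrite e1 in e4. rewrite e2 in e5.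
    assert (tK : (K + 1) * Cmod t <= dL) by nra.
    assert (eE : Cmod (E t) <= dL).
    { replace (E t) with (E t - t + t)%C by ring. eapply Rle_trans; [apply Cmod_triangle|].
      assert (Cmod t ^ 2 <= Cmod t) by (simpl; nra).
      assert (K * Cmod t ^ 2 <= K * Cmod t) by now apply Rmult_le_compat_l. lra. }
    assert (e6 : Cmod (y' (E t) - y' t) <= L * (K * Cmod t ^ 2)).
    { apply Rle_trans with (1 := lip (E t) t eE ltac:(nra)). now apply Rmult_le_compat_l. }
    assert (e7 : Cmod (beta t (y' t)) <= L * K * Cmod t).
    { apply Rmult_le_reg_l with (Cmod t); [easy|]. rewrite <- Cmod_mult.
      replace (t * beta t (y' t))%C with (y' (E t) - y' t)%C by (rewrite e5; ring).
      apply Rle_trans with (1 := e6). apply Req_le. ring. }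
    assert (e8 : Cmod (beta (RtoC 0) (y' (RtoC 0)) - beta t (y' t)) <= L' * Cmod t).
    { apply Rle_trans with (1 := lip' (RtoC 0) t ltac:(rewrite Cmod_0; lra) ltac:(lra)).
      rewrite Cmod_minus_sym, Cmod_minus_0. lra. }
    rewrite y'0 in e8.
    replace (beta 0 0) with (beta 0 0 - beta t (y' t) + beta t (y' t))%C by ring.
    eapply Rle_trans; [apply Cmod_triangle|].
    nra. }
  split; auto.
  - now split.
  - now split; [|left].
  - intros m hm. apply (lift_map_is_lift M q h1 U g G1 G2); auto.
  (* The second component is z + x beta, and [b0] makes x beta quadratic. *)
  - split; [now apply hol_x_mult|]. split; [now apply hol_y_plus_x|].
    destruct (hol_lip beta kb) as (L & dL & hdL & hL & lip). destruct ch as (d & hd & ch).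
    exists (K + L), (Rmin (d / 2) dL). split; [apply Rmin_glb_lt; lra|]. split; [lra|].
    intros x z m hx hz hm. rmin_bounds.
    destruct (ch x z ltac:(lra) ltac:(lra)) as (_ & _ & _ & e4).
    assert (x0 := Cmod_ge_0 x).
    assert (sq : Cmod x ^ 2 <= m ^ 2) by (apply pow_incr; lra).
    assert (m2 : 0 <= m ^ 2) by (apply pow_le; lra).
    split; [unfold H1; nra|]. unfold H2. replace (z + x * beta x z - z)%C with (x * beta x z)%C by ring.
    assert (Cmod (beta x z) <= L * m).
    { replace (beta x z) with (beta x z - beta 0 0)%C by (rewrite b0; ring).
      apply lip; rewrite ?Cmod_minus_0, ?Cmod_0; lra. }
    rewrite Cmod_mult. apply Rle_trans with (m * (L * m)).
    + apply Rmult_le_compat; auto. apply Cmod_ge_0.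
    + simpl. nra.
  - intros t ht. simpl. replace (t * (y' t + v))%C with (y t) by (rewrite ey by easy; ring).
    rewrite <- h9 by easy. apply over_indep. auto.
  - intros t ht. now rewrite (psi_inl t ht).
  - intros t ht. destruct (h11 t ht) as (Gc & g0 & gc). exists Gc. split; [easy|].
    apply filter_imp with (2 := gc). intros s (e & e1 & e2). split; [|easy].
    rewrite (psi_inl t ht). simpl. unfold psi. now rewrite e.
  - intros s t hs ht e. apply h12; auto. apply (f_equal (@proj M q)) in e.
    unfold psi in e. now rewrite !proj_over in e.
  - intros t ht. destruct (h13 t ht) as [u e]. split.
    + unfold psi. split; rewrite proj_over; [easy|]. right. rewrite e. apply h10.
      now apply (petal_step D E pet).
    + unfold psi. rewrite lift_map_over by auto. now rewrite e.
  - now exists (Rmin d1 d2).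
Qed.

Lemma transverse_can_blow_up h : forall M U g q G1 G2 y phi,
  transverse_curve D E M U g q G1 G2 y phi -> can_blow_up h U g q D phi.
Proof.
  induction h as [|h IH]; intros M U g q G1 G2 y phi tc; [exact I|].
  destruct (transverse_lift M U g q G1 G2 y phi tc) as (v & H1 & H2 & y' & psi & hpsi & tc' & _).
  exists (lift_map M q g), psi, (Some v). split; [|split; [|split]].
  - apply (lift_map_is_lift M q (tc_chart _ _ _ _ _ _ _ _ _ _ tc) U g G1 G2); apply tc.
  - intros t ht. split; [|now apply hpsi]. now apply (tc_ne _ _ _ _ _ _ _ _ _ _ tc).
  - exact (transverse_parabolic _ _ _ _ _ _ _ _ tc').
  - exact (IH _ _ _ _ _ _ _ _ tc').
Qed.

End Curves.

(** * Non-degenerate leading part: tangential lifts *)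

Lemma par_C2_O2 x y : @par C2 O2 (x, y) = (x, y).
Proof. simpl. now rewrite !Cplus_0_l. Qed.

Lemma centered_chart_C2 : centered_chart C2 O2.
Proof.
  split; [exact (par_C2_O2 0 0)|]. split.
  - exists 1. split; [lra|]. intros x y _ _. rewrite par_C2_O2. unfold O2. intros e.
    split; [exact (f_equal fst e)|exact (f_equal snd e)].
  - intros [a b] ne.
    assert (K : forall c d : C, c <> 0%C -> Cmod d < Cmod c -> (c + d)%C <> 0%C).
    { intros c d hc hd e. replace c with (c + d - d)%C in hd by ring. rewrite e in hd.
      replace (0 - d)%C with (- d)%C in hd by ring. rewrite Cmod_opp in hd. lra. }
    destruct (Ceq_dec a (RtoC 0)) as [a0|a0].
    + assert (b0 : b <> 0%C) by (intros b0; apply ne; now rewrite a0, b0).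
      exists (Cmod b). split; [now apply Cmod_gt_0|]. intros x y _ hy e.
      apply (K b y b0 hy). exact (f_equal snd e).
    + exists (Cmod a). split; [now apply Cmod_gt_0|]. intros x y hx _ e.
      apply (K a x a0 hx). exact (f_equal fst e).
Qed.

(* [coord_x] and [coord_w v] are the components of the inverse of the chart
   [par (dir v)] below. *)
Definition coord_x (m : blowup C2 O2) : C := fst (proj m : C * C).

Definition coord_w (v : C) (m : blowup C2 O2) : C :=
  match m with
  | inl m0 => let z : C * C := proj1_sig m0 in (snd z / fst z - v)%C
  | inr (Some v') => (v' - v)%C
  | inr None => RtoC 0
  end.

Definition dir (v : C) : blowup C2 O2 := exc_pt (O2 : C2) (Some v).

Lemma par_dir v x y : par (dir v) (x, y) = over (M := C2) O2 (x, x * (y + v))%C (Some (y + v)%C).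
Proof. simpl. now rewrite !Cplus_0_l. Qed.

Lemma coord_x_par v x y : coord_x (par (dir v) (x, y)) = x.
Proof. unfold coord_x. rewrite par_dir, (proj_over C2 O2). easy. Qed.

Lemma coord_w_par v x y : coord_w v (par (dir v) (x, y)) = y.
Proof.
  rewrite par_dir. destruct (Ceq_dec x (RtoC 0)) as [->|x0].
  - replace (0 * (y + v))%C with (RtoC 0) by ring.
    replace (over (M := C2) O2 (RtoC 0, RtoC 0) (Some (y + v)%C)) with
      (inr (Some (y + v)%C) : blowup C2 O2) by (symmetry; apply (over_same C2 O2)).
    simpl. ring.
  - assert (ne : (x, (x * (y + v))%C) <> O2) by (intros e; apply x0; exact (f_equal fst e)).
    rewrite (over_ne C2 O2 _ _ ne). simpl. field. easy.
Qed.

Lemma exc_div_par v x y : exc_div (O2 : C2) (par (dir v) (x, y)) <-> x = 0%C.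
Proof.
  unfold exc_div. rewrite par_dir, (proj_over C2 O2). unfold O2. split.
  - intros e. exact (f_equal fst e).
  - intros ->. now rewrite Cmult_0_l.
Qed.

Lemma nbhs_dir v (P : blowup C2 O2 -> Prop) :
  nbhs (dir v) P <-> near (fun x y => P (par (dir v) (x, y))).
Proof. apply locally_O2. Qed.

Lemma holomorphic_fun_dir v h :
  holomorphic_fun (dir v) h <-> hol (fun x y => h (par (dir v) (x, y))).
Proof.
  unfold holomorphic_fun. rewrite holomorphic2_hol.
  apply (hol_at_O2 (fun z => h (par (dir v) z))).
Qed.

Lemma holomorphic_fun_coords v c : hol c -> holomorphic_fun (dir v) (fun m => c (coord_x m) (coord_w v m)).
Proof.
  intros hc. apply holomorphic_fun_dir. apply hol_ext with (2 := hc).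
  exists 1. split; [lra|]. intros x y _ _. now rewrite coord_x_par, coord_w_par.
Qed.

Lemma vanishing_ideal_dir v h :
  vanishing_ideal (exc_div (O2 : C2)) (dir v) h ->
  exists d, 0 < d /\ forall y, Cmod y < d -> h (par (dir v) (RtoC 0, y)) = 0%C.
Proof.
  intros [_ hz]. apply nbhs_dir in hz. destruct hz as (d & hd & hz). exists d. split; [easy|].
  intros y hy. apply hz; [now rewrite Cmod_0|easy|]. now apply exc_div_par.
Qed.

Lemma coord_x_ideal v : vanishing_ideal (exc_div (O2 : C2)) (dir v) coord_x.
Proof.
  split; [apply (holomorphic_fun_coords v (fun x _ => x)), hol_x|].
  apply nbhs_dir. exists 1. split; [lra|]. intros x y _ _ e. rewrite coord_x_par.
  now apply exc_div_par in e.
Qed.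

Lemma coord_x_defining v : defining_function (exc_div (O2 : C2)) (dir v) coord_x.
Proof.
  split; [apply coord_x_ideal|]. intros a ha.
  assert (h1 := proj1 ha). apply holomorphic_fun_dir in h1.
  destruct (hol_divx1 _ h1 (vanishing_ideal_dir v a ha)) as (b & hb & e).
  exists (fun m => b (coord_x m) (coord_w v m)). split; [now apply holomorphic_fun_coords|].
  apply nbhs_dir. apply near_imp with (2 := e). intros x y e'.
  now rewrite coord_x_par, coord_w_par, e', Cmult_comm.
Qed.

Lemma ideal_pow_coord_x v c T : hol c ->
  ideal_pow (dir v) (vanishing_ideal (exc_div (O2 : C2)) (dir v)) T
    (fun m => coord_x m ^ T * c (coord_x m) (coord_w v m))%C.
Proof.
  intros hc. induction T as [|T IH].
  - apply ideal_pow_O. apply (holomorphic_fun_coords v (fun x y => x ^ 0 * c x y)%C).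
    apply hol_mult; [apply (hol_pow (fun x _ => x) 0), hol_x|easy].
  - apply ideal_pow_germ with (2 := ideal_pow_mul _ _ T _ _ (coord_x_ideal v) IH).
    apply nbhs_dir. exists 1. split; [lra|]. intros x y _ _. simpl. ring.
Qed.

(** Turns membership in a power of the ideal into a growth rate, so as to bound the order of contact
    from above. *)
Lemma ideal_pow_bound v T a :
  ideal_pow (dir v) (vanishing_ideal (exc_div (O2 : C2)) (dir v)) T a ->
  exists K, near (fun x y => Cmod (a (par (dir v) (x, y))) <= K * Cmod x ^ T).
Proof.
  induction 1 as [h hh|T a b ha _ (K & IH)|T a b _ (K & IH) _ (K' & IH')|T a b e _ (K & IH)].
  - apply holomorphic_fun_dir in hh. destruct (hol_bounded_near _ hh) as (K & _ & hK).
    exists K. apply near_imp with (2 := hK). intros x y hxy. rewrite pow_O, Rmult_1_r. exact hxy.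
  - assert (h1 := proj1 ha). apply holomorphic_fun_dir in h1.
    destruct (vanishing_ideal_dir v a ha) as (d & hd & z).
    destruct (hol_lip _ h1) as (L & dL & hdL & hL & lip).
    exists (L * K). apply near_imp with (2 := near_and _ _ IH (near_lt (Rmin d dL) ltac:(now apply Rmin_glb_lt))).
    intros x y [hb [hx hy]]. rmin_bounds.
    assert (x0 := Cmod_ge_0 x).
    assert (ba : Cmod (a (par (dir v) (x, y))) <= L * Cmod x).
    { replace (a (par (dir v) (x, y))) with (a (par (dir v) (x, y)) - a (par (dir v) (RtoC 0, y)))%C
        by (rewrite z by lra; ring).
      apply lip; rewrite ?Cmod_diag, ?Cmod_minus_0, ?Cmod_0; lra. }
    rewrite Cmod_mult. replace (L * K * Cmod x ^ S T) with (L * Cmod x * (K * Cmod x ^ T)) by (simpl; ring).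
    apply Rmult_le_compat; auto; apply Cmod_ge_0.
  - exists (K + K'). apply near_imp with (2 := near_and _ _ IH IH'). intros x y [h1 h2].
    eapply Rle_trans; [apply Cmod_triangle|]. lra.
  - exists K. apply nbhs_dir in e. apply near_imp with (2 := near_and _ _ IH e).
    intros x y [h1 h2]. now rewrite <- h2.
Qed.

(** Off the axis the difference is bounded by 0, so [hol_divx] makes it divisible by x, and it
    vanishes on the axis as well. *)
Lemma near_eq_off_axis h h' : hol h -> hol h' ->
  near (fun x y => x <> 0%C -> h x y = h' x y) -> near (fun x y => h x y = h' x y).
Proof.
  intros h1 h2 hd.
  destruct (hol_divx (fun x y => h x y - h' x y)%C 0 1) as (Q & hQ & e); [now apply hol_minus|..].
  { apply near_imp with (2 := hd). intros x y e x0. rewrite (e x0).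
    replace (h' x y - h' x y)%C with (RtoC 0) by ring. rewrite Cmod_0. lra. }
  apply near_imp with (2 := near_and _ _ hd e). intros x y [e1 e2].
  destruct (Ceq_dec x (RtoC 0)) as [->|x0]; [|now apply e1].
  replace (h 0 y) with (h 0 y - h' 0 y + h' 0 y)%C by ring. rewrite e2. simpl. ring.
Qed.

(** Off the divisor a lift is forced by its projection, and holomorphy extends the equality across
    it. The image of [1 : v] must not be another point of the divisor: for [1 : v'], comparing
    slopes at the origin gives v' = v; for [0 : 1], the product [K1 (H2 + v)] would be 1 although
    [K1] vanishes at the origin. *)
Lemma lift_unique (U : C2 -> Prop) (f : C2 -> C2) f' v H1 H2 :
  near (fun x y => U (x, y)) -> f O2 = O2 -> is_lift (O2 : C2) U f f' ->
  hol H1 -> hol H2 -> H1 (RtoC 0) (RtoC 0) = 0%C -> H2 (RtoC 0) (RtoC 0) = 0%C ->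
  near (fun x y => x <> 0%C -> H1 x y <> 0%C) ->
  near (fun x y => f (x, x * (y + v))%C = (H1 x y, H1 x y * (H2 x y + v))%C) ->
  near (fun x y => f' (par (dir v) (x, y)) = par (dir v) (H1 x y, H2 x y)).
Proof.
  intros hU f0 hl h1 h2 z1 z2 nz rep.
  destruct (hl (dir v)) as [hm hp].
  { split; [|now left]. destruct hU as (d & hd & hU). apply hU; now rewrite Cmod_0. }
  destruct hm as (G & g1 & g2 & g0 & gr).
  apply holomorphic2_hol, hol_at_O2 in g1, g2. apply locally_O2 in gr.
  set (K1 := fun x y => fst (G (x, y))) in *. set (K2 := fun x y => snd (G (x, y))) in *.
  assert (k1z : K1 (RtoC 0) (RtoC 0) = 0%C) by exact (f_equal fst g0).
  assert (k2z : K2 (RtoC 0) (RtoC 0) = 0%C) by exact (f_equal snd g0).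
  assert (hU' := near_comp _ (fun x _ => x) (fun x y => x * (y + v))%C hU hol_x (hol_scal_x v)
     eq_refl ltac:(cbv beta; ring)).
  assert (off : near (fun x y => x <> 0%C ->
     proj (par (f' (dir v)) (K1 x y, K2 x y)) = (H1 x y, H1 x y * (H2 x y + v))%C :> C * C)).
  { apply near_imp with (2 := near_and _ _ (near_and _ _ gr hU') (near_and _ _ nz rep)).
    intros x y [[e1 e2] [e3 e4]] x0. specialize (e3 x0).
    assert (pe : proj (par (dir v) (x, y)) = (x, x * (y + v))%C :> C * C).
    { rewrite par_dir. apply (proj_over C2 O2). }
    destruct (hl (par (dir v) (x, y))) as [_ hp'].
    { split; rewrite pe; [easy|]. right. rewrite e4. intros e. apply e3. exact (f_equal fst e). }
    rewrite pe, e4, e1 in hp'. unfold K1, K2. rewrite <- surjective_pairing. exact hp'. }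
  assert (D0 : exists l, f' (dir v) = inr l).
  { destruct (f' (dir v)) as [m|l]; [|now exists l]. exfalso. simpl in hp.
    exact (proj2_sig m (eq_trans hp f0)). }
  destruct D0 as [[v'|] D0]; rewrite D0 in off.
  - assert (eqs : near (fun x y => x <> 0%C -> K1 x y = H1 x y /\ (K2 x y + v')%C = (H2 x y + v)%C)).
    { apply near_imp with (2 := near_and _ _ nz off). intros x y [e1 e2] x0.
      specialize (e1 x0). specialize (e2 x0). change (inr (Some v')) with (dir v') in e2.
      rewrite par_dir in e2. rewrite (proj_over C2 O2) in e2.
      assert (E1 : K1 x y = H1 x y) by exact (f_equal fst e2).
      assert (E2 : (K1 x y * (K2 x y + v'))%C = (H1 x y * (H2 x y + v))%C) by exact (f_equal snd e2).
      split; [easy|]. rewrite E1 in E2.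
      replace (K2 x y + v')%C with (H1 x y * (K2 x y + v') / H1 x y)%C by (field; easy).
      rewrite E2. field. easy. }
    assert (all1 : near (fun x y => K1 x y = H1 x y)).
    { apply near_eq_off_axis; auto. apply near_imp with (2 := eqs). intros x y e x0. now apply e. }
    assert (all2 : near (fun x y => (K2 x y + v')%C = (H2 x y + v)%C)).
    { apply near_eq_off_axis.
      - apply (hol_plus K2 (fun _ _ => v')); [easy|apply hol_const].
      - apply (hol_plus H2 (fun _ _ => v)); [easy|apply hol_const].
      - apply near_imp with (2 := eqs). intros x y e x0. now apply e. }
    assert (vv : v' = v).
    { destruct all2 as (d & hd & a). specialize (a (RtoC 0) (RtoC 0)). rewrite Cmod_0, k2z, z2 in a.
      now rewrite !Cplus_0_l in a; apply a. }
    apply near_imp with (2 := near_and _ _ gr (near_and _ _ all1 all2)).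
    intros x y [e1 [e2 e3]]. rewrite e1, D0, vv. change (inr (Some v)) with (dir v).
    rewrite (surjective_pairing (G (x, y))). fold (K1 x y) (K2 x y). rewrite e2. do 2 f_equal.
    rewrite vv in e3. replace (K2 x y) with (K2 x y + v - v)%C by ring. rewrite e3. ring.
  - exfalso.
    assert (eqs : near (fun x y => x <> 0%C -> (K1 x y * (H2 x y + v))%C = RtoC 1)).
    { apply near_imp with (2 := near_and _ _ nz off). intros x y [e1 e2] x0.
      specialize (e1 x0). specialize (e2 x0). simpl in e2. rewrite (proj_over C2 O2) in e2.
      assert (E1 : (0 + K1 x y * K2 x y)%C = H1 x y) by exact (f_equal fst e2).
      assert (E2 : (0 + K2 x y)%C = (H1 x y * (H2 x y + v))%C) by exact (f_equal snd e2).
      rewrite Cplus_0_l in E1, E2. rewrite E2 in E1.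
      replace (K1 x y * (H2 x y + v))%C with (K1 x y * (H1 x y * (H2 x y + v)) / H1 x y)%C by (field; easy).
      rewrite E1. field. easy. }
    assert (hh : hol (fun x y => K1 x y * (H2 x y + v))%C).
    { apply hol_mult; [easy|]. apply (hol_plus H2 (fun _ _ => v)); [easy|apply hol_const]. }
    destruct (near_eq_off_axis _ (fun _ _ => RtoC 1) hh (hol_const _) eqs) as (d & hd & a).
    specialize (a (RtoC 0) (RtoC 0)). rewrite Cmod_0, k1z in a. specialize (a hd hd).
    rewrite Cmult_0_l in a. apply RtoC_inj in a. lra.
Qed.

Section LeadingPart.

Variables (X f : C * C -> C * C) (k : nat) (b : bool -> nat -> nat -> C) (r N : R).
Hypotheses (exp_f : is_exp X f)
  (hX1 : hol_at (fun q => fst (X q)) O2) (hX2 : hol_at (fun q => snd (X q)) O2)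
  (f0 : f O2 = O2) (hk : (2 <= k)%nat)
  (hb : forall i, expan r N (b i) (fun x y => comp i (X (x, y))))
  (hv : forall i, vanish_below k (b i)).

Let lead (i : bool) (v : C) : C := hom (b i) k (RtoC 1) v.

Lemma exp_chart v i : exists K, 0 <= K /\ near (fun x y => x <> 0%C ->
  Cmod (comp i (f (x, x * (v + y))%C) - (comp i (x, (x * (v + y))%C) + x ^ k * lead i (v + y)%C))
    <= K * Cmod x ^ (k + 1)).
Proof.
  destruct (exp_estimate X f exp_f hX1 hX2 r N b k hk hb hv) as (K1 & m0 & hm0 & est).
  destruct (field_chart X k b r N hb hv v i) as (K2 & hK2 & fc).
  assert (c0 := Cmod_ge_0 v). set (c := Cmod v + 1).
  exists (Rabs K1 * c ^ (k + 1) + K2). assert (cp : 0 <= c ^ (k + 1)) by (apply pow_le; unfold c; lra).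
  split; [assert (a := Rabs_pos K1); nra|].
  apply near_imp with (2 := near_and _ _ fc (near_lt (Rmin 1 (m0 / c))
    ltac:(apply Rmin_glb_lt; [lra|apply Rdiv_lt_0_compat; unfold c; lra]))).
  intros x y [[_ e] [hx hy]] x0. rmin_bounds.
  assert (xp : 0 < Cmod x) by now apply Cmod_gt_0.
  assert (cm : c * Cmod x <= m0).
  { apply mul_le_of_le_div; unfold c in *; lra. }
  assert (es := est i x (x * (v + y))%C (c * Cmod x) ltac:(unfold c; nra) cm ltac:(unfold c; nra)).
  assert (es' := es ltac:(rewrite Cmod_mult, Rmult_comm; apply Rmult_le_compat_r; [lra|];
    eapply Rle_trans; [apply Cmod_triangle|]; unfold c; lra)).
  replace (comp i (f (x, x * (v + y))%C) - (comp i (x, (x * (v + y))%C) + x ^ k * lead i (v + y)))%C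
   with ((comp i (f (x, x * (v + y))%C) - (comp i (x, (x * (v + y))%C) + comp i (X (x, x * (v + y))%C)))
     + (comp i (X (x, x * (v + y))%C) - x ^ k * lead i (v + y)))%C by ring.
  eapply Rle_trans; [apply Cmod_triangle|]. rewrite Rmult_plus_distr_r.
  apply Rplus_le_compat; [|exact e].
  apply Rle_trans with (1 := es'). rewrite Rpow_mult_distr, <- Rmult_assoc.
  apply Rmult_le_compat_r; [apply pow_le; lra|]. apply Rmult_le_compat_r; [easy|apply Rle_abs].
Qed.

Lemma exp_tangent_id : hol (fun x y => fst (f (x, y))) -> hol (fun x y => snd (f (x, y))) ->
  tangent_id (fun x y => fst (f (x, y))) (fun x y => snd (f (x, y))).
Proof.
  intros h1 h2. split; [easy|]. split; [easy|].
  destruct (exp_estimate X f exp_f hX1 hX2 r N b k hk hb hv) as (K1 & m0 & hm0 & est).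
  assert (hr : 0 < r) by apply (hb true). assert (hN := expan_N_ge0 _ _ _ _ (hb true)).
  assert (p1 : 0 <= N / r ^ k) by (apply Rdiv_le_0_compat; [easy|now apply pow_lt]).
  assert (aK := Rabs_pos K1).
  set (K := Rabs K1 + N / r ^ k).
  exists K, (Rmin (Rmin m0 1) r). split; [repeat apply Rmin_glb_lt; lra|]. split; [unfold K; lra|].
  intros x y m hx hy hm.
  rmin_bounds.
  assert (m0' : 0 <= m) by (generalize (Cmod_ge_0 x); lra).
  assert (main : forall i, Cmod (comp i (f (x, y)) - comp i (x, y)) <= K * m ^ 2).
  { destruct (Rle_lt_or_eq_dec 0 m m0') as [mp|<-].
    - intros i. assert (e := est i x y m mp ltac:(lra) hx hy).
      destruct (vanish_tail r N (b i) _ k m x y (hb i) (hv i) hx hy ltac:(lra)) as [e1 _].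
      assert (pw : forall j, (2 <= j)%nat -> 0 <= m ^ j <= m ^ 2).
      { intros j hj. split; [now apply pow_le|]. apply pow_le_low; [lra|easy]. }
      assert (w1 := pw k hk). assert (w2 := pw (k + 1)%nat ltac:(lia)).
      replace (comp i (f (x, y)) - comp i (x, y))%C with
        ((comp i (f (x, y)) - (comp i (x, y) + comp i (X (x, y)))) + comp i (X (x, y)))%C by ring.
      eapply Rle_trans; [apply Cmod_triangle|]. unfold K. rewrite Rmult_plus_distr_r.
      apply Rplus_le_compat.
      + apply Rle_trans with (1 := e). apply Rle_trans with (Rabs K1 * m ^ (k + 1)).
        * apply Rmult_le_compat_r; [apply w2|apply Rle_abs].
        * now apply Rmult_le_compat_l.
      + apply Rle_trans with (1 := e1). now apply Rmult_le_compat_l.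
    - intros i. assert (x0 : x = 0%C) by (apply Cmod_eq_0; generalize (Cmod_ge_0 x); lra).
      assert (y0 : y = 0%C) by (apply Cmod_eq_0; generalize (Cmod_ge_0 y); lra).
      rewrite x0, y0. change (RtoC 0, RtoC 0) with O2. rewrite f0.
      replace (comp i O2 - comp i O2)%C with (RtoC 0) by ring. rewrite Cmod_0. simpl. lra. }
  split; [apply (main true)|apply (main false)].
Qed.

Lemma lead_bounded i v : exists K, 0 <= K /\ forall y, Cmod y < 1 -> Cmod (lead i (v + y)%C) <= K.
Proof.
  assert (c0 := Cmod_ge_0 v).
  exists (hn (b i) k * (Cmod v + 1) ^ k). split; [apply hn_pow_ge0; lra|]. intros y hy.
  apply hom_bound; [rewrite Cmod_1; lra|]. eapply Rle_trans; [apply Cmod_triangle|]. lra.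
Qed.

(** In the chart the first coordinate moves by O(x^k) and the second by x^(k-1) [rr y] up to O(x^k).
    As [rr] is non-zero at y = 0, the order of contact is exactly k - 1, and the extra factor x in
    the motion of the first coordinate is tangentiality. *)
Lemma nondegenerate_tangential (U : C2 -> Prop) f' v :
  hol (fun x y => fst (f (x, y))) -> hol (fun x y => snd (f (x, y))) ->
  near (fun x y => U (x, y)) -> is_lift (O2 : C2) U (f : C2 -> C2) f' ->
  lead false v <> (v * lead true v)%C ->
  tangential_at f' (exc_div (O2 : C2)) (dir v).
Proof.
  intros hf1 hf2 hU hl hnd.
  assert (tid := exp_tangent_id hf1 hf2).
  destruct (tangent_id_chart _ _ v tid) as (s & beta & K & hs & hbeta & hK & ch).
  set (H1 := fun x y => (x * s x y)%C). set (H2 := fun x y => (y + x * beta x y)%C).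
  assert (h1 : hol H1) by now apply hol_x_mult. assert (h2 : hol H2) by now apply hol_y_plus_x.
  assert (z1 : H1 (RtoC 0) (RtoC 0) = 0%C) by (unfold H1; ring).
  assert (z2 : H2 (RtoC 0) (RtoC 0) = 0%C) by (unfold H2; ring).
  assert (lift := lift_unique U f f' v H1 H2 hU f0 hl h1 h2 z1 z2
    (near_imp _ _ (fun x y h x0 => Cmult_neq_0 _ _ x0 (proj1 (proj2 (proj2 h)))) ch)
    (near_imp _ _ (fun x y h => eq_trans (surjective_pairing _) (f_equal2 pair (proj1 h) (proj1 (proj2 h)))) ch)).
  destruct (exp_chart v true) as (Ka & hKa & ea). destruct (exp_chart v false) as (Kb & hKb & eb).
  destruct (lead_bounded true v) as (La & hLa & la). destruct (lead_bounded false v) as (Lb & hLb & lb).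
  assert (c0 := Cmod_ge_0 v). set (c := Cmod v + 1).
  set (Kc := Kb + c * Ka).
  set (rr := fun y => (lead false (v + y) - (v + y) * lead true (v + y))%C).
  assert (Kc0 : 0 <= Kc) by (unfold Kc, c; nra).
  (* [H2 - y] is, up to the factor [H1 ~ x], the discriminant of the leading part. *)
  assert (est : near (fun x y => x <> 0%C ->
     Cmod (H1 x y - x) <= (Ka + La) * Cmod x ^ k /\
     Cmod x / 2 <= Cmod (H1 x y) <= 2 * Cmod x /\
     Cmod (H1 x y * (H2 x y - y) - x ^ k * rr y) <= Kc * Cmod x ^ (k + 1))).
  { apply near_imp with (2 := near_and _ _ (near_and _ _ ea eb) (near_and _ _ ch
      (near_lt (Rmin 1 (/ (2 * (K + 1)))) ltac:(apply Rmin_glb_lt; [lra|apply Rinv_0_lt_compat; lra])))).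
    intros x y [[e1 e2] [(q1 & q2 & _ & q4) [hx hy]]] x0. specialize (e1 x0). specialize (e2 x0).
    change (x * s x y)%C with (H1 x y) in q1, q2, q4. change (y + x * beta x y)%C with (H2 x y) in q2.
    rmin_bounds.
    assert (xp : 0 < Cmod x) by now apply Cmod_gt_0.
    unfold comp in e1, e2. cbn [fst snd] in e1, e2. rewrite (Cplus_comm y) in q1, q2.
    rewrite q1 in e1. rewrite q2 in e2.
    assert (pk : 0 < Cmod x ^ k) by now apply pow_lt.
    assert (pk1 : Cmod x ^ (k + 1) <= Cmod x ^ k) by (rewrite pow_add; simpl; nra).
    split; [|split].
    - replace (H1 x y - x)%C with ((H1 x y - (x + x ^ k * lead true (v + y))) + x ^ k * lead true (v + y))%C by ring.
      eapply Rle_trans; [apply Cmod_triangle|]. rewrite Cmod_mult, Cmod_pow.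
      specialize (la y ltac:(lra)). nra.
    - assert (sm : K * Cmod x ^ 2 <= Cmod x / 2).
      { assert ((K + 1) * Cmod x <= / 2).
        { apply Rle_trans with ((K + 1) * / (2 * (K + 1))); [apply Rmult_le_compat_l; lra|].
          apply Req_le. field. lra. }
        simpl. nra. }
      generalize (Cmod_lower x (H1 x y)) (Cmod_lower (H1 x y) x). rewrite (Cmod_minus_sym x). lra.
    - unfold rr. replace (H1 x y * (H2 x y - y) - x ^ k * (lead false (v + y) - (v + y) * lead true (v + y)))%C
       with ((H1 x y * (H2 x y + v) - (x * (v + y) + x ^ k * lead false (v + y)))
         - (v + y) * (H1 x y - (x + x ^ k * lead true (v + y))))%C by ring.
      eapply Rle_trans; [apply Cmod_triangle_minus|]. rewrite Cmod_mult.
      assert (Cmod (v + y) <= c) by (eapply Rle_trans; [apply Cmod_triangle|unfold c; lra]).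
      assert (Cmod (v + y) * Cmod (H1 x y - (x + x ^ k * lead true (v + y))) <= c * (Ka * Cmod x ^ (k + 1))).
      { apply Rmult_le_compat; auto; apply Cmod_ge_0. }
      unfold Kc. lra. }
  assert (rrb : forall y, Cmod y < 1 -> Cmod (rr y) <= Lb + c * La).
  { intros y hy. unfold rr. eapply Rle_trans; [apply Cmod_triangle_minus|]. rewrite Cmod_mult.
    specialize (la y hy). specialize (lb y hy).
    assert (Cmod (v + y) <= c) by (eapply Rle_trans; [apply Cmod_triangle|unfold c; lra]).
    assert (Cmod (v + y) * Cmod (lead true (v + y)) <= c * La)
      by (apply Rmult_le_compat; auto; apply Cmod_ge_0). lra. }
  (* One order is lost when [H1], comparable with x, is divided out of the last estimate. *)
  set (T := (k - 1)%nat). assert (kT : k = S T) by (unfold T; lia).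
  set (Kd := Ka + La + 2 * (Kc + (Lb + c * La))).
  assert (Kd0 : 0 <= Lb + c * La) by (unfold c; nra).
  assert (est2 : near (fun x y => x <> 0%C ->
     Cmod (H1 x y - x) <= Kd * Cmod x ^ T /\ Cmod (H2 x y - y) <= Kd * Cmod x ^ T)).
  { apply near_imp with (2 := near_and _ _ est (near_lt 1 Rlt_0_1)).
    intros x y [e [hx hy]] x0. destruct (e x0) as (e1 & [e2 e2'] & e3).
    assert (xp : 0 < Cmod x) by now apply Cmod_gt_0.
    assert (pT : 0 < Cmod x ^ T) by now apply pow_lt.
    assert (xk : Cmod x ^ k = Cmod x * Cmod x ^ T) by (rewrite kT; easy).
    assert (xk1 : Cmod x ^ (k + 1) = Cmod x * Cmod x ^ k) by (rewrite pow_add; simpl; ring).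
    assert (p2 : 0 <= Kc * Cmod x ^ T) by (apply Rmult_le_pos; lra).
    split.
    - apply Rle_trans with (1 := e1). unfold Kd. rewrite xk.
      assert (0 <= (Ka + La) * Cmod x ^ T) by (apply Rmult_le_pos; lra).
      assert (0 <= (Lb + c * La) * Cmod x ^ T) by (apply Rmult_le_pos; lra). nra.
    - apply Rmult_le_reg_l with (Cmod x / 2); [lra|].
      apply Rle_trans with (Cmod (H1 x y * (H2 x y - y))).
      + rewrite Cmod_mult. apply Rmult_le_compat_r; [apply Cmod_ge_0|easy].
      + replace (H1 x y * (H2 x y - y))%C with ((H1 x y * (H2 x y - y) - x ^ k * rr y) + x ^ k * rr y)%C by ring.
        eapply Rle_trans; [apply Cmod_triangle|]. rewrite Cmod_mult, Cmod_pow.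
        specialize (rrb y hy).
        assert (Cmod x ^ k * Cmod (rr y) <= Cmod x ^ k * (Lb + c * La))
          by (apply Rmult_le_compat_l; [apply pow_le|]; lra).
        assert (Kc * Cmod x ^ (k + 1) <= Kc * Cmod x ^ k).
        { apply Rmult_le_compat_l; [easy|]. rewrite xk1. assert (0 < Cmod x ^ k) by now apply pow_lt. nra. }
        apply Rle_trans with ((Kc + (Lb + c * La)) * Cmod x ^ k); [lra|]. rewrite xk. unfold Kd.
        assert (0 <= (Ka + La) * (Cmod x * Cmod x ^ T)) by (apply Rmult_le_pos; [lra|nra]). nra. }
  destruct (hol_divx (fun x y => H1 x y - x)%C (Ka + La) k) as (a & ha & ea').
  { apply hol_minus; [easy|apply hol_x]. }
  { apply near_imp with (2 := est). intros x y e x0. now apply e. }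
  exists T, coord_x, (fun m => coord_x m * a (coord_x m) (coord_w v m))%C.
  split; [split|split; [apply coord_x_defining|split]].
  (* A holomorphic function is Lipschitz in the two coordinates, so its increment is O(x^T), hence
     x^T times a holomorphic function. *)
  - intros h hh. apply holomorphic_fun_dir in hh. set (hc := fun x y => h (par (dir v) (x, y))) in *.
    assert (hcH : hol (fun x y => hc (H1 x y) (H2 x y))) by (apply hol_comp; auto).
    destruct (hol_lip hc hh) as (L & d & hd & hL & lip).
    assert (dom := near_and _ _ (near_comp _ H1 H2 (near_lt d hd) h1 h2 z1 z2) (near_lt d hd)).
    destruct (hol_divx (fun x y => hc (H1 x y) (H2 x y) - hc x y)%C (L * Kd) T) as (cc & hcc & ecc).
    { now apply hol_minus. }
    { apply near_imp with (2 := near_and _ _ dom est2). intros x y [[[d1 d2] [d3 d4]] e] x0.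
      destruct (e x0) as [e1 e2]. rewrite Rmult_assoc. apply lip; lra. }
    apply ideal_pow_germ with (2 := ideal_pow_coord_x v cc T hcc).
    apply nbhs_dir. apply near_imp with (2 := near_and _ _ ecc lift). intros x y [e1 e2].
    rewrite coord_x_par, coord_w_par, e2, <- e1. easy.
  (* The test function is [coord_w v]: contact of order k or more would make [H2] of order x^k on y
     = 0, against the non-zero value of [rr] at 0. *)
  - intros T' hT'. destruct (le_lt_dec T' T) as [h|h]; [easy|]. exfalso.
    assert (hw : holomorphic_fun (dir v) (coord_w v)) by (apply (holomorphic_fun_coords v (fun _ y => y)), hol_y).
    destruct (ideal_pow_bound v T' _ (hT' _ hw)) as (K3 & bd).
    assert (r0 : 0 < Cmod (rr (RtoC 0))).
    { apply Cmod_gt_0. unfold rr. rewrite Cplus_0_r. intros e. apply hnd.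
      replace (lead false v) with (lead false v - v * lead true v + v * lead true v)%C by ring.
      rewrite e. ring. }
    destruct (near_and _ _ (near_and _ _ bd lift) est) as (d & hd & all).
    assert (aK := Rabs_pos K3).
    destruct (small_real (Kc + 2 * Rabs K3) d (Cmod (rr (RtoC 0)) / 2)) as (x & sp & sd & s1 & sm);
      [easy|lra|].
    assert (cs := Cmod_real x ltac:(lra)).
    assert (s0 : RtoC x <> 0%C) by (intros e; apply RtoC_inj in e; lra).
    destruct (all (RtoC x) (RtoC 0)) as [[a1 a2] a3]; [lra|rewrite Cmod_0; lra|].
    destruct (a3 s0) as (_ & [_ e2] & e3). rewrite a2, !coord_w_par in a1. rewrite cs in *.
    replace (H2 x 0 - 0)%C with (H2 x 0) in a1, e3 by ring.
    assert (pT : x ^ T' <= x ^ k) by (apply pow_le_low; [lra|lia]).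
    assert (pk : 0 < x ^ k) by now apply pow_lt.
    assert (b1 : Cmod (H2 x 0) <= Rabs K3 * x ^ k).
    { apply Rle_trans with (1 := a1). assert (0 < x ^ T') by now apply pow_lt.
      assert (K3 <= Rabs K3) by apply Rle_abs. nra. }
    assert (b2 : Cmod (x ^ k * rr 0) <= Kc * x ^ (k + 1) + 2 * x * (Rabs K3 * x ^ k)).
    { replace (x ^ k * rr 0)%C with (H1 x 0 * H2 x 0 - (H1 x 0 * H2 x 0 - x ^ k * rr 0))%C by ring.
      eapply Rle_trans; [apply Cmod_triangle_minus|]. rewrite Cmod_mult.
      assert (Cmod (H1 x 0) * Cmod (H2 x 0) <= 2 * x * (Rabs K3 * x ^ k))
        by (apply Rmult_le_compat; auto; apply Cmod_ge_0). lra. }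
    rewrite Cmod_mult, Cmod_pow, cs, pow_add in b2. simpl (x ^ 1) in b2.
    assert (b3 : Cmod (rr (RtoC 0)) <= (Kc + 2 * Rabs K3) * x).
    { apply Rmult_le_reg_l with (x ^ k); [easy|]. lra. }
    lra.
  - apply nbhs_dir. apply near_imp with (2 := near_and _ _ ea' lift). intros x y [e1 e2].
    rewrite e2, !coord_x_par, coord_w_par, e1, kT. simpl. ring.
  - split.
    + apply (holomorphic_fun_coords v (fun x y => x * a x y)%C). apply hol_mult; [apply hol_x|easy].
    + apply nbhs_dir. exists 1. split; [lra|]. intros x y _ _ e. apply exc_div_par in e.
      rewrite coord_x_par, e. ring.
Qed.

End LeadingPart.

(** * Petals with different limit directions *)

(** [None] is a placeholder: by [RP_limit_direction] the orbits on an RP curve avoid the origin. *)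
Definition limit_direction (f : C2 -> C2) (c : curve) (l : P1) : Prop :=
  forall t, cdom c t ->
    filterlim (fun n => over (M := C2) O2 (Nat.iter n f (cmap c t)) None : blowup C2 O2)
      Hierarchy.eventually (nbhs (exc_pt (O2 : C2) l)).

(** One blow-up is enough: orbits on the lifted curve converge to its limit point and project to the
    orbits on the curve. *)
Lemma RP_limit_direction U f c : RP_curve U f c ->
  exists l, limit_direction f c l /\
    forall t, cdom c t -> forall n, Nat.iter n f (cmap c t) <> O2.
Proof.
  intros (_ & hb & _). destruct (hb 1%nat (le_n _)) as (g' & psi & l & hl & hpsi & pc & _).
  destruct pc as (_ & _ & _ & _ & _ & _ & _ & inv & lim). exists l.
  assert (step : forall t, cdom c t -> forall n, exists s, cdom c s /\
     Nat.iter n g' (psi t) = psi s /\ Nat.iter n f (cmap c t) = cmap c s).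
  { intros t ht. induction n as [|n (s & hs & e1 & e2)]; [now exists t|].
    destruct (inv s hs) as (dom & s' & hs' & e). exists s'. split; [easy|].
    split; [exact (eq_trans (f_equal g' e1) e)|]. apply (eq_trans (f_equal f e2)).
    destruct (hl _ dom) as [_ hp].
    rewrite e in hp. destruct (hpsi s hs) as [_ p1]. destruct (hpsi s' hs') as [_ p2].
    rewrite p1, p2 in hp. now symmetry. }
  split.
  - intros t ht. apply filterlim_ext with (2 := lim t ht). intros n.
    destruct (step t ht n) as (s & hs & e1 & e2). rewrite e1, e2.
    destruct (hpsi s hs) as [ne p1]. rewrite <- p1 in ne |- *.
    destruct (psi s) as [m|l']; [|now contradiction ne]. destruct m as [m hm]. simpl.
    symmetry. apply (over_ne C2 O2).
  - intros t ht n. destruct (step t ht n) as (s & hs & _ & e2). rewrite e2. now apply hpsi.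
Qed.

(** Distinct points of the divisor are separated by neighbourhoods described through the slope of
    the projected point. *)
Lemma direction_unique (p : nat -> C * C) v l :
  (forall n, p n <> O2) ->
  filterlim (fun n => over (M := C2) O2 (p n) None : blowup C2 O2) Hierarchy.eventually (nbhs (dir v)) ->
  filterlim (fun n => over (M := C2) O2 (p n) None : blowup C2 O2) Hierarchy.eventually
    (nbhs (exc_pt (O2 : C2) l)) ->
  l = Some v.
Proof.
  intros hp h1 h2.
  assert (N1 : forall e, 0 < e -> nbhs (dir v) (fun m => exists x w, Cmod w < e /\
    proj m = (x, x * (w + v))%C :> C * C)).
  { intros e he. apply nbhs_dir. exists e. split; [easy|]. intros x w _ hw. exists x, w.
    split; [easy|]. rewrite par_dir. apply (proj_over C2 O2). }
  destruct l as [v'|].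
  - destruct (Ceq_dec v v') as [->|ne]; [easy|]. exfalso.
    assert (dv : 0 < Cmod (v - v')).
    { apply Cmod_gt_0. intros e. apply ne. replace v with (v - v' + v')%C by ring. rewrite e. ring. }
    assert (N2 : nbhs (dir v') (fun m => exists x w, Cmod w < Cmod (v - v') / 2 /\
      proj m = (x, x * (w + v'))%C :> C * C)).
    { apply nbhs_dir. exists (Cmod (v - v') / 2). split; [lra|]. intros x w _ hw. exists x, w.
      split; [easy|]. rewrite par_dir. apply (proj_over C2 O2). }
    destruct (h1 _ (N1 (Cmod (v - v') / 2) ltac:(lra))) as [n1 e1]. destruct (h2 _ N2) as [n2 e2].
    destruct (e1 (n1 + n2)%nat ltac:(lia)) as (x & w & hw & ex).
    destruct (e2 (n1 + n2)%nat ltac:(lia)) as (x' & w' & hw' & ex').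
    rewrite (proj_over C2 O2) in ex, ex'. rewrite ex in ex'.
    assert (xx : x = x') by exact (f_equal fst ex').
    assert (yy : (x * (w + v))%C = (x' * (w' + v'))%C) by exact (f_equal snd ex').
    rewrite <- xx in yy.
    assert (x0 : x <> 0%C).
    { intros x0. apply (hp (n1 + n2)%nat). rewrite ex, x0. unfold O2. now rewrite Cmult_0_l. }
    assert (ww : (v - v')%C = (w' - w)%C).
    { replace (v - v')%C with (x * (w + v) / x - w - v')%C by (field; easy). rewrite yy. field. easy. }
    rewrite ww in hw, hw'. generalize (Cmod_triangle_minus w' w). lra.
  - exfalso.
    (* Near [1 : v] the slope has modulus at most |v| + 1, near [0 : 1] its inverse is smaller than
       e, and their product is 1. *)
    set (e := / (Cmod v + 2)). assert (v0 := Cmod_ge_0 v).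
    assert (he : 0 < e) by (apply Rinv_0_lt_compat; lra).
    assert (N2 : nbhs (exc_pt (O2 : C2) None) (fun m => exists x w, Cmod x < e /\
      proj m = (x * w, w)%C :> C * C)).
    { apply locally_O2. exists e. split; [easy|]. intros x w hx _. exists x, w.
      split; [easy|]. simpl par. rewrite (proj_over C2 O2). simpl. now rewrite !Cplus_0_l. }
    destruct (h1 _ (N1 1 Rlt_0_1)) as [n1 e1]. destruct (h2 _ N2) as [n2 e2].
    destruct (e1 (n1 + n2)%nat ltac:(lia)) as (x & w & hw & ex).
    destruct (e2 (n1 + n2)%nat ltac:(lia)) as (x' & w' & hw' & ex').
    rewrite (proj_over C2 O2) in ex, ex'. rewrite ex in ex'.
    assert (xx : x = (x' * w')%C) by exact (f_equal fst ex').
    assert (yy : (x * (w + v))%C = w') by exact (f_equal snd ex').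
    assert (x0 : x <> 0%C).
    { intros x0. apply (hp (n1 + n2)%nat). rewrite ex, x0. unfold O2. now rewrite Cmult_0_l. }
    rewrite <- yy in xx.
    assert (one : (x' * (w + v))%C = 1%C).
    { replace (x' * (w + v))%C with (x' * (x * (w + v)) / x)%C by (field; easy). rewrite <- xx. field. easy. }
    assert (m1 := f_equal Cmod one). rewrite Cmod_mult, Cmod_1 in m1.
    assert (b : Cmod (w + v) <= Cmod v + 1) by (eapply Rle_trans; [apply Cmod_triangle|]; lra).
    assert (p0 := Cmod_ge_0 x'). assert (p1 := Cmod_ge_0 (w + v)).
    assert (e * (Cmod v + 2) = 1) by (unfold e; field; lra). nra.
Qed.

(** A curve included in another shares its orbits with it, and an orbit has at most one limit
    direction. With v fixed, an equivalence passes through the generated equivalence relation. *)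
Lemma same_petal_direction U f c d v :
  same_petal U f c d -> limit_direction f c (Some v) <-> limit_direction f d (Some v).
Proof.
  induction 1 as [c d (rc & rd & inc)|c|c d _ IH|c d e _ IH _ IH']; [|tauto|tauto|tauto].
  destruct (RP_limit_direction U f c rc) as (lc & hlc & nc).
  destruct (RP_limit_direction U f d rd) as (ld & hld & nd).
  destruct rc as ((_ & _ & _ & bd & _) & _).
  destruct (bd (fun _ => True)) as [[t [_ ht]] _]; [now exists (mkposreal 1 Rlt_0_1)|].
  destruct (inc t ht) as (s & hs & e). assert (nt := nc t ht). split; intros h.
  - assert (ld = Some v) as <-; [|easy].
    apply (direction_unique _ v ld nt (h t ht)). rewrite e. now apply hld.
  - assert (lc = Some v) as <-; [|easy].
    apply (direction_unique _ v lc nt); [rewrite e; now apply h|now apply hlc].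
Qed.

(** The petal is taken small enough for the leaf over it to lie in U and for Y to be differentiable
    there. The asymptotic series is convergent: it is that of the parametrisation (t, Y t). *)
Lemma RP_curve_of_leaf (U : C2 -> Prop) (f : C2 -> C2) (u : C -> C) (v c : C) k d K :
  open (U : C * C -> Prop) -> U O2 -> (forall p : C2, U p -> holomorphic_map p f) -> f O2 = O2 ->
  tangent_id (fun x y => fst (f (x, y))) (fun x y => snd (f (x, y))) ->
  hol (fun x _ => u x) -> u (RtoC 0) = 0%C -> c <> 0%C -> (2 <= k)%nat -> 0 < d ->
  (forall t, Cmod t < d -> exists e, f (t, t * (v + u t))%C = (e, e * (v + u e))%C /\
      Cmod (e - (t + c * t ^ k)) <= K * Cmod t ^ (k + 1)) ->
  exists cv, RP_curve U f cv /\ limit_direction f cv (Some v).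
Proof.
  intros hU hU0 hf f0 tid hu u0 hc hk hd inv.
  set (Y := fun t => (t * (v + u t))%C). set (E := fun t => fst (f (t, Y t))).
  assert (hE : forall t, Cmod t < d -> f (t, Y t) = (E t, Y (E t)) /\
    Cmod (E t - (t + c * t ^ k)) <= K * Cmod t ^ (k + 1)).
  { intros t ht. destruct (inv t ht) as (e & e1 & e2).
    assert (ee : E t = e) by (unfold E; fold (Y t) in e1; now rewrite e1).
    rewrite ee. now split. }
  assert (hY : hol (fun x _ => Y x)).
  { apply (hol_mult (fun x _ => x) (fun x _ => v + u x)%C); [apply hol_x|].
    apply (hol_plus (fun _ _ => v) (fun x _ => u x)); [apply hol_const|easy]. }
  assert (Y0 : Y (RtoC 0) = 0%C) by (unfold Y; ring).
  destruct (hol_dx _ hY) as (Y' & _ & dY & hdY & derY).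
  assert (nU := hU O2 hU0). apply locally_O2 in nU.
  destruct (near_at0 _ (near_snd0 _ Y hY Y0 nU)) as (dU & hdU & inU).
  destruct (attracting_petal E c k K d hc hk hd (fun t ht => proj2 (hE t ht)) (Rmin d (Rmin dU dY)))
    as (D & D1 & D2 & D3 & D4 & D5).
  { apply Rmin_glb_lt; [easy|now apply Rmin_glb_lt]. }
  rmin_bounds.
  assert (small : forall t, D t -> Cmod t < d /\ Cmod t < dU /\ Cmod t < dY).
  { intros t ht. destruct (D4 t ht) as (_ & h & _). lra. }
  assert (pet : petal D E).
  { split; auto; intros t ht; now apply D4. }
  set (phi := fun t => (t, Y t) : C2).
  assert (tc : transverse_curve D E C2 U f O2 (fun x y => fst (f (x, y))) (fun x y => snd (f (x, y))) Y phi).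
  { split; auto.
    - apply centered_chart_C2.
    - exists 1. split; [lra|]. intros x y _ _. rewrite !par_C2_O2. apply surjective_pairing.
    - intros t _. symmetry. apply par_C2_O2.
    - intros t ht e. destruct (D4 t ht) as (t0 & _). apply t0. exact (f_equal fst e).
    - intros t ht. exists (fun s => (s - t, Y s - Y t)%C). split.
      + unfold O2. f_equal; ring.
      + destruct (small t ht) as (_ & _ & ht'). apply locally_C.
        exists (dY - Cmod t). split; [lra|]. intros s hs.
        assert (hs' : Cmod s < dY).
        { replace s with (s - t + t)%C by ring. eapply Rle_lt_trans; [apply Cmod_triangle|]. lra. }
        split; [|split].
        * unfold phi. simpl. f_equal; ring.
        * exists (RtoC 1). apply cder_is_derive. apply cder_exact. intros. simpl. ring.
        * exists (Y' s (RtoC 0)). apply cder_is_derive.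
          specialize (derY s (RtoC 0) hs' ltac:(now rewrite Cmod_0)). intros eps he.
          destruct (derY eps he) as (dd & hdd & h). exists dd. split; [easy|]. intros w hw. simpl.
          replace (Y (s + w) - Y t - (Y s - Y t) - Y' s 0 * w)%C with (Y (s + w) - Y s - Y' s 0 * w)%C by ring.
          now apply h.
    - intros s t _ _ e. exact (f_equal fst e).
    - intros t ht. destruct (small t ht) as (s1 & s2 & _). split; [now apply inU|]. now apply hE.
    - exists d. split; [easy|]. intros t _ ht. destruct (hE t ht) as [e _]. split; [easy|].
      exact (f_equal snd e). }
  exists (Curve D phi). split; [split; [|split]|].
  - exact (transverse_parabolic D E pet C2 U f O2 _ _ Y phi tc).
  - intros h _. exact (transverse_can_blow_up D E pet h C2 U f O2 _ _ Y phi tc).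
  - destruct hY as (r & N & a & hr & hN & hs).
    exists (fun n => (if Nat.eq_dec n 1 then RtoC 1 else RtoC 0, a n O)).
    intros h hh. exists r, (N / r ^ (h + 1)). split; [easy|]. intros t ht htr.
    simpl in ht. cbn [cmap phi fst snd].
    assert (N0 : 0 <= N) by apply (hN O).
    assert (K0 : 0 <= N / r ^ (h + 1) * Cmod t ^ (h + 1)).
    { apply Rmult_le_pos; [|apply pow_le, Cmod_ge_0]. apply Rdiv_le_0_compat; [easy|now apply pow_lt]. }
    split.
    + rewrite sum_n_csum. destruct h as [|h]; [lia|].
      rewrite !csum_shift. rewrite csum_0.
      * simpl Nat.eq_dec. simpl. replace (t - (0 * 1 + (1 * (t * 1) + 0)))%C with (RtoC 0) by ring.
        rewrite Cmod_0. exact K0.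
      * intros q hq. destruct (Nat.eq_dec (S (S q)) 1); [lia|]. ring.
    + rewrite sum_n_csum. replace (S h) with (h + 1)%nat by lia.
      assert (T := pser_tail (fun n => a n O) r N t (Y t) (h + 1) hr).
      apply Rle_trans with (N * (Cmod t / r) ^ (h + 1)).
      * apply T; [|lra|].
        -- intros n. apply Rle_trans with (2 := hN n). apply rsum_le. intros q _.
           apply Rmult_le_compat_r; [apply pow_le; lra|]. unfold hn. cbn [rsum].
           rewrite Nat.sub_diag. assert (0 <= rsum (fun i => Cmod (a i (q - i)%nat)) q)
             by (apply rsum_ge0; intros; apply Cmod_ge_0). lra.
        -- apply ser_ext with (fun n => hom a n t 0).
           ++ intros n. unfold hom. cbn [csum]. rewrite csum_0.
              ** rewrite Nat.sub_diag. simpl. ring.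
              ** intros q hq. replace (n - q)%nat with (S (n - q - 1)) by lia. simpl. ring.
           ++ apply (hs t (RtoC 0)); [lra|rewrite Cmod_0; lra].
      * apply Req_le. unfold Rdiv. rewrite Rpow_mult_distr, pow_inv. ring.
  (* In the chart at [1 : v] the lifted orbit is (s, u s), with s running through the iterates of E,
     which tend to 0. *)
  - intros t ht. simpl in ht. cbn [cmap].
    intros P hP.
    destruct (curve_limit D (blowup C2 O2) (dir v) u (fun t => over (M := C2) O2 (phi t) None) P hu u0) as (dl & hdl & hl).
    + intros s hs. rewrite par_dir. unfold phi, Y. rewrite (Cplus_comm (u s)).
      apply (over_indep C2 O2). intros e. apply (petal_nz D E pet s hs). exact (f_equal fst e).
    + exact hP.
    + destruct (petal_lim D E pet t ht dl hdl) as [n0 hn0]. exists n0. intros n hn.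
      rewrite (iter_curve D E pet C2 f phi t (fun t ht => proj2 (tc_inv _ _ _ _ _ _ _ _ _ _ tc t ht)) ht).
      apply hl; [now apply petal_iter|now apply hn0].
Qed.

(* The germ [f] is given by an arbitrary representative, holomorphic on an open
   neighbourhood [U] of the origin. *)
Theorem proposition1p2 (U : C2 -> Prop) (f : C2 -> C2)
  (hU : open (U : C * C -> Prop)) (hU0 : U O2)
  (hf : forall p : C2, U p -> holomorphic_map p f)
  (hexp : Phi_ge2 f)
  (hdic : dicritical U f) :
  exists c : nat -> curve,
    (forall n, RP_curve U f (c n)) /\
    (forall i j, i <> j -> ~ same_petal U f (c i) (c j)).
Proof.
  destruct hdic as (hid & f' & hlift & hnt).
  assert (hid' : ~ locally (O2 : C * C) (fun p => f p = p)).
  { intros h. apply hid. apply locally_O2. apply locally_O2 in h.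
    apply near_imp with (2 := h). intros x y e. now rewrite par_C2_O2. }
  destruct (exp_leading f hexp hid') as (X & k & b & r & N & hX & hX1 & hX2 & f0 & hk & hb & hv & nz).
  destruct (hf O2 hU0) as (G & g1 & g2 & _ & gr). rewrite f0 in gr.
  apply locally_O2 in gr.
  assert (gr' : near (fun x y => f (x, y) = G (x, y))).
  { apply near_imp with (2 := gr). intros x y e. rewrite par_C2_O2 in e. rewrite e.
    rewrite (surjective_pairing (G (x, y))) at 1. now rewrite par_C2_O2, <- surjective_pairing. }
  apply holomorphic2_hol, hol_at_O2 in g1, g2.
  assert (hf1 : hol (fun x y => fst (f (x, y)))).
  { apply hol_ext with (2 := g1). apply near_imp with (2 := gr'). now intros x y ->. }
  assert (hf2 : hol (fun x y => snd (f (x, y)))).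
  { apply hol_ext with (2 := g2). apply near_imp with (2 := gr'). now intros x y ->. }
  assert (nU := hU O2 hU0). apply locally_O2 in nU.
  assert (euler : forall v, hom (b false) k (RtoC 1) v = (v * hom (b true) k (RtoC 1) v)%C).
  { intros v. apply NNPP. intros ne. apply (hnt (Some v)).
    now apply (nondegenerate_tangential X f k b r N hX hX1 hX2 f0 hk hb hv U f' v). }
  (* If the first leading component vanished, the Euler condition would make the second vanish too,
     against the choice of k. *)
  assert (nzt : exists i j, (i + j = k)%nat /\ b true i j <> RtoC 0).
  { apply NNPP. intros no.
    assert (zt : forall i j, (i + j = k)%nat -> b true i j = RtoC 0).
    { intros i j e. apply NNPP. intros ne. apply no. now exists i, j. }
    assert (lt : forall v, hom (b true) k (RtoC 1) v = RtoC 0).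
    { intros v. apply csum_0. intros i hi. rewrite zt by lia. ring. }
    assert (zf := hom_vanish_poly (b false) k ltac:(intros v; rewrite euler, lt; ring)).
    destruct nz as ([|] & i & j & e & ne); apply ne; [now apply zt|now apply zf]. }
  destruct (hom_nonvanishing _ _ nzt) as (d & hd & nv).
  (* Pairwise distinct slopes in the punctured disc where the leading part has no zero; the shift by
     2 keeps them below d. *)
  set (v := fun i : nat => (d / INR (i + 2))%R).
  assert (vp : forall i : nat, (0 < v i < d)%R).
  { intros i. assert (h : (2 <= INR (i + 2))%R) by (change 2%R with (INR 2); apply le_INR; lia).
    unfold v. split; [apply Rdiv_lt_0_compat; lra|].
    apply Rmult_lt_reg_r with (INR (i + 2)); [lra|].
    replace (d / INR (i + 2) * INR (i + 2))%R with d by (field; lra). nra. }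
  assert (curves : forall i, exists c, RP_curve U f c /\ limit_direction f c (Some (RtoC (v i)))).
  { intros i. assert (hc : hom (b true) k (RtoC 1) (v i) <> RtoC 0).
    { apply nv. specialize (vp i). rewrite Cmod_real; lra. }
    destruct (leaf X f k b r N hX hX1 hX2 f0 hk hb hv (v i) euler hc) as (u & dl & K & hu & u0 & hdl & inv).
    apply (RP_curve_of_leaf U f u (v i) _ k dl K hU hU0 hf f0
      (exp_tangent_id X f k b r N hX hX1 hX2 f0 hk hb hv hf1 hf2) hu u0 hc hk hdl inv). }
  destruct (choice_nat _ curves) as [c hc]. exists c. split; [intros n; apply hc|].
  intros i j ne same. apply ne.
  destruct (hc i) as [_ li]. destruct (hc j) as [rj lj].
  apply (same_petal_direction U f (c i) (c j) (RtoC (v i)) same) in li.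
  destruct (RP_limit_direction U f (c j) rj) as (_ & _ & nj).
  destruct rj as ((_ & _ & _ & bd & _) & _).
  destruct (bd (fun _ => True)) as [[t [_ ht]] _]; [now exists (mkposreal 1 Rlt_0_1)|].
  (* Both limit directions are read along a single orbit, on the curve [c j]. *)
  assert (e := direction_unique _ _ _ (nj t ht) (li t ht) (lj t ht)).
  assert (e' : v j = v i) by (apply RtoC_inj; congruence).
  unfold v in e'. assert (vi := vp i). assert (vj := vp j).
  assert (hi : INR (i + 2) <> 0%R) by (apply not_0_INR; lia).
  assert (hj : INR (j + 2) <> 0%R) by (apply not_0_INR; lia).
  assert (e2 : INR (i + 2) = INR (j + 2)).
  { apply Rmult_eq_reg_l with d; [|lra].
    replace (d * INR (i + 2))%R with (d / INR (j + 2) * INR (j + 2) * INR (i + 2))%R by (field; easy).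
    rewrite e'. field. easy. }
  apply INR_eq in e2. lia.
Qed.
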